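(* Assume the setting below. Let $\mathcal{X},\mathcal{Y}\subseteq\mathcal{A}$ be disjoint, let $\tilde P=P^{\mathcal{X}}_{\mathcal{Y}}$, $\tilde K$, $\tilde{\boldsymbol{\tau}}$, $\tilde{\boldsymbol{\zeta}}$ be as defined below. Assume (1) $\mathcal{X}=\mathcal{S}\cup\mathcal{C}$ where $\tilde\zeta_j<1$ for all $j\in\mathcal{S}$ and $\tilde\zeta_j=1$ for all $j\in\mathcal{C}$, and (2) $\tilde\zeta_j<1$ for all $j\in\mathcal{Y}$. Let $\tilde M$ be the submatrix of $\mathcal{H}_{\tilde K}(\tilde{\boldsymbol{\tau}})^{-1}$ formed by the rows and columns indexed by $\mathcal{C}$. Then, as $n\to+\infty$, \[ \mathbb{P}\big(m\succ_{\boldsymbol{\alpha}}\mathcal{X}\wedge m\preccurlyeq_{\boldsymbol{\alpha}}\mathcal{Y}\big)\sim \frac{\tilde P(\tilde{\boldsymbol{\zeta}})^n}{\prod_{j\in\mathcal{S}}\tilde\zeta_j^{\lceil\beta_jn\rceil-1}\prod_{j\in\mathcal{Y}}\tilde\zeta_j^{\lfloor\alpha_jn\rfloor}}\cdot\frac{1}{\prod_{j\in\mathcal{S}\cup\mathcal{Y}}(1-\tilde\zeta_j)}\cdot\frac{1}{\sqrt{(2\pi)^{|\mathcal{X}\cup\mathcal{Y}|}\,n^{|\mathcal{S}\cup\mathcal{Y}|}\det(\mathcal{H}_{\tilde K}(\tilde{\boldsymbol{\tau}}))}}\int_{(0,+\infty)^{|\mathcal{C}|}}e^{-\mathbf{u}^T\tilde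 M\mathbf{u}/2}\,d\mathbf{u}. \]
   Context: Fix an integer $m\ge 2$ of candidates $\{1,\dots,m\}$ and let $\mathcal{A}=\{1,\dots,m-1\}$. There are $n$ voters; each voter independently draws a strict ranking $r$ of the candidates with probability $p_r$, where $p_r>0$ for each of the $m!$ rankings and $\sum_r p_r=1$ (independent of $n$). For $\mathcal{Z}\subseteq\mathcal{A}$, let $p_{\mathcal{Z}}$ be the probability that, in a random ranking, the set of adversaries ranked above $m$ is exactly $\mathcal{Z}$; let $P(\mathbf{x})=\sum_{\mathcal{Z}\subseteq\mathcal{A}} p_{\mathcal{Z}}\prod_{j\in\mathcal{Z}}x_j$. Fix $\boldsymbol{\alpha}\in(0,1)^{m-1}$, $\boldsymbol{\beta}=\mathbf{1}-\boldsymbol{\alpha}$. For $j\in\mathcal{A}$, write $m\succ_{\boldsymbol\alpha} j$ if strictly more than $\alpha_jn$ voters rank $m$ above $j$, and $m\preccurlyeq_{\boldsymbol\alpha} j$ otherwise (at most $\alpha_jn$ voters rank $m$ above $j$); $m\succ_{\boldsymbol\alpha}\mathcal{X}$ means $m\succ_{\boldsymbol\alpha}j$ for all $j\in\mathcal{X}$, and similarly for $m\preccurlyeq_{\boldsymbol\alpha}\mathcal{Y}$. For disjoint $\mathcal{X},\mathcal{Y}\subseteq\mathcal{A}$ define the polynomial in variables $(x_j)_{j\in\mathcal{X}},(y_j)_{j\in\mathcal{Y}}$: $P^{\mathcal{X}}_{\mathcal{Y}}(\mathbf{x}_{\mathcal{X}},\mathbf{y}_{\mathcal{Y}})=\big(\prod_{j\in\mathcal{Y}}y_j\big)\,P(\mathbf{x}')$,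 where $x'_j=x_j$ for $j\in\mathcal{X}$, $x'_j=1/y_j$ for $j\in\mathcal{Y}$, and $x'_j=1$ otherwise. Let $\tilde K(\mathbf{t})=\log P^{\mathcal{X}}_{\mathcal{Y}}(e^{\mathbf{t}})$ for $\mathbf{t}\in\mathbb{R}^{|\mathcal{X}\cup\mathcal{Y}|}$, let $\tilde{\boldsymbol\tau}$ be the maximizer of $\mathbf{t}\mapsto-\tilde K(\mathbf{t})+(\boldsymbol\beta_{\mathcal{X}},\boldsymbol\alpha_{\mathcal{Y}})^T\mathbf{t}$ (the vector of thresholds is $\beta_j$ on coordinates $j\in\mathcal{X}$ and $\alpha_j$ on coordinates $j\in\mathcal{Y}$), and $\tilde{\boldsymbol\zeta}=e^{\tilde{\boldsymbol\tau}}$ componentwise (the saddle point associated with $\mathbb{P}(m\succ_{\boldsymbol\alpha}\mathcal{X}\wedge m\preccurlyeq_{\boldsymbol\alpha}\mathcal{Y})$); $\mathcal{H}_{\tilde K}(\tilde{\boldsymbol\tau})$ is the Hessian of $\tilde K$ at $\tilde{\boldsymbol\tau}$. When $\mathcal{C}=\emptyset$ the integral is interpreted as $1$. *)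

(* Defs.v *)
From HB Require Import structures.
From mathcomp Require Import all_boot all_order all_algebra all_fingroup.
From mathcomp Require Import all_classical all_reals all_analysis.
Unset Printing Implicit Defensive.
Import Order.TTheory GRing.Theory Num.Theory.
Import numFieldNormedType.Exports.
Local Open Scope ring_scope.
Local Open Scope classical_set_scope.

(* Candidates are 'I_k.+1 (m = k+1); candidate m is [ord_max];
   adversaries 1..m-1 are 'I_k, embedded by [widen_ord].
   A ranking r : {perm 'I_k.+1} maps each candidate c to its position r c
   (position 0 = top). *)
Section Setting.
Variable R : realType.
Variable k : nat.

Definition ranking := {perm 'I_k.+1}.
Definition cand_m : 'I_k.+1 := ord_max.
Definition adv (j : 'I_k) : 'I_k.+1 := widen_ord (leqnSn k) j.

Definition ranks_above (r : ranking) (a b : 'I_k.+1) : bool := (nat_of_ord (r a) < nat_of_ord (r b))%N.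

Definition above_m (r : ranking) : {set 'I_k} :=
  [set j | ranks_above r (adv j) cand_m].

Variable p : ranking -> R.

Definition pZ (Z : {set 'I_k}) : R := \sum_(r : ranking | above_m r == Z) p r.

Definition Ppoly (x : 'I_k -> R) : R :=
  \sum_(Z : {set 'I_k}) pZ Z * \prod_(j in Z) x j.

(* P^X_Y(z) where z_j plays x_j for j in X and y_j for j in Y
   (other coordinates of z are ignored). *)
Definition PXY (X Y : {set 'I_k}) (z : 'I_k -> R) : R :=
  (\prod_(j in Y) z j) *
  Ppoly (fun j => if j \in X then z j else if j \in Y then (z j)^-1 else 1).

Definition XYidx (X Y : {set 'I_k}) (i : 'I_#|X :|: Y|) : 'I_k :=
  @enum_val _ (mem (X :|: Y)) i.

(* coordinate of t attached to adversary j (0 if j is not in X :|: Y) *)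
Definition tcoord (X Y : {set 'I_k}) (t : 'rV[R]_#|X :|: Y|) (j : 'I_k) : R :=
  \sum_(i < #|X :|: Y| | XYidx X Y i == j) t ord0 i.

Definition Ktilde (X Y : {set 'I_k}) (t : 'rV[R]_#|X :|: Y|) : R :=
  ln (PXY X Y (fun j => expR (tcoord X Y t j))).

Definition objective (alpha : 'I_k -> R) (X Y : {set 'I_k})
  (t : 'rV[R]_#|X :|: Y|) : R :=
  - Ktilde X Y t +
  \sum_(i < #|X :|: Y|)
     (if XYidx X Y i \in X then 1 - alpha (XYidx X Y i)
      else alpha (XYidx X Y i)) * t ord0 i.

Definition hessian (X Y : {set 'I_k}) (tau : 'rV[R]_#|X :|: Y|)
  : 'M[R]_#|X :|: Y| :=
  \matrix_(i, j)
    derive (fun t => derive (Ktilde X Y) t (delta_mx ord0 j)) tau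
           (delta_mx ord0 i).

Definition zeta_of (X Y : {set 'I_k}) (tau : 'rV[R]_#|X :|: Y|) (j : 'I_k) : R :=
  expR (tcoord X Y tau j).

Definition nb_m_above (n : nat) (prof : n.-tuple ranking) (j : 'I_k) : nat :=
  #|[set i : 'I_n | ranks_above (tnth prof i) cand_m (adv j)]|.

Definition event (alpha : 'I_k -> R) (X Y : {set 'I_k}) (n : nat)
  (prof : n.-tuple ranking) : bool :=
  [forall j in X, alpha j * n%:R < (nb_m_above n prof j)%:R] &&
  [forall j in Y, (nb_m_above n prof j)%:R <= alpha j * n%:R].

Definition prob_event (alpha : 'I_k -> R) (X Y : {set 'I_k}) (n : nat) : R :=
  \sum_(prof : n.-tuple ranking)
     (\prod_(i < n) p (tnth prof i)) * (event alpha X Y n prof)%:R.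

End Setting.

Local Open Scope ereal_scope.
(* Iterated Lebesgue integral over (0,+oo)^c of a nonnegative function of
   u : nat -> R (only coordinates 0..c-1 are used); for c = 0 it is g 0.
   By Tonelli this is the integral over (0,+oo)^c w.r.t. Lebesgue measure. *)
Fixpoint orthant_integral {R : realType} (c : nat)
  (g : (nat -> R) -> \bar R) : \bar R :=
  match c with
  | 0 => g (fun _ => 0%R)
  | c'.+1 =>
      \int[@lebesgue_measure R]_(x in `]0%R, +oo[)
        orthant_integral c' (fun u => g (fun i => if i == c' then x else u i))
  end.
Local Close Scope ereal_scope.

Definition asym_equiv {R : realType} (f g : nat -> R) : Prop :=
  (fun n => f n / g n) @ \oo --> (1 : R).

(* Main.v *)
Require Import Defs.
From HB Require Import structures.
From mathcomp Require Import all_boot all_order all_algebra all_fingroup.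
From mathcomp Require Import all_classical all_reals all_analysis.
From mathcomp Require Import measurable_realfun.
From mathcomp Require Import ring lra zify.
Import Order.TTheory GRing.Theory Num.Theory.
Import numFieldNormedType.Exports.
Set Implicit Arguments.
Unset Strict Implicit.
Unset Printing Implicit Defensive.
Local Open Scope ring_scope.

(* Record, for each voter, which adversaries of X are above m and which
   adversaries of Y are not.  Tilting the law of these 0/1-vectors by tau gives
   mean (beta_X, alpha_Y) and covariance H, and turns the probability into
   P(zeta)^n zeta^(-w) T^n f (w), where T is the transition operator of the
   lattice walk with the tilted steps, f(x) is the product of the zeta_i^(x_i)
   over the nonnegative orthant, and w is the integer threshold.  What remains
   is a local limit theorem for T^n f (w), obtained without Fourier transform.
   Each backward difference is made smaller by T^n by a factor n^(-1/2); since
   f is an iterated difference, along S and Y, of a bounded function, T^n f is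
   O(n^(-|S u Y|/2)).  Hence exchanging the walk steps one by one for steps of
   a Gaussian kernel, at cost O(j^(-3/2)) for the j-th one, leaves a relative
   error tending to 0.  The final Gaussian sum is a product of geometric series
   along S and Y and a Riemann sum of the orthant integral along C. *)

(** The exchange of steps cannot be carried back to the start of the walk: the costs from step j on
    add up to O(j^(-1/2)), so it has to stop at a fixed large j. The j steps left over are settled
    otherwise. Differences of T^n f are smaller by n^(-1/2) than the bound on T^n f itself, so
    averaging it against a fixed kernel of j steps multiplies it by the mass of that kernel, up to a
    negligible error. That mass is close to the Gaussian integral once j is large. A second obstacle
    is that every cost must be small relative to n^(-|S u Y|/2). While many walk steps remain, their
    smoothing provides this factor; near the end T^m f is no longer small pointwise, and the factor
    comes instead from the summability of f along S and Y. The gain n^(-1/2) rests on p_r > 0: every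
    0/1-vector then has positive probability, so a fixed share of each step is a fair choice between
    staying and moving by one in direction i, and summation by parts for the binomial law applies.
    The same positivity makes the covariance invertible. *)

Ltac nng := repeat first [ assumption | exact: ler0n | exact: normr_ge0 | exact: expR_ge0
  | exact: sqrtr_ge0 | exact: sqr_ge0 | exact: ler01 | (apply: ltW; assumption)
  | apply: mulr_ge0 | apply: addr_ge0 | apply: exprn_ge0 | (rewrite invr_ge0)
  | (apply: sumr_ge0 => ? _) | (apply: prodr_ge0 => ? _) ].

(** * Binomial sums *)

Lemma sum_binS (R : pzRingType) N (G : nat -> R) :
  \sum_(k < N.+2) 'C(N.+1, k)%:R * G k =
  \sum_(k < N.+1) 'C(N, k)%:R * (G k + G k.+1).
Proof.
rewrite big_ord_recl bin0 mul1r.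
under eq_bigr do rewrite /= /bump /= add1n binS natrD mulrDl.
rewrite big_split /= addrA.
under [RHS]eq_bigr do rewrite mulrDr.
rewrite [RHS]big_split /=; congr (_ + _).
rewrite big_ord_recr /= bin_small // mul0r addr0.
by rewrite [RHS]big_ord_recl bin0 mul1r; under [in RHS]eq_bigr do rewrite /= /bump /= add1n.
Qed.

(** With k minus signs, a sum of N signs equals N - 2k: this is the variance N of a sum of N fair
    signs, multiplied by the number 2^N of sign choices. *)
Lemma binomial_second_moment (R : comPzRingType) N :
  \sum_(k < N.+1) 'C(N, k)%:R * (N%:R - 2 * k%:R) ^+ 2 = N%:R * 2 ^+ N :> R.
Proof.
elim: N => [|N IH]; first by rewrite big_ord1 bin0 /=; ring.
rewrite (@sum_binS R N (fun k => (N.+1%:R - 2 * k%:R) ^+ 2)).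
have -> : \sum_(k < N.+1) 'C(N, k)%:R * ((N.+1%:R - 2 * k%:R) ^+ 2 +
    (N.+1%:R - 2 * k.+1%:R) ^+ 2) =
  \sum_(k < N.+1) (2 * ('C(N, k)%:R * (N%:R - 2 * k%:R) ^+ 2) +
     2 * 'C(N, k)%:R) :> R.
  by apply: eq_bigr => k _; rewrite -!natr1; ring.
rewrite big_split /= -!mulr_sumr IH -natr_sum.
have -> : (\sum_(i < N.+1) 'C(N, i) = 2 ^ N)%N.
  rewrite -[2%N]/(1 + 1)%N expnDn; apply: eq_bigr => i _.
  by rewrite !exp1n !muln1.
by rewrite natrX exprS -natr1; ring.
Qed.

(** Summation by parts, from (k+1) C(N,k+1) = (N-k) C(N,k). It trades a difference of [F] for the
    factor (N+1-2k)/(N+1), typically of size N^(-1/2): the source of every gain of n^(-1/2)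
    below. *)
Lemma sum_bin_diff (R : comPzRingType) N (F : nat -> R) :
  \sum_(k < N.+2) 'C(N.+1, k)%:R * ((N.+1%:R - 2 * k%:R) * F k) =
  N.+1%:R * \sum_(k < N.+1) 'C(N, k)%:R * (F k - F k.+1).
Proof.
rewrite (@sum_binS R N (fun k => (N.+1%:R - 2 * k%:R) * F k)) mulr_sumr.
have E : \sum_(k < N.+1) (k%:R * 'C(N, k)%:R) * F k =
         \sum_(k < N.+1) ((N%:R - k%:R) * 'C(N, k)%:R) * F k.+1.
  rewrite big_ord_recl !mul0r add0r big_ord_recr /= subrr !mul0r addr0.
  apply: eq_bigr => i _; rewrite /bump /= add1n; congr (_ * _).
  by rewrite -natrM mul_bin_left natrM natrB // ltnW.
apply/eqP; rewrite -subr_eq0 -sumrB.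
rewrite [X in X == 0](_ : _ = - 2 * (\sum_(k < N.+1) (k%:R * 'C(N, k)%:R) * F k -
    \sum_(k < N.+1) ((N%:R - k%:R) * 'C(N, k)%:R) * F k.+1)); last first.
  rewrite -sumrB mulr_sumr; apply: eq_bigr => k _; rewrite -!natr1; ring.
by rewrite E subrr mulr0.
Qed.

(** * Smoothing of lattice walks *)

Notation pattern d := {ffun 'I_d -> bool}.
Notation lattice d := {ffun 'I_d -> int}.

Definition stepv {d} (b : pattern d) : lattice d := [ffun i => (b i : nat)%:Z].
Definition unitp {d} (i : 'I_d) : pattern d := [ffun j => j == i].
Definition nopat {d} : pattern d := [ffun => false].

(* The weights need not be nonnegative: backward differences are weighted
   averages too, hence commute with the transition operator of the walk. *)
Definition wavg {R : realType} {d} (q : pattern d -> R) (f : lattice d -> R) :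
    lattice d -> R :=
  fun x => \sum_b q b * f (x - stepv b).

Definition diffw (R : realType) d (i : 'I_d) (b : pattern d) : R :=
  (b == nopat)%:R - (b == unitp i)%:R.
Notation bdiff i := (wavg (diffw _ i)).

Section WeightedAverages.
Context {R : realType} {d : nat}.
Implicit Types (q : pattern d -> R) (f : lattice d -> R).

Lemma stepv_nopat : stepv nopat = 0 :> lattice d.
Proof. by apply/ffunP => i; rewrite !ffunE. Qed.

Lemma nopat_unitp (i : 'I_d) : (nopat == unitp i) = false.
Proof. by apply/eqP => /ffunP/(_ i); rewrite !ffunE eqxx. Qed.

Lemma wavgC q q' f : wavg q (wavg q' f) = wavg q' (wavg q f).
Proof.
apply/funext => x; rewrite /wavg.
under eq_bigr do rewrite mulr_sumr; rewrite exchange_big /=.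
apply: eq_bigr => b _; rewrite mulr_sumr; apply: eq_bigr => c _.
by rewrite mulrCA -!addrA [- stepv c - _]addrC.
Qed.

Lemma iter_wavgC n q q' f : iter n (wavg q) (wavg q' f) = wavg q' (iter n (wavg q) f).
Proof. by elim: n => //= n ->; rewrite wavgC. Qed.

Lemma wavg_bound q f (K : R) : (forall x, `|f x| <= K) ->
  forall x, `|wavg q f x| <= (\sum_b `|q b|) * K.
Proof.
move=> fK x; rewrite mulr_suml; apply: le_trans (ler_norm_sum _ _ _) _.
by apply: ler_sum => b _; rewrite normrM ler_wpM2l.
Qed.

Lemma wavgDl a a' q q' f x :
  wavg (fun b => a * q b + a' * q' b) f x = a * wavg q f x + a' * wavg q' f x.
Proof.
rewrite /wavg !mulr_sumr -big_split /=; apply: eq_bigr => b _; ring.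
Qed.

Lemma wavg_lin q a a' f f' x :
  wavg q (fun y => a * f y + a' * f' y) x = a * wavg q f x + a' * wavg q f' x.
Proof.
rewrite /wavg !mulr_sumr -big_split /=; apply: eq_bigr => b _; ring.
Qed.

Lemma iter_wavg_lin n q a a' f f' x :
  iter n (wavg q) (fun y => a * f y + a' * f' y) x =
  a * iter n (wavg q) f x + a' * iter n (wavg q) f' x.
Proof.
elim: n x => //= n IH x; rewrite -wavg_lin; congr (wavg q _ x).
exact/funext.
Qed.

Lemma wavg_delta c f x : wavg (fun b => (b == c)%:R) f x = f (x - stepv c).
Proof.
rewrite /wavg (bigD1 c) //= eqxx mul1r big1 ?addr0 // => b /negPf ->.
by rewrite mul0r.
Qed.

Lemma bdiffE i f x : bdiff i f x = f x - f (x - stepv (unitp i)).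
Proof.
rewrite -[in RHS](wavg_delta (unitp i)) -{1}[x in RHS]subr0 -stepv_nopat -[in RHS](wavg_delta nopat).
have := wavgDl 1 (- 1) (fun b => (b == nopat)%:R) (fun b => (b == unitp i)%:R) f x.
rewrite mul1r mulN1r => <-; congr (wavg _ _ _); apply/funext => b.
by rewrite mul1r mulN1r.
Qed.

End WeightedAverages.

Definition halfw (R : realType) d (i : 'I_d) (b : pattern d) : R :=
  ((b == nopat)%:R + (b == unitp i)%:R) / 2.

Lemma inv_sqrt_le (R : realType) (a b : nat) : (0 < a)%N -> (b <= 4 * a)%N -> (0 < b)%N ->
  (Num.sqrt a%:R)^-1 <= 2 / Num.sqrt b%:R :> R.
Proof.
move=> a0 ba b0.
have sa : 0 < Num.sqrt (a%:R : R) by rewrite sqrtr_gt0 ltr0n.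
have sb : 0 < Num.sqrt (b%:R : R) by rewrite sqrtr_gt0 ltr0n.
rewrite -[2 / _]invf_div lef_pV2 ?posrE ?divr_gt0 // ler_pdivrMr //.
rewrite -[X in _ * X]ger0_norm // -sqrtr_sqr mulrC -sqrtrM ?sqr_ge0 //.
by rewrite ler_wsqrtr // -natrX -natrM ler_nat.
Qed.

Section Smoothing.
Context {R : realType} {d : nat}.
Variable q : pattern d -> R.
Hypothesis q_gt0 : forall b, 0 < q b.
Hypothesis q_sum1 : \sum_b q b = 1.
Implicit Types f : lattice d -> R.

Lemma sum_norm_law : \sum_b `|q b| = 1.
Proof. by rewrite -q_sum1; apply: eq_bigr => b _; rewrite gtr0_norm. Qed.

Lemma wavg_bound1 f (K : R) : (forall x, `|f x| <= K) -> forall x, `|wavg q f x| <= K.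
Proof. by move=> /wavg_bound h x; have := h q x; rewrite sum_norm_law mul1r. Qed.

Lemma iter_wavg_bound n f (K : R) :
  (forall x, `|f x| <= K) -> forall x, `|iter n (wavg q) f x| <= K.
Proof. by move=> fK; elim: n => //= n IH; apply: wavg_bound1. Qed.

Lemma halfwE i f x : wavg (halfw R i) f x = (f x + f (x - stepv (unitp i))) / 2.
Proof.
rewrite -[in RHS](wavg_delta (unitp i)) -{1}[x in RHS]subr0 -stepv_nopat -[in RHS](wavg_delta nopat).
rewrite mulrDl ![_ / 2]mulrC -wavgDl; congr (wavg _ _ _); apply/funext => b.
by rewrite /halfw; ring.
Qed.

Lemma iter_halfwE i N f x : iter N (wavg (halfw R i)) f x =
  2 ^- N * \sum_(k < N.+1) 'C(N, k)%:R * f (x - stepv (unitp i) *+ k).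
Proof.
elim: N f x => [|N IH] f x.
  by rewrite big_ord1 /= bin0 expr0 invr1 !mul1r mulr0n subr0.
rewrite iterSr IH (sum_binS N (fun k => f (x - stepv (unitp i) *+ k))).
rewrite exprSr invfM mulrAC -mulrA mulr_suml; congr (_ * _).
apply: eq_bigr => k _; rewrite halfwE -mulrA; congr (_ * ((_ + _) / _)).
by rewrite mulrSr opprD addrA.
Qed.

(** Cauchy-Schwarz against the binomial variance, before optimising: lam = sqrt(N+1) gives the order
    N^(-1/2). With [lam] left free the bound is affine in 1/(N+1), hence can be averaged over a
    random number of lazy steps. *)
Lemma halfw_bdiff_bound i N f (K lam : R) : (forall x, `|f x| <= K) -> 0 < lam ->
  forall x, `|iter N (wavg (halfw R i)) (bdiff i f) x| <= K * (lam / N.+1%:R + lam^-1).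
Proof.
move=> fK lam0 x; rewrite iter_halfwE.
have N0 : 0 < N.+1%:R :> R by rewrite ltr0n.
have K0 : 0 <= K by apply: le_trans (fK 0).
have p0 : 0 < 2 ^+ N :> R by rewrite exprn_gt0.
under eq_bigr do rewrite bdiffE -addrA -opprD -mulrSr.
rewrite [X in _ * X](_ : _ = N.+1%:R^-1 * \sum_(k < N.+2) 'C(N.+1, k)%:R *
    ((N.+1%:R - 2 * k%:R) * f (x - stepv (unitp i) *+ k))); last first.
  by rewrite (@sum_bin_diff R N (fun k => f (x - stepv (unitp i) *+ k))) mulKf // gt_eqF.
have B (k : 'I_N.+2) : `|'C(N.+1, k)%:R * ((N.+1%:R - 2 * k%:R) * f (x - stepv (unitp i) *+ k))| <=
   K / 2 * (lam / N.+1%:R * ('C(N.+1, k)%:R * (N.+1%:R - 2 * k%:R) ^+ 2) + N.+1%:R / lam * 'C(N.+1, k)%:R).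
  rewrite !normrM normr_nat.
  set c : R := 'C(_, _)%:R; set u : R := `|_ - _|; rewrite -[(_ - _) ^+ 2]real_normK ?num_real // -/u.
  have c0 : 0 <= c by rewrite ler0n.
  have u0 : 0 <= u by exact: normr_ge0.
  apply: le_trans (_ : c * (u * K) <= _).
    by do 2![apply: ler_wpM2l => //].
  (* 2u <= (lam/(N+1)) u^2 + (N+1)/lam, since the difference is a square. *)
  rewrite -subr_ge0 [X in 0 <= X](_ : _ =
    K / 2 * c * lam / N.+1%:R * (u - N.+1%:R / lam) ^+ 2).
    by nng.
  by field; rewrite !gt_eqF.
rewrite normrM gtr0_norm ?invr_gt0 // ler_pdivrMl //.
rewrite normrM gtr0_norm ?invr_gt0 // ler_pdivrMl //.
apply: le_trans (ler_norm_sum _ _ _) _; apply: le_trans (ler_sum _ (fun k _ => B k)) _.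
rewrite -mulr_sumr big_split /= -!mulr_sumr binomial_second_moment -natr_sum.
have -> : (\sum_(i < N.+2) 'C(N.+1, i) = 2 ^ N.+1)%N.
  rewrite -[2%N]/(1 + 1)%N expnDn; apply: eq_bigr => j _.
  by rewrite !exp1n !muln1.
rewrite natrX exprS le_eqVlt; apply/orP; left; apply/eqP.
by field; rewrite !gt_eqF.
Qed.

Definition laziness (i : 'I_d) : R := Num.min (q nopat) (q (unitp i)).

Lemma laziness_bounds i : 0 < laziness i <= 1.
Proof.
rewrite /laziness lt_min !q_gt0 -q_sum1 (bigD1 nopat) //=.
apply: le_trans (_ : q nopat <= _); first by rewrite ge_min lexx.
by rewrite lerDl sumr_ge0 // => b _; exact/ltW.
Qed.

(** [N] counts the lazy steps already extracted; each of the [m] other steps adds one with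
    probability eta. Convexity of 1/x works against the averaging, so a step is credited with eta/2
    only. *)
Lemma walk_halfw_bdiff_bound i m N f (K lam : R) : (forall x, `|f x| <= K) -> 0 < lam ->
  forall x, `|iter m (wavg q) (iter N (wavg (halfw R i)) (bdiff i f)) x| <=
    K * (lam / (laziness i / 2 * m%:R + N.+1%:R) + lam^-1).
Proof.
set eta := laziness i; move=> fK lam0.
have K0 : 0 <= K by apply: le_trans (fK 0).
have /andP[eta0 eta1] : 0 < eta <= 1 := laziness_bounds i.
elim: m N => [|m IH] N x.
  by rewrite mulr0 add0r; apply: halfw_bdiff_bound.
set G := iter N _ _.
(* Take off from [q] a lazy step in direction [i], of total mass [eta]. *)
pose q' b := 1 * q b + - eta * halfw R i b.
have q'0 b : 0 <= q' b.
  rewrite /q' /halfw mul1r mulNr subr_ge0.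
  have [->|_] := eqVneq b nopat; first rewrite nopat_unitp addr0.
    have : eta <= q nopat by rewrite ge_min lexx.
    by rewrite mulr1n; have := q_gt0 nopat; nra.
  rewrite add0r; have [->|_] := eqVneq b (unitp i).
    have : eta <= q (unitp i) by rewrite ge_min lexx orbT.
    by rewrite mulr1n; have := q_gt0 (unitp i); nra.
  by rewrite mul0r mulr0 ltW.
have sq' : \sum_b `|q' b| = 1 - eta.
  under eq_bigr do rewrite ger0_norm //.
  rewrite big_split /= -!mulr_sumr q_sum1 -mulr_suml big_split /=.
  have D (c : pattern d) : \sum_(b : pattern d) (b == c)%:R = 1 :> R.
    by rewrite (bigD1 c) //= eqxx big1 ?addr0 // => b /negPf ->.
  by rewrite !D; field.
have E : wavg q G = fun y => 1 * wavg q' G y + eta * iter N.+1 (wavg (halfw R i)) (bdiff i f) y.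
  apply/funext => y; rewrite mul1r /q' wavgDl /= -/G; ring.
rewrite iterSr E iter_wavg_lin mul1r iter_wavgC.
apply: le_trans (ler_normD _ _) _.
have := wavg_bound q' (IH N) x; rewrite sq' => h1.
have h2 := IH N.+1 x.
rewrite normrM (gtr0_norm eta0).
apply: le_trans (lerD h1 (ler_wpM2l (ltW eta0) h2)) _.
set a := eta / 2 * m%:R + N.+1%:R.
have a1 : 1 <= a.
  by rewrite /a -[N.+1%:R]natr1 addrA lerDr; nng.
have -> : eta / 2 * m%:R + N.+2%:R = a + 1 by rewrite /a -[N.+2%:R]natr1; ring.
have -> : eta / 2 * m.+1%:R + N.+1%:R = a + eta / 2 by rewrite /a -[m.+1%:R]natr1; ring.
(* The terms in 1/lam cancel; what remains is (1-eta)/a + eta/(a+1) <= 1/(a + eta/2), valid for a >=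
   1. *)
rewrite -subr_ge0 [X in 0 <= X](_ : _ = K * lam * (((a + eta / 2)^-1) - ((1 - eta) / a + eta / (a + 1)))); last first.
  have a0 : 0 < a by lra.
  field; rewrite !gt_eqF //; lra.
have a0 : 0 < a by lra.
rewrite !mulr_ge0 // ?(ltW lam0) //.
rewrite [X in 0 <= X](_ : _ = (eta / 2 * (a - 1 + eta)) / (a * (a + 1) * (a + eta / 2))); last first.
  field; rewrite !gt_eqF //; lra.
by rewrite divr_ge0 ?mulr_ge0 //; lra.
Qed.

Lemma walk_bdiff_bound i : exists2 C : R, 0 <= C & forall m f (K : R), (forall x, `|f x| <= K) ->
  forall x, `|iter m (wavg q) (bdiff i f) x| <= C * K / Num.sqrt m.+1%:R.
Proof.
set eta := laziness i.
have /andP[eta0 eta1] : 0 < eta <= 1 := laziness_bounds i.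
exists (2 / eta + 1); first by nng.
move=> m f K fK x.
have K0 : 0 <= K by apply: le_trans (fK 0).
have m0 : 0 < m.+1%:R :> R by rewrite ltr0n.
(* The value lam = sqrt(m+1) makes both terms of order (m+1)^(-1/2). *)
set s := Num.sqrt _; have s0 : 0 < s by rewrite sqrtr_gt0.
have ss : m.+1%:R = s * s by rewrite -expr2 sqr_sqrtr // ltW.
apply: le_trans (walk_halfw_bdiff_bound i m 0 fK s0 x) _.
rewrite [X in _ <= X](_ : _ = K * ((2 / eta + 1) / s)); last by ring.
apply: ler_wpM2l => //; rewrite -/eta.
rewrite mulrDl mul1r lerD2r.
have h : eta / 2 * (s * s) <= eta / 2 * m%:R + 1 by rewrite -ss -[m.+1%:R]natr1; lra.
have ss0 : 0 < s * s by rewrite mulr_gt0.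
rewrite ler_pdivrMr; last by apply: lt_le_trans h; rewrite !mulr_gt0.
apply: le_trans (ler_wpM2l _ h); last by rewrite !mulr_ge0 ?invr_ge0 // ltW.
by rewrite le_eqVlt; apply/orP; left; apply/eqP; field; rewrite !gt_eqF.
Qed.

Lemma walk_bdiffs_bound (l : seq 'I_d) : exists2 C : R, 0 <= C & forall m F (K : R), (forall x, `|F x| <= K) ->
  forall x, `|iter m (wavg q) (foldr (fun i => bdiff i) F l) x| <=
     C * K / Num.sqrt m.+1%:R ^+ size l.
Proof.
elim: l => [|i l [C C0 IH]].
  exists 1 => // m F K FK x; rewrite mul1r expr0 divr1.
  exact: iter_wavg_bound.
have [D D0 HD] := walk_bdiff_bound i.
exists (D * C * 2 ^+ (size l).+1); first by nng.
move=> m F K FK x /=.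
have K0 : 0 <= K by apply: le_trans (FK 0).
(* One half of the steps smoothes the first difference, the rest the others. *)
rewrite -[in iter m _](@subnK m./2 m) ?half_leqif //; last by lia.
rewrite addnC iterD iter_wavgC.
have := HD m./2 _ _ (IH (m - m./2)%N F K FK) x.
move=> /le_trans; apply.
set s := Num.sqrt m.+1%:R; have s0 : 0 < s by rewrite sqrtr_gt0 ltr0n.
have half (j : nat) : (m.+1 <= 4 * j.+1)%N -> (Num.sqrt j.+1%:R)^-1 <= 2 / s :> R.
  by move=> mj; apply: inv_sqrt_le.
apply: le_trans (_ : D * (C * K * (2 / s) ^+ size l) * (2 / s) <= _).
  apply: ler_pM; rewrite ?mulr_ge0 ?invr_ge0 ?sqrtr_ge0 ?exprn_ge0 //.
    apply: ler_wpM2l => //; apply: ler_wpM2l; first by rewrite mulr_ge0.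
    rewrite -exprVn; apply: lerXn2r; rewrite ?nnegrE ?invr_ge0 ?sqrtr_ge0 //.
      by rewrite divr_ge0 // ltW.
    by apply: half; lia.
  by apply: half; lia.
rewrite !expr_div_n !exprS; have := exprn_gt0 (size l) s0.
move: (2 ^+ _) (s ^+ _) => a b b0; rewrite le_eqVlt; apply/orP; left; apply/eqP.
by field; rewrite !gt_eqF.
Qed.
End Smoothing.

(** * Gaussian estimates *)

Section ExponentialBounds.
Context {R : realType}.
Implicit Types x y : R.

Lemma expR_lipschitz0 x : `|expR x - 1| <= `|x| * expR `|x|.
Proof.
have [x0|x0] := leP 0 x.
  have h : expR x - 1 = expR x * (1 - expR (- x)) by rewrite mulrBr mulr1 -expRD subrr expR0.
  have h2 : 1 - expR (- x) <= x by have := expR_ge1Dx (- x); lra.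
  rewrite !ger0_norm //; last by have := expR_ge1Dx x; lra.
  by rewrite h mulrC; apply: ler_wpM2r => //; exact: expR_ge0.
rewrite ler0_norm; last by rewrite subr_le0 -expR0 ler_expR ltW.
rewrite ltr0_norm //; have := expR_ge1Dx x.
have h : 1 <= expR (- x) by rewrite -[leLHS]expR0 ler_expR; lra.
have : - x * 1 <= - x * expR (- x) by apply: ler_wpM2l => //; lra.
lra.
Qed.

(** Mean value theorem between 0 and x. Giving up the factorials leaves a bound of the same shape,
    so that the Taylor remainders of [expR] follow one from another. *)
Lemma primitive_bound (f f' : R -> R) (k : nat) :
  (forall x, is_derive x 1 f (f' x)) -> f 0 = 0 ->
  (forall x, `|f' x| <= `|x| ^+ k * expR `|x|) ->
  forall x, `|f x| <= `|x| ^+ k.+1 * expR `|x|.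
Proof.
move=> df f0 hf' x.
have cf : continuous f.
  by move=> u; apply: differentiable_continuous; apply/derivable1_diffP; exact: ex_derive.
have step (c : R) : `|c| <= `|x| -> `|f' c| * `|x| <= `|x| ^+ k.+1 * expR `|x|.
  move=> cx; rewrite exprSr mulrAC; apply: ler_wpM2r => //.
  apply: le_trans (hf' c) _; apply: ler_pM; rewrite ?exprn_ge0 ?expR_ge0 ?ler_expR //.
  by apply: lerXn2r; rewrite ?nnegrE.
have mvt (a b : R) : a <= b -> exists2 c : R, c \in `[a, b] & f b - f a = f' c * (b - a).
  by move=> ab; apply: MVT_segment => //; exact: continuous_subspaceT.
have [x0|x0] := leP 0 x.
  have [c] := mvt _ _ x0.
  rewrite in_itv /= => /andP[c0 cx]; rewrite f0 !subr0 => ->.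
  by rewrite normrM; apply: step; rewrite !ger0_norm.
have [c] := mvt _ _ (ltW x0).
rewrite in_itv /= => /andP[c0 cx]; rewrite f0 !sub0r => /eqP.
rewrite eqr_oppLR => /eqP ->; rewrite normrN normrM normrN; apply: step.
by rewrite !ler0_norm ?lerN2 // ltW.
Qed.

Lemma expR_taylor2 x : `|expR x - 1 - x| <= `|x| ^+ 2 * expR `|x|.
Proof.
apply: (@primitive_bound (fun x => expR x - 1 - x) (fun x => expR x - 1)).
- move=> u; have -> : (fun x => expR x - 1 - x) = (expR - cst 1 - id) :> (R -> R) by exact/funext.
  by apply: is_derive_eq; rewrite subr0.
- by rewrite expR0; ring.
- by move=> u; rewrite expr1; exact: expR_lipschitz0.
Qed.

Lemma expR_taylor3 x : `|expR x - 1 - x - x ^+ 2 / 2| <= `|x| ^+ 3 * expR `|x|.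
Proof.
apply: (@primitive_bound (fun x => expR x - 1 - x - x ^+ 2 / 2) (fun x => expR x - 1 - x)).
- move=> u; have -> : (fun x => expR x - 1 - x - x ^+ 2 / 2) =
      (expR - cst 1 - id - 2^-1 *: (id ^+ 2)) :> (R -> R).
    by apply/funext => y; rewrite /= !fctE /GRing.scale /= [in RHS]mulrC.
  apply: is_derive_eq; rewrite subr0 /GRing.scale /= mulr1 expr1; by field.
- by rewrite expR0; field.
- exact: expR_taylor2.
Qed.

Lemma ln1D_bounds x : 0 <= x -> x - x ^+ 2 <= ln (1 + x) <= x.
Proof.
move=> x0; rewrite le_ln1Dx ?andbT; last by lra.
have h : ln (1 + x) = - ln (1 + (- (x / (1 + x)))).
  rewrite -lnV ?posrE; last first.
    have -> : 1 + (- (x / (1 + x))) = (1 + x)^-1 by field; lra.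
    by rewrite invr_gt0; lra.
  by congr ln; field; rewrite ?gt_eqF //; lra.
rewrite h lerNr; apply: le_trans (le_ln1Dx _) _.
  have -> : - (x / (1 + x)) = (1 + x)^-1 - 1 by field; lra.
  have : 0 < (1 + x)^-1 by rewrite invr_gt0; lra.
  by lra.
rewrite lerN2 -subr_ge0 [X in 0 <= X](_ : _ = x ^+ 3 / (1 + x)).
  by rewrite divr_ge0 ?exprn_ge0 //; lra.
by field; lra.
Qed.

Lemma expRN_le x : 0 <= x <= 1 -> x / 2 <= 1 - expR (- x).
Proof.
move=> /andP[x0 x1]; have h := expR_ge1Dx x.
have : expR (- x) <= (1 + x)^-1.
  by rewrite expRN lef_pV2 ?posrE ?expR_gt0 //; lra.
have : (1 + x)^-1 <= 1 - x / 2.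
  rewrite -subr_ge0 [X in 0 <= X](_ : _ = x * (1 - x) / (2 * (1 + x))).
    by rewrite divr_ge0 ?mulr_ge0 //; lra.
  by field; lra.
lra.
Qed.

Lemma poly4_expR x : 0 <= x -> (1 + x) ^+ 4 <= 256 * expR x.
Proof.
move=> x0; have h := expR_ge1Dx (x / 4).
have -> : expR x = expR (x / 4) ^+ 4 by rewrite -expRM_natl; congr expR; field.
have -> : 256 = 4 ^+ 4 :> R by ring.
rewrite -exprMn; apply: lerXn2r; rewrite ?nnegrE; lra.
Qed.

(** 1 + x <= 4 e^(x/4) gives 256 = 4^4 and a factor e^x. The exponent to be bounded is then (a+2) x
    - c x^2, where 2 pays for this e^x and for the e^(-x) kept on the right; its maximum is
    (a+2)^2/(4c). *)
Lemma gauss_absorb (a c x : R) : 0 < c -> 0 <= x ->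
  (1 + x) ^+ 4 * expR (a * x) * expR (- (c * x ^+ 2)) <=
  256 * expR ((a + 2) ^+ 2 / (4 * c)) * expR (- x).
Proof.
move=> c0 x0; rewrite -mulrA -expRD.
apply: le_trans (ler_wpM2r (expR_ge0 _) (poly4_expR x0)) _.
rewrite -!mulrA -!expRD; apply: ler_wpM2l => //; rewrite ler_expR.
rewrite -subr_ge0 [X in 0 <= X](_ : _ = c * (x - (a + 2) / (2 * c)) ^+ 2).
  by nng.
by field; lra.
Qed.

End ExponentialBounds.

(** * Lattice sums over cubes *)

Section Boxes.
Context {d : nat}.
Implicit Types (M : nat) (x y : lattice d).

(** Coordinates run from -M to M. Sums against Gaussian kernels are finite sums over such cubes,
    with error bounds free of [M]; [M] is fixed only at the very end. *)
Definition boxpt M (v : {ffun 'I_d -> 'I_(M + M).+1}) : lattice d :=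
  [ffun i => (v i : nat)%:Z - M%:Z].

Definition boxsum {V : nmodType} M (F : lattice d -> V) : V := \sum_v F (@boxpt M v).

Definition in_box M x := [forall i, (`|x i| <= M)%N].

Lemma boxpt_inj M : injective (@boxpt M).
Proof.
move=> u v /ffunP h; apply/ffunP => i; apply/val_inj.
by have := h i; rewrite !ffunE => /addIr [].
Qed.

Lemma boxptP M x : reflect (exists v, @boxpt M v = x) (in_box M x).
Proof.
apply: (iffP forallP) => [h|[v <-] i]; last first.
  by rewrite ffunE; have := ltn_ord (v i); lia.
exists [ffun i => inord (absz (x i + M%:Z))]; apply/ffunP => i; rewrite !ffunE.
move: (x i) (h i) => u hu; rewrite inordK; last by lia.
have : - M%:Z <= u by lia.
by move=> ?; rewrite gez0_abs ?addrK //; lia.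
Qed.

Lemma boxsumE (V : nmodType) M (F : lattice d -> V) :
  boxsum M F = \sum_(y <- [seq @boxpt M v | v <- enum {: {ffun 'I_d -> 'I_(M + M).+1}}]) F y.
Proof. by rewrite big_map big_enum. Qed.

Lemma sum_uniq_support (V : nmodType) (s1 s2 : seq (lattice d)) (F : lattice d -> V) :
  uniq s1 -> uniq s2 -> (forall y, F y != 0 -> (y \in s1) && (y \in s2)) ->
  \sum_(y <- s1) F y = \sum_(y <- s2) F y.
Proof.
have red (s : seq (lattice d)) : \sum_(y <- s) F y = \sum_(y <- [seq y <- s | F y != 0]) F y.
  rewrite big_filter [in RHS]big_mkcond; apply: eq_bigr => y _.
  by case: eqP => //=.
move=> u1 u2 h; rewrite (red s1) (red s2); apply: perm_big; apply: uniq_perm.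
- exact: filter_uniq.
- exact: filter_uniq.
- by move=> y; rewrite !mem_filter; case: eqP => //= /eqP /h /andP[-> ->].
Qed.

(** The hypothesis keeps the support of [F] and its translate by [s] inside the cube, so both sums
    have the same nonzero terms. *)
Lemma boxsum_shift (V : nmodType) M (F : lattice d -> V) (s : lattice d) :
  (forall y, F y != 0 -> forall i, (`|y i| + `|s i| <= M)%N) ->
  boxsum M (fun y => F (y - s)) = boxsum M F.
Proof.
move=> h; rewrite !boxsumE -[LHS](big_map (fun y => y - s) xpredT F).
apply: sum_uniq_support => [||y /h hy].
- rewrite -map_comp map_inj_uniq ?enum_uniq // => u v /= /addIr.
  exact: boxpt_inj.
- by rewrite map_inj_uniq ?enum_uniq //; exact: boxpt_inj.
apply/andP; split; last first.
  have /boxptP[v <-] : in_box M y by apply/forallP => i; have := hy i; lia.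
  by apply/map_f; rewrite mem_enum.
have /boxptP[v vE] : in_box M (y + s).
  by apply/forallP => i; move: (hy i); rewrite ffunE; move: (y i) (s i) => a b; lia.
by apply/mapP; exists (y + s); rewrite ?addrK // -vE; apply/map_f; rewrite mem_enum.
Qed.

Lemma boxsum_prod (R : comPzRingType) M (F : 'I_d -> int -> R) :
  boxsum M (fun y => \prod_i F i (y i)) =
  \prod_i \sum_(a < (M + M).+1) F i ((a : nat)%:Z - M%:Z).
Proof.
rewrite bigA_distr_bigA; apply: eq_bigr => v _; apply: eq_bigr => i _.
by rewrite ffunE.
Qed.

Lemma ler_boxsum (R : numDomainType) M (F G : lattice d -> R) :
  (forall y, F y <= G y) -> boxsum M F <= boxsum M G.
Proof. by move=> h; apply: ler_sum => v _. Qed.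

Lemma ler_norm_boxsum (R : numDomainType) M (F : lattice d -> R) :
  `|boxsum M F| <= boxsum M (fun y => `|F y|).
Proof. exact: ler_norm_sum. Qed.

End Boxes.

Section LineSums.
Context {R : realType}.

Lemma exp_line_sum (h z : R) (m n : nat) : 0 < h <= 1 ->
  \sum_(a < n) expR (- (h * `|((a : nat)%:Z - m%:Z)%:~R - z|)) <= 4 / h.
Proof.
move=> /andP[h0 h1].
(* [S] is the primitive of h e^(-h|t|) growing from 0 to 2. Its increment over [t, t+1] is at least
   h/2 times the term at t, and these increments telescope. *)
pose S (t : R) := if t <= 0 then expR (h * t) else 2 - expR (- (h * t)).
have S0 t : 0 <= S t.
  rewrite /S; case: ifPn => [_|]; first exact: expR_ge0.
  rewrite -ltNge => t0; have : expR (- (h * t)) <= 1.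
    by rewrite -expR0 ler_expR oppr_le0 mulr_ge0 // ltW.
  by lra.
have S2 t : S t <= 2.
  rewrite /S; case: ifPn => t0; last by have := expR_ge0 (- (h * t)); lra.
  have : expR (h * t) <= 1 by rewrite -expR0 ler_expR; nra.
  by lra.
have Sinc t : h / 2 * expR (- (h * `|t|)) <= S (t + 1) - S t.
  have e1 : h / 2 <= 1 - expR (- h) by apply: expRN_le; rewrite ltW.
  rewrite /S; have [t0|t0] := leP t 0; have [t1|t1] := leP (t + 1) 0; try lra.
  - rewrite ler0_norm // mulrN opprK mulrDr mulr1 expRD.
    have := expR_ge1Dx h; have := expR_ge0 (h * t).
    by move: (expR (h * t)) (expR h) => u v u0 hv; nra.
  - have a1 : h * (t + 1) / 2 <= 1 - expR (- (h * (t + 1))).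
      by apply: expRN_le; nra.
    have a2 : - (h * t) / 2 <= 1 - expR (- - (h * t)) by apply: expRN_le; nra.
    rewrite opprK in a2.
    have : expR (- (h * `|t|)) <= 1 by rewrite -expR0 ler_expR oppr_le0 mulr_ge0 // ltW.
    by move: (expR (- (h * `|t|))) => u hu; nra.
  - rewrite gtr0_norm // mulrDr mulr1 opprD expRD.
    have := expR_gt0 (- (h * t)); move: (expR (- (h * t))) (expR (- h)) e1 => u v e1 u0.
    by nra.
have tel : \sum_(a < n) (h / 2 * expR (- (h * `|((a : nat)%:Z - m%:Z)%:~R - z|))) <= 2.
  pose T (a : nat) := S (a%:R - m%:R - z).
  apply: le_trans (_ : \sum_(0 <= a < n) (T a.+1 - T a) <= _).
    rewrite big_mkord; apply: ler_sum => a _; rewrite rmorphB /=.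
    apply: le_trans (Sinc _) _.
    by rewrite /T -[in a.+1%:R]natr1 (_ : a%:R - m%:R - z + 1 = a%:R + 1 - m%:R - z) //; ring.
  by rewrite telescope_sumr // /T; have := S0 (0%:R - m%:R - z); have := S2 (n%:R - m%:R - z); lra.
rewrite -mulr_sumr in tel.
rewrite ler_pdivlMr //; move: tel; set X := \sum_(a < n) _; lra.
Qed.

End LineSums.

(** * One walk step against one Gaussian step, in scalar form *)

Section ScalarStep.
Context {R : realType}.

Lemma sum_law_bound (I : finType) (q : I -> R) (q0 : forall b, 0 <= q b) (q1 : \sum_b q b = 1)
  (f : I -> R) (K : R) : (forall b, `|f b| <= K) -> `|\sum_b q b * f b| <= K.
Proof.
move=> h; apply: le_trans (ler_norm_sum _ _ _) _.
rewrite -[leRHS]mul1r -q1 mulr_suml; apply: ler_sum => b _.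
by rewrite normrM ger0_norm // ler_wpM2l.
Qed.

(** [r] is the logarithm of the Gaussian after the step, with its change of normalisation, relative
    to exp(-Qz/2). The last bound is free of [t] and uses up only half of the decay exp(-Qz/2). *)
Lemma log_gauss_ratio (t Qz D : R) (r := t ^+ 2 * Qz / (2 * (1 + t ^+ 2)) - D / 2 * ln (1 + t ^+ 2)) :
  0 < t <= 1 -> 0 <= Qz -> 0 <= D ->
  [/\ `|r - t ^+ 2 * (Qz - D) / 2| <= t ^+ 3 * ((Qz + D) / 2),
      `|r| <= t ^+ 2 * ((Qz + D) / 2) & `|r| <= Qz / 4 + D / 2].
Proof.
move=> /andP[t0 t1] Q0 D0.
have t20 : 0 < t ^+ 2 <= 1 by rewrite exprn_gt0 // expr_le1 // ltW.
have t43 : (t ^+ 2) ^+ 2 <= t ^+ 3.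
  by rewrite -exprM [t ^+ (2 * 2)]exprS ler_piMl // exprn_ge0 // ltW.
rewrite /r {r}; move: (t ^+ 2) (t ^+ 3) t20 t43 => u w /andP[u0 u1] uw.
have /andP[ln1 ln2] := ln1D_bounds (ltW u0).
have ln0 : 0 <= ln (1 + u) by apply: ln_ge0; lra.
move: (ln _) ln1 ln2 ln0 => l l1 l2 l0 {t t0 t1}.
have l3 : D / 2 * l <= D / 2 * u by apply: ler_wpM2l; nng.
have l4 : 0 <= D / 2 * l by nng.
have f1 : u * Qz / (2 * (1 + u)) <= Qz / 4 by rewrite ler_pdivrMr; nra.
have f2 : u * Qz / (2 * (1 + u)) <= u * Qz / 2.
  rewrite ler_pdivrMr; last by lra.
  have : 0 <= u * Qz * u by nng.
  by lra.
have f0 : 0 <= u * Qz / (2 * (1 + u)) by apply: divr_ge0; nng; lra.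
have f3 : u * Qz / 2 - u ^+ 2 * (Qz / 2) <= u * Qz / (2 * (1 + u)).
  rewrite ler_pdivlMr; last by lra.
  have : 0 <= Qz * u ^+ 3 by nng.
  by lra.
have f4 : u ^+ 2 * (Qz / 2) <= w * (Qz / 2) by apply: ler_wpM2r; nng.
have d1 : D / 2 * (u - u ^+ 2) <= D / 2 * l by apply: ler_wpM2l; nng.
have d2 : D / 2 * u ^+ 2 <= D / 2 * w by apply: ler_wpM2l; nng.
have wQ : 0 <= w * (Qz / 2) by apply: mulr_ge0; [apply: le_trans uw; nng | nng].
have wD : 0 <= D / 2 * w by apply: mulr_ge0; [nng | apply: le_trans uw; nng].
have uD : D / 2 * u <= D / 2 by rewrite ler_piMr //; nng.
have uQ : 0 <= u * Qz / 2 by nng.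
have uD0 : 0 <= D / 2 * u by nng.
move: (_ / (2 * (1 + u))) f0 f1 f2 f3 => v f0 f1 f2 f3.
by split; rewrite ler_norml; apply/andP; split; lra.
Qed.

(* With [Qz = Q z], [be b = B (z, xi_b)], [ga b = Q xi_b], both terms are
   [exp (- Qz / 2)] times [1 + t^2 (Qz - D) / 2] up to order [t^3]. *)
Lemma gauss_step_scalar (I : finType) (q : I -> R) (a D c : R) :
  (forall b, 0 <= q b) -> \sum_b q b = 1 -> 0 <= a -> 0 <= D -> 0 < c ->
  exists2 C : R, 0 <= C & forall (t N Qz : R) (be ga : I -> R),
    0 < t <= 1 -> 0 <= N -> c * N ^+ 2 <= Qz <= a * N ^+ 2 ->
    (forall b, `|be b| <= a * N) -> (forall b, `|ga b| <= a) ->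
    \sum_b q b * be b = 0 -> \sum_b q b * ga b = D -> \sum_b q b * be b ^+ 2 = Qz ->
    `|\sum_b q b * expR (- (Qz - 2 * t * be b + t ^+ 2 * ga b) / 2)
      - expR (- (D / 2 * ln (1 + t ^+ 2))) * expR (- (Qz / (1 + t ^+ 2)) / 2)|
    <= C * t ^+ 3 * expR (- N).
Proof.
move=> q0 q1 a0 D0 c0.
(* The three groups pay for the cubic Taylor remainder of the walk term, for the mixed terms of
   order t^3 and t^4 with the expansion of [r], and for the quadratic Taylor remainder of exp r. *)
pose C1 : R := a ^+ 3 * expR a + (a ^+ 2 / 2 + a ^+ 2 / 8 + (a + D) / 2) + (a + D) ^+ 2 / 4 * expR (D / 2).
exists (C1 * (256 * expR ((a + 2) ^+ 2 / (4 * (c / 4))))).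
  by rewrite /C1; nng.
move=> t N Qz be ga /andP[t0 t1] N0 /andP[Qc Qa] hbe hga Ebe Ega Ebe2.
have t2 : t ^+ 2 <= 1 by rewrite expr_le1 // ltW.
have t20 : 0 < t ^+ 2 by rewrite exprn_gt0.
have t43 : t ^+ 4 <= t ^+ 3 by rewrite [t ^+ 4]exprS ler_piMl; nng.
have t30 : 0 <= t ^+ 3 by rewrite exprn_ge0 // ltW.
have Q0 : 0 <= Qz by apply: le_trans Qc; rewrite mulr_ge0 ?sqr_ge0 // ltW.
pose L : R := 1 + N; have L1 : 1 <= L by rewrite /L; lra.
pose s b := t * be b - t ^+ 2 * ga b / 2.
pose r := t ^+ 2 * Qz / (2 * (1 + t ^+ 2)) - D / 2 * ln (1 + t ^+ 2).
have L0 : 0 <= L by lra.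
(* [W] dominates the growth of all error terms. Its exp(Qz/4) leaves exp(-Qz/4) of the Gaussian
   decay, which absorbs the other two factors because c N^2 <= Qz. *)
pose W : R := L ^+ 4 * expR (a * N) * expR (Qz / 4).
have L4 : 1 <= L ^+ 4 by rewrite exprn_ege1.
have e1 (x : R) : 0 <= x -> 1 <= expR x by move=> x0; rewrite -[leLHS]expR0 ler_expR.
have eaN : 1 <= expR (a * N) by apply: e1; nng.
have eQ : 1 <= expR (Qz / 4) by apply: e1; nng.
have W4 : L ^+ 4 <= W by rewrite /W -mulrA ler_peMr //; [lra | nra].
have hs b : `|s b| <= t * (a * L).
  rewrite /s; apply: le_trans (ler_normB _ _) _.
  rewrite (normrM t) -mulrA (normrM (t ^+ 2)) (normrM (ga b)) (ger0_norm (ltW t0)) (ger0_norm (ltW t20)) normfV [`|2|]ger0_norm //.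
  have g0 := normr_ge0 (ga b); have b0 := normr_ge0 (be b).
  have := hbe b; have := hga b; rewrite expr2 /L in t2 t20 *.
  move: `|ga b| `|be b| g0 b0 => u v u0 v0 ua va.
  have x1 : t * v <= t * (a * N) by rewrite ler_pM2l.
  have x2 : t * t * u / 2 <= t * a by rewrite -!mulrA ler_pM2l //; nra.
  by lra.
have T3 b : `|expR (s b) - (1 + s b + s b ^+ 2 / 2)| <= t ^+ 3 * (a ^+ 3 * expR a) * W.
  rewrite (_ : _ - _ = expR (s b) - 1 - s b - s b ^+ 2 / 2); last by ring.
  apply: le_trans (expR_taylor3 _) _.
  have h1 : `|s b| ^+ 3 <= t ^+ 3 * a ^+ 3 * L ^+ 4.
    apply: le_trans (_ : (t * (a * L)) ^+ 3 <= _).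
      by apply: lerXn2r; rewrite ?nnegrE //; apply: le_trans (hs b).
    rewrite !exprMn mulrA; apply: ler_wpM2l; first by nng.
    by rewrite [leRHS]exprS ler_peMl //; nng.
  have h2 : expR `|s b| <= expR a * (expR (a * N) * expR (Qz / 4)).
    rewrite mulrA -expRD; apply: le_trans (_ : expR (a + a * N) <= _).
      rewrite ler_expR; apply: le_trans (hs b) _.
      have -> : a + a * N = 1 * (a * L) by rewrite /L; ring.
      by apply: ler_wpM2r; rewrite // mulr_ge0.
    by rewrite ler_peMr // expR_ge0.
  apply: le_trans (ler_pM _ _ h1 h2) _; rewrite ?exprn_ge0 ?expR_ge0 //.
  by rewrite /W le_eqVlt; apply/orP; left; apply/eqP; ring.
(* The order t vanishes by [Ebe]; [Ega] and [Ebe2] make the order t^2 agree with that of [r]. *)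
have Es : \sum_b q b * (1 + s b + s b ^+ 2 / 2) =
   1 + t ^+ 2 * (Qz - D) / 2 - t ^+ 3 / 2 * (\sum_b q b * (be b * ga b)) + t ^+ 4 / 8 * (\sum_b q b * ga b ^+ 2).
  rewrite -Ebe2 -Ega.
  transitivity (\sum_b (q b + t * (q b * be b) - t ^+ 2 / 2 * (q b * ga b) +
     t ^+ 2 / 2 * (q b * be b ^+ 2) - t ^+ 3 / 2 * (q b * (be b * ga b)) + t ^+ 4 / 8 * (q b * ga b ^+ 2))).
    by apply: eq_bigr => b _; rewrite /s; field.
  by rewrite !(big_split, sumrN) /= -!mulr_sumr Ebe mulr0 q1; field.
have hbg : `|\sum_b q b * (be b * ga b)| <= a * N * a.
  by apply: sum_law_bound => // b; rewrite normrM ler_pM.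
have hgg : `|\sum_b q b * ga b ^+ 2| <= a ^+ 2.
  by apply: sum_law_bound => // b; rewrite normrX lerXn2r ?nnegrE.
have QL : Qz <= a * L ^+ 4.
  apply: le_trans Qa _; apply: ler_wpM2l => //; apply: le_trans (_ : L ^+ 2 <= _).
    by apply: lerXn2r; rewrite ?nnegrE // /L; lra.
  by rewrite ler_weXn2l.
have DL : D <= D * L ^+ 4 by rewrite ler_peMr.
have [hr1' hr2 hr3] := log_gauss_ratio (introT andP (conj t0 t1)) Q0 D0; rewrite -/r in hr1' hr2 hr3.
have hr1 : `|r - t ^+ 2 * (Qz - D) / 2| <= t ^+ 3 * ((a + D) / 2) * L ^+ 4.
  apply: le_trans hr1' _; rewrite -mulrA; apply: ler_wpM2l => //.
  by move: QL DL; clear; lra.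
have T2 : `|expR r - (1 + r)| <= t ^+ 3 * ((a + D) ^+ 2 / 4 * expR (D / 2)) * W.
  rewrite (_ : _ - _ = expR r - 1 - r); last by ring.
  apply: le_trans (expR_taylor2 _) _.
  have h1 : `|r| ^+ 2 <= t ^+ 3 * ((a + D) ^+ 2 / 4) * L ^+ 4.
    apply: le_trans (_ : (t ^+ 2 * ((a + D) / 2 * L ^+ 2)) ^+ 2 <= _).
      apply: lerXn2r; rewrite ?nnegrE //; first by nng.
      apply: le_trans hr2 _; apply: ler_wpM2l; first by nng.
      have : D <= D * L ^+ 2 by rewrite ler_peMr // exprn_ege1.
      have : Qz <= a * L ^+ 2.
        by apply: le_trans Qa _; apply: ler_wpM2l => //; apply: lerXn2r; rewrite ?nnegrE // /L; lra.
      by lra.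
    rewrite (_ : _ ^+ 2 = t ^+ 4 * ((a + D) ^+ 2 / 4 * L ^+ 4)); last by field.
    by rewrite -[X in _ <= X]mulrA; apply: ler_wpM2r => //; nng.
  have h2 : expR `|r| <= expR (D / 2) * (expR (a * N) * expR (Qz / 4)).
    apply: le_trans (_ : expR (D / 2) * (1 * expR (Qz / 4)) <= _).
      by rewrite mul1r -expRD ler_expR; lra.
    by apply: ler_wpM2l; rewrite ?expR_ge0 //; apply: ler_wpM2r; rewrite ?expR_ge0.
  apply: le_trans (ler_pM _ _ h1 h2) _; rewrite ?exprn_ge0 ?expR_ge0 //.
  by rewrite /W le_eqVlt; apply/orP; left; apply/eqP; ring.
have main : `|\sum_b q b * expR (s b) - expR r| <= t ^+ 3 * C1 * W.
  have -> : \sum_b q b * expR (s b) - expR r =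
     \sum_b q b * (expR (s b) - (1 + s b + s b ^+ 2 / 2)) - (expR r - (1 + r))
     - (r - t ^+ 2 * (Qz - D) / 2)
     - t ^+ 3 / 2 * (\sum_b q b * (be b * ga b)) + t ^+ 4 / 8 * (\sum_b q b * ga b ^+ 2).
    under [in RHS]eq_bigr do rewrite mulrBr.
    by rewrite sumrB Es; ring.
  have S3 := sum_law_bound q0 q1 T3.
  apply: le_trans (ler_normD _ _) _; apply: le_trans (lerD (ler_normB _ _) (lexx _)) _.
  apply: le_trans (lerD (lerD (ler_normB _ _) (lexx _)) (lexx _)) _.
  apply: le_trans (lerD (lerD (lerD (ler_normB _ _) (lexx _)) (lexx _)) (lexx _)) _.
  have x1 : `|t ^+ 3 / 2 * (\sum_b q b * (be b * ga b))| <= t ^+ 3 * (a ^+ 2 / 2) * W.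
    rewrite normrM ger0_norm; last by nng.
    rewrite -[leRHS]mulrA -[leLHS]mulrA; apply: ler_wpM2l => //.
    have NL : N <= L ^+ 4 by apply: le_trans (_ : L <= _); [rewrite /L; lra | rewrite ler_eXnr].
    apply: le_trans (_ : 2^-1 * (a * W * a) <= _); last by rewrite le_eqVlt; apply/orP; left; apply/eqP; ring.
    apply: ler_wpM2l => //; apply: le_trans hbg _; apply: ler_wpM2r => //; apply: ler_wpM2l => //.
    exact: le_trans W4.
  have x2 : `|t ^+ 4 / 8 * (\sum_b q b * ga b ^+ 2)| <= t ^+ 3 * (a ^+ 2 / 8) * W.
    rewrite normrM ger0_norm; last by nng.
    apply: le_trans (_ : t ^+ 3 / 8 * a ^+ 2 <= _).
      by apply: ler_pM => //; nng; apply: ler_wpM2r.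
    have : t ^+ 3 * (a ^+ 2 / 8) * 1 <= t ^+ 3 * (a ^+ 2 / 8) * W.
      by apply: ler_wpM2l; [nng | exact: le_trans W4].
    by lra.
  have x3 : `|r - t ^+ 2 * (Qz - D) / 2| <= t ^+ 3 * ((a + D) / 2) * W.
    by apply: le_trans hr1 _; apply: ler_wpM2l => //; nng.
  by rewrite /C1; move: S3 T2 x1 x2 x3; clear; lra.
have -> : \sum_b q b * expR (- (Qz - 2 * t * be b + t ^+ 2 * ga b) / 2)
      - expR (- (D / 2 * ln (1 + t ^+ 2))) * expR (- (Qz / (1 + t ^+ 2)) / 2)
   = expR (- (Qz / 2)) * (\sum_b q b * expR (s b) - expR r).
  rewrite mulrBr -!expRD mulr_sumr; congr (_ - _).
    apply: eq_bigr => b _; rewrite mulrCA -expRD; congr (_ * expR _).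
    by rewrite /s; field.
  by congr expR; rewrite /r; field; lra.
rewrite normrM ger0_norm ?expR_ge0 //.
apply: le_trans (ler_wpM2l (expR_ge0 _) main) _.
have c40 : 0 < c / 4 by lra.
have := gauss_absorb a c40 N0; rewrite -/L => GA.
have C10 : 0 <= C1 by rewrite /C1; nng.
apply: le_trans (_ : t ^+ 3 * C1 * (L ^+ 4 * expR (a * N) * expR (- (c / 4 * N ^+ 2))) <= _).
  rewrite [X in X <= _](_ : _ = t ^+ 3 * C1 * (L ^+ 4 * expR (a * N) * (expR (Qz / 4) * expR (- (Qz / 2))))); last first.
    by rewrite /W; ring.
  apply: ler_wpM2l; first by nng.
  rewrite -expRD; apply: ler_wpM2l; first by nng.
  by rewrite ler_expR; lra.
apply: le_trans (ler_wpM2l _ GA) _; first by nng.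
by rewrite le_eqVlt; apply/orP; left; apply/eqP; ring.
Qed.

End ScalarStep.

(** * Quadratic forms *)

Section QuadraticForms.
Context {R : realType} {d : nat}.
Implicit Types (A : 'M[R]_d) (x y z : 'rV[R]_d).

Definition bform A x y : R := (x *m A *m y^T) 0 0.
Definition qform A x : R := bform A x x.
Definition rnorm1 x : R := \sum_i `|x 0 i|.
Definition entry_norm A : R := \sum_i \sum_j `|A i j|.

Lemma entryB m n (M N : 'M[R]_(m, n)) i j : (M - N) i j = M i j - N i j.
Proof. by rewrite !mxE. Qed.

Lemma bformE A x y : bform A x y = \sum_i \sum_j x 0 i * A i j * y 0 j.
Proof.
rewrite /bform mxE; under eq_bigr do rewrite !mxE mulr_suml.
exact: exchange_big.
Qed.

Lemma bformC A x y : A^T = A -> bform A x y = bform A y x.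
Proof.
move=> As; rewrite /bform -[in LHS](trmxK (x *m A *m y^T)) [in LHS]mxE.
by rewrite !trmx_mul trmxK As mulmxA.
Qed.

Lemma bformBl A x y z : bform A (x - y) z = bform A x z - bform A y z.
Proof. by rewrite /bform !mulmxBl mxE [X in _ + X]mxE. Qed.

Lemma bformBr A x y z : bform A x (y - z) = bform A x y - bform A x z.
Proof. by rewrite /bform linearB /= mulmxBr mxE [X in _ + X]mxE. Qed.

Lemma bformZl A (t : R) x y : bform A (t *: x) y = t * bform A x y.
Proof. by rewrite /bform -!scalemxAl mxE. Qed.

Lemma bformZr A (t : R) x y : bform A x (t *: y) = t * bform A x y.
Proof. by rewrite /bform linearZ /= -scalemxAr mxE. Qed.

Lemma qform_subZ A x y (t : R) : A^T = A ->
  qform A (x - t *: y) = qform A x - 2 * t * bform A x y + t ^+ 2 * qform A y.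
Proof.
move=> As; rewrite /qform bformBl !bformBr !(bformZl, bformZr) (bformC y x As).
ring.
Qed.

Lemma qformZ A x (t : R) : qform A (t *: x) = t ^+ 2 * qform A x.
Proof. by rewrite /qform bformZl bformZr mulrA expr2. Qed.

Lemma rnorm1_ge0 x : 0 <= rnorm1 x. Proof. exact: sumr_ge0. Qed.
Lemma entry_norm_ge0 A : 0 <= entry_norm A.
Proof. by apply: sumr_ge0 => i _; apply: sumr_ge0. Qed.

Lemma rnorm1Z (t : R) x : rnorm1 (t *: x) = `|t| * rnorm1 x.
Proof. by rewrite /rnorm1 mulr_sumr; apply: eq_bigr => i _; rewrite mxE normrM. Qed.

Lemma rnorm1_entry x i : `|x 0 i| <= rnorm1 x.
Proof. by rewrite /rnorm1 (bigD1 i) //= lerDl sumr_ge0. Qed.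

Lemma bform_bound A x y (a b : R) : (forall i, `|x 0 i| <= a) -> (forall i, `|y 0 i| <= b) ->
  0 <= a -> `|bform A x y| <= entry_norm A * (a * b).
Proof.
move=> hx hy a0; rewrite bformE; apply: le_trans (ler_norm_sum _ _ _) _.
rewrite /entry_norm mulr_suml; apply: ler_sum => i _.
apply: le_trans (ler_norm_sum _ _ _) _; rewrite mulr_suml; apply: ler_sum => j _.
rewrite !normrM [`|x 0 i| * _]mulrC -mulrA; apply: ler_wpM2l => //.
by apply: ler_pM.
Qed.

End QuadraticForms.

(** * Mean, covariance and precision matrix of a random pattern *)

Section Covariance.
Context {R : realType} {d : nat}.
Variable q : pattern d -> R.
Hypothesis q_gt0 : forall b, 0 < q b.
Hypothesis q_sum1 : \sum_b q b = 1.

Implicit Types x y v : 'rV[R]_d.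

Definition meanv : 'rV[R]_d := \row_i \sum_b q b * (b i)%:R.
Definition devv (b : pattern d) : 'rV[R]_d := \row_i (b i)%:R - meanv.
Definition covm : 'M[R]_d := \sum_b q b *: ((devv b)^T *m devv b).
Definition precm : 'M[R]_d := invmx covm.

Lemma mean_devv : \sum_b q b *: devv b = 0.
Proof.
apply/rowP => i; rewrite summxE.
under eq_bigr do rewrite !mxE mulrBr.
by rewrite sumrB -mulr_suml q_sum1 mul1r mxE subrr.
Qed.

Lemma devv_le1 b i : `|devv b 0 i| <= 1.
Proof.
rewrite !mxE; have -> : (b i)%:R - \sum_c q c * (c i)%:R = \sum_c q c * ((b i)%:R - (c i)%:R).
  by under [RHS]eq_bigr do rewrite mulrBr; rewrite sumrB -mulr_suml q_sum1 mul1r.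
apply: sum_law_bound => // c; first by apply/ltW.
by case: (b i) (c i) => [] []; rewrite ?subrr ?subr0 ?sub0r ?normrN ?normr1 ?normr0.
Qed.

Lemma covm_sym : covm^T = covm.
Proof.
rewrite /covm linear_sum /=; apply: eq_bigr => b _.
by rewrite linearZ /= trmx_mul trmxK.
Qed.

Lemma covm_bform x y : bform covm x y = \sum_b q b * ((devv b *m x^T) 0 0 * (devv b *m y^T) 0 0).
Proof.
rewrite /bform /covm mulmx_sumr mulmx_suml summxE; apply: eq_bigr => b _.
rewrite -!(scalemxAl, scalemxAr) mxE; congr (_ * _).
rewrite mulmxA -(mulmxA (x *m _)) mxE big_ord1; congr (_ * _).
by rewrite -[in LHS](trmxK (x *m _)) mxE trmx_mul trmxK.
Qed.

(** A kernel vector is orthogonal to every deviation, all patterns having positive weight; comparing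
    [unitp i] with [nopat] isolates its i-th entry. *)
Lemma covm_unit : covm \in unitmx.
Proof.
rewrite -row_free_unit; apply: inj_row_free => v v0.
have : \sum_b q b * ((devv b *m v^T) 0 0) ^+ 2 = 0.
  transitivity (bform covm v v); last by rewrite /bform v0 mul0mx mxE.
  by rewrite covm_bform; apply: eq_bigr => b _; rewrite expr2.
move/psumr_eq0P => h.
have {}h b : (devv b *m v^T) 0 0 = 0.
  have /(_ b isT)/eqP := h (fun b _ => mulr_ge0 (ltW (q_gt0 b)) (sqr_ge0 _)).
  by rewrite mulf_eq0 gt_eqF //= sqrf_eq0 => /eqP.
apply/rowP => i; rewrite [RHS]mxE.
have := congr2 (fun a b : R => a - b) (h (unitp i)) (h nopat).
have e : (devv (unitp i) *m v^T) 0 0 - (devv nopat *m v^T) 0 0 = ((devv (unitp i) - devv nopat) *m v^T) 0 0.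
  by rewrite (mulmxBl (devv (unitp i)) (devv nopat)) entryB.
rewrite /= e subrr /devv opprB addrA subrK mxE (bigD1 i) //= big1 ?addr0.
  by rewrite !mxE !ffunE eqxx subr0 mul1r.
by move=> j ji; rewrite !mxE !ffunE (negPf ji) subrr mul0r.
Qed.

Lemma precm_sym : precm^T = precm.
Proof. by rewrite /precm trmx_inv covm_sym. Qed.

Lemma precm_qform x : qform precm x = qform covm (x *m precm).
Proof.
rewrite /qform /bform trmx_mul precm_sym mulmxA -(mulmxA x precm covm) mulVmx ?covm_unit //.
by rewrite mulmx1.
Qed.

(* Cauchy-Schwarz for [x_i = cov (<x A, V>, V_i)], and [Var V_i <= 1]. *)
Lemma precm_coercive_entry x i : x 0 i ^+ 2 <= qform precm x.
Proof.
rewrite precm_qform /qform covm_bform.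
pose u b := (devv b *m (x *m precm)^T) 0 0.
have -> : x 0 i = \sum_b q b * (u b * devv b 0 i).
  rewrite -[in LHS](mulmx1 x) -(mulVmx covm_unit) mulmxA -[x *m invmx _]/(x *m precm).
  rewrite /covm mulmx_sumr summxE; apply: eq_bigr => b _.
  rewrite -scalemxAr mxE; congr (_ * _).
  rewrite mulmxA mxE big_ord1; congr (_ * _).
  by rewrite -[in LHS](trmxK (x *m _ *m _)) mxE trmx_mul trmxK.
set m := \sum_b _.
have : 0 <= \sum_b q b * (u b * devv b 0 i - m) ^+ 2.
  by apply: sumr_ge0 => b _; apply: mulr_ge0; rewrite ?sqr_ge0 // ltW.
have -> : \sum_b q b * (u b * devv b 0 i - m) ^+ 2 = \sum_b q b * (u b * devv b 0 i) ^+ 2 - m ^+ 2.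
  transitivity (\sum_b (q b * (u b * devv b 0 i) ^+ 2 - 2 * m * (q b * (u b * devv b 0 i)) + m ^+ 2 * q b)).
    by apply: eq_bigr => b _; ring.
  by rewrite big_split sumrB /= -!mulr_sumr q_sum1 -/m; ring.
rewrite subr_ge0 => /le_trans; apply; apply: ler_sum => b _.
apply: ler_wpM2l; first exact/ltW.
rewrite exprMn -[leRHS]mulr1; apply: ler_wpM2l; first exact: sqr_ge0.
by rewrite -real_normK ?num_real // expr_le1 // devv_le1.
Qed.

(** Summing the entrywise bound costs a factor d; writing [d + 1] keeps the constant positive for d
    = 0. *)
Lemma precm_coercive x : (d%:R + 1) ^- 2 * rnorm1 x ^+ 2 <= qform precm x.
Proof.
have Q0 : 0 <= qform precm x.
  rewrite precm_qform /qform covm_bform; apply: sumr_ge0 => b _.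
  by apply: mulr_ge0; rewrite -?expr2 ?sqr_ge0 // ltW.
have h i : `|x 0 i| <= Num.sqrt (qform precm x).
  by rewrite -sqrtr_sqr ler_wsqrtr // precm_coercive_entry.
have hs : rnorm1 x <= (d%:R + 1) * Num.sqrt (qform precm x).
  apply: le_trans (ler_sum _ (fun i _ => h i)) _.
  by rewrite sumr_const card_ord -[X in X <= _]mulr_natl; apply: ler_wpM2r; rewrite ?sqrtr_ge0 // lerDl.
have d0 : 0 < d%:R + 1 :> R by have := ler0n R d; lra.
rewrite ler_pdivrMl ?exprn_gt0 // -[in leRHS](sqr_sqrtr Q0) -exprMn.
by apply: lerXn2r; rewrite ?nnegrE ?rnorm1_ge0 // mulr_ge0 ?sqrtr_ge0 // ltW.
Qed.

Lemma mean_bform x : \sum_b q b * bform precm x (devv b) = 0.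
Proof.
transitivity (bform precm x (\sum_b q b *: devv b)); last first.
  by rewrite mean_devv /bform linear0 mulmx0 mxE.
have -> : bform precm x (\sum_b q b *: devv b) = (x *m precm *m (\sum_b q b *: (devv b)^T)) 0 0.
  rewrite /bform linear_sum; congr ((_ *m _) 0 0).
  by apply: eq_bigr => b _; rewrite linearZ.
rewrite mulmx_sumr summxE; apply: eq_bigr => b _.
by rewrite -scalemxAr mxE.
Qed.

(** The sum is the trace of [covm] times [precm]. That the kernel uses the inverse of the covariance
    enters the one-step comparison through this value and through [mean_bform2]. *)
Lemma mean_qform : \sum_b q b * qform precm (devv b) = d%:R.
Proof.
transitivity (\tr (covm *m precm)); last by rewrite mulmxV ?covm_unit // mxtrace1.
rewrite /covm mulmx_suml linear_sum; apply: eq_bigr => b _.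
rewrite -scalemxAl linearZ /=; congr (_ * _).
by rewrite -mulmxA mxtrace_mulC /mxtrace big_ord1.
Qed.

Lemma mean_bform2 x : \sum_b q b * bform precm x (devv b) ^+ 2 = qform precm x.
Proof.
rewrite precm_qform /qform covm_bform; apply: eq_bigr => b _.
by rewrite bformC ?precm_sym // /bform trmx_mul precm_sym mulmxA expr2.
Qed.

End Covariance.

(** * The Gaussian kernel and its one-step error *)

Section GaussianKernel.
Context {R : realType} {d : nat}.

Definition pos (y : lattice d) : 'rV[R]_d := \row_i (y i)%:~R.

(** The Gaussian density after [j] steps of mean [th], without its normalising constant: for
    positive definite [A] its mass over the lattice tends to [gauss_mass A], not to 1. *)
Definition gker (A : 'M[R]_d) (th : 'rV[R]_d) (j : nat) (y : lattice d) : R :=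
  (Num.sqrt j%:R)^-1 ^+ d * expR (- qform A ((Num.sqrt j%:R)^-1 *: (pos y - j%:R *: th)) / 2).

Variable q : pattern d -> R.
Hypothesis q_gt0 : forall b, 0 < q b.
Hypothesis q_sum1 : \sum_b q b = 1.

(** With x = y - (j+1) th, a step b leads from y to y - b, and y - b - j th = x - (b - th); the
    scalar estimate is applied at x / sqrt j. The exponential profile is kept because its lattice
    sum is O(t^(-d)), so the total error is O(t^3). *)
Lemma gauss_step : exists2 C : R, 0 <= C & forall (j : nat) (y : lattice d)
    (t : R := (Num.sqrt j%:R)^-1), (0 < j)%N ->
  `|wavg q (gker (precm q) (meanv q) j) y - gker (precm q) (meanv q) j.+1 y| <=
    C * t ^+ 3 * (t ^+ d * expR (- (t * rnorm1 (pos y - j.+1%:R *: meanv q)))).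
Proof.
set A := precm q; set th := meanv q.
have e0 := entry_norm_ge0 A.
have cd : 0 < (d%:R + 1) ^- 2 :> R by rewrite invr_gt0 exprn_gt0 //; have := ler0n R d; lra.
have [C C0 HC] := gauss_step_scalar (fun b => ltW (q_gt0 b)) q_sum1 e0 (ler0n R d) cd.
exists C; first exact: C0.
move=> j y t j0.
have jR : 0 < j%:R :> R by rewrite ltr0n.
have s0 : 0 < Num.sqrt (j%:R : R) by rewrite sqrtr_gt0.
have t0 : 0 < t by rewrite invr_gt0.
have tt : t ^+ 2 = j%:R^-1 by rewrite /t exprVn sqr_sqrtr // ltW.
have t1 : t <= 1.
  by rewrite invf_le1 // -[leLHS]sqrtr1 ler_wsqrtr // ler1n.
set x := pos y - j.+1%:R *: th.
have E1 b : pos (y - stepv b) - j%:R *: th = x - devv q b.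
  rewrite /x /devv -/th -[j.+1%:R]natr1 scalerDl scale1r.
  apply/rowP => i; rewrite !mxE !ffunE rmorphB /=; ring.
have n1 := rnorm1_ge0 (t *: x).
have := HC t (rnorm1 (t *: x)) (qform A (t *: x)) (fun b => bform A (t *: x) (devv q b)) (fun b => qform A (devv q b)).
have hbe b : `|bform A (t *: x) (devv q b)| <= entry_norm A * rnorm1 (t *: x).
  rewrite -[X in _ * X]mulr1; apply: bform_bound => // i; first exact: rnorm1_entry.
  exact: devv_le1.
have hga b : `|qform A (devv q b)| <= entry_norm A.
  by rewrite -[leRHS]mulr1 -[X in _ * X]mulr1; apply: bform_bound => // i; exact: devv_le1.
have hq : (d%:R + 1) ^- 2 * rnorm1 (t *: x) ^+ 2 <= qform A (t *: x) <= entry_norm A * rnorm1 (t *: x) ^+ 2.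
  apply/andP; split; first exact: precm_coercive.
  by apply: le_trans (ler_norm _) _; apply: bform_bound => // i; exact: rnorm1_entry.
move=> /(_ (introT andP (conj t0 t1)) n1 hq hbe hga (mean_bform q_sum1 _) (mean_qform q_gt0) (mean_bform2 q_gt0 _)).
rewrite rnorm1Z (gtr0_norm t0) => H.
have As : A^T = A by exact: precm_sym.
have gE b : gker A th j (y - stepv b) = t ^+ d * expR (- qform A (t *: (x - devv q b)) / 2).
  by rewrite -E1.
(* Passing from j to j+1 divides [t] by sqrt(1 + t^2); this produces both the rescaled form and the
   factor (1 + t^2)^(-d/2). *)
have st : (Num.sqrt j.+1%:R)^-1 = t * (Num.sqrt (1 + t ^+ 2))^-1 :> R.
  rewrite -invfM -sqrtrM ?ler0n // tt mulrDr mulr1 mulfV ?gt_eqF //.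
  by rewrite natr1.
have gE' : gker A th j.+1 y = (t * (Num.sqrt (1 + t ^+ 2))^-1) ^+ d *
    expR (- qform A ((t * (Num.sqrt (1 + t ^+ 2))^-1) *: x) / 2) by rewrite -st.
clear HC hbe hga hq E1 st; clearbody t x A.
have u0 : 0 < 1 + t ^+ 2 by rewrite addr_gt0 // exprn_gt0.
have Eg : gker A th j.+1 y = t ^+ d * (expR (- (d%:R / 2 * ln (1 + t ^+ 2))) * expR (- (qform A (t *: x) / (1 + t ^+ 2)) / 2)).
  have P1 : (Num.sqrt (1 + t ^+ 2))^-1 ^+ d = expR (- (d%:R / 2 * ln (1 + t ^+ 2))).
    rewrite (_ : d%:R / 2 * _ = d%:R * (ln (1 + t ^+ 2) / 2)); last by ring.
    rewrite -mulrN expRM_natl; congr (_ ^+ _).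
    rewrite expRN; congr (_^-1); apply: ln_inj; rewrite ?posrE ?expR_gt0 ?sqrtr_gt0 //.
    by rewrite expRK -[in RHS](sqr_sqrtr (ltW u0)) lnXn ?sqrtr_gt0 // mulr2n; field.
  have P2 : qform A ((t / Num.sqrt (1 + t ^+ 2)) *: x) = qform A (t *: x) / (1 + t ^+ 2).
    have ss : Num.sqrt (1 + t ^+ 2) ^+ 2 = 1 + t ^+ 2 by rewrite sqr_sqrtr // ltW.
    by rewrite !qformZ -[in RHS]ss expr_div_n mulrAC.
  by rewrite gE' exprMn P1 P2 mulrA.
have El : wavg q (gker A th j) y = t ^+ d * \sum_b q b * expR (- (qform A (t *: x) - 2 * t * bform A (t *: x) (devv q b) + t ^+ 2 * qform A (devv q b)) / 2).
  rewrite /wavg mulr_sumr; apply: eq_bigr => b _.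
  by rewrite gE mulrCA scalerBr qform_subZ.
rewrite El Eg -mulrBr normrM ger0_norm; last by nng.
rewrite mulrCA; apply: ler_wpM2l; first by nng.
exact: H.
Qed.

End GaussianKernel.

(** * Gaussian Riemann sums *)

Section HalfLine.
Context {R : realType}.
Implicit Types (phi F : R -> R) (A h : R).
Local Notation mu := (@lebesgue_measure R).

(** The Lipschitz constant is weighted by exp(-x) so that the errors of the cells of an infinite
    mesh are summable. *)
Definition exp_decay A phi :=
  (forall x : R, 0 <= x -> 0 <= phi x <= A * expR (- x)) /\
  (forall x y : R, 0 <= x <= y -> `|phi y - phi x| <= A * (y - x) * expR (- x)).

Lemma is_derive_expRN (c : R) : is_derive c 1 (fun x : R => expR (- x)) (- expR (- c)).
Proof.
have h1 : is_derive (- c) 1 (@expR R) (expR (- c)) by exact: is_derive_expR.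
have h2 : is_derive c 1 (@GRing.opp R) (-1) by exact: is_deriveNid.
have h3 := @is_derive1_comp R (@expR R) (@GRing.opp R) c _ _ h1 h2.
by apply: (is_derive_eq h3); rewrite mulrN1.
Qed.

Lemma is_deriveDZ (F g : R -> R) (A c f' g' : R) : is_derive c 1 F f' -> is_derive c 1 g g' ->
  is_derive c 1 (fun x => F x + A * g x) (f' + A * g').
Proof.
move=> hF hg.
have h := @is_deriveZ R R R g A c 1 g' hg.
exact: (@is_deriveD R R R F (A \*: g) c 1 f' (A *: g') hF h).
Qed.

(** The base point -1 leaves a margin to the left of 0, so the primitive has a two-sided derivative
    at 0 as well. *)
Lemma continuous_primitive phi : continuous phi ->
  exists F : R -> R, forall x : R, -1 < x -> is_derive x 1 F (phi x).
Proof.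
move=> cphi; exists (fun x => \int[mu]_(t in [set` `[-1, x]]) phi t)%R => x x1.
have I : mu.-integrable `[-1, x + 1]%classic (EFin \o phi).
  apply: continuous_compact_integrable; first exact: segment_compact.
  exact: continuous_subspaceT.
have xx : x < x + 1 by lra.
have [d1 d2] := @continuous_FTC1_closed R phi (-1) x (x + 1) xx I x1 (cphi x).
apply: DeriveDef; first exact: d1.
by rewrite -derive1E; exact: d2.
Qed.

Lemma exp_sum_bound h K : 0 < h <= 1 -> \sum_(a < K) expR (- (h * a%:R)) <= 2 / h.
Proof.
move=> h01; have /andP[h0 h1] := h01.
have e := expRN_le (introT andP (conj (ltW h0) h1)).
have tel : (1 - expR (- h)) * \sum_(a < K) expR (- (h * a%:R)) = 1 - expR (- (h * K%:R)).
  elim: K => [|K IH]; first by rewrite big_ord0 !mulr0 oppr0 expR0 subrr.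
  rewrite big_ord_recr /= mulrDr IH -[K.+1%:R]natr1 mulrDr mulr1 opprD expRD; ring.
have S0 : 0 <= \sum_(a < K) expR (- (h * a%:R)) by apply: sumr_ge0 => a _; exact: expR_ge0.
rewrite ler_pdivlMr //; have := expR_ge0 (- (h * K%:R)); have := ler_wpM2r S0 e.
move: tel; clear; set S := \sum_(a < K) _; lra.
Qed.

(** The cell of index a contributes an error A h^2 exp(-h a), in total at most 2 A h; the part of
    the integral beyond h K gives the exponential. Sample points are free within their cells,
    because shifted lattices will be summed. *)
Lemma riemann_half_line A phi : exp_decay A phi ->
  exists J : R, [/\ (\int[mu]_(x in `]0%R, +oo[) (phi x)%:E)%E = J%:E, 0 <= J <= A &
    forall h K (s : nat -> R), 0 < h <= 1 -> (forall a, a%:R <= s a <= a%:R + 1) ->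
      `|h * \sum_(a < K) phi (h * s a) - J| <= A * (2 * h + expR (- (h * K%:R)))].
Proof.
move=> [pos_phi lip_phi].
have A0 : 0 <= A by have := pos_phi 0 (lexx _); rewrite oppr0 expR0 mulr1 => /andP[/le_trans] h /h.
(* The even extension is continuous on the whole line, as the fundamental theorem of calculus
   requires at 0. *)
pose psi (x : R) := phi `|x|.
have psiE (x : R) : 0 <= x -> psi x = phi x by move=> x0; rewrite /psi ger0_norm.
have e1 (x : R) : 0 <= x -> expR (- x) <= 1 by move=> x0; rewrite -expR0 ler_expR oppr_le0.
have lip (x y : R) : `|psi x - psi y| <= A * `|x - y|.
  suff h (u v : R) : 0 <= u <= v -> `|phi v - phi u| <= A * (v - u).
    apply: le_trans (_ : A * `| `|x| - `|y| | <= _); last by rewrite ler_wpM2l // ler_dist_dist.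
    rewrite /psi; have [xy|yx] := leP `|x| `|y|.
      by rewrite distrC [X in _ <= _ * X]distrC [X in _ <= _ * X]ger0_norm ?subr_ge0 //; apply: h; rewrite normr_ge0.
    by rewrite [X in _ <= _ * X]ger0_norm ?subr_ge0 ?(ltW yx) //; apply: h; rewrite normr_ge0 ltW.
  move=> /andP[u0 uv]; have uv' : 0 <= u <= v by rewrite u0.
  apply: le_trans (lip_phi _ _ uv') _; rewrite ler_piMr ?e1 // mulr_ge0 // subr_ge0 //.
have cpsi : continuous psi.
  move=> x; apply/cvgrPdist_le => e e0.
  have A1 : 0 < A + 1 by lra.
  near=> y; apply: le_trans (lip x y) _.
  have : `|x - y| <= e / (A + 1).
    by near: y; apply: cvgr_dist_le => //; rewrite divr_gt0.
  by rewrite ler_pdivlMr //; have := normr_ge0 (x - y); move: `|x - y| => d; nra.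
have [F dF] := continuous_primitive cpsi.
have mvt (x y : R) : 0 <= x -> x <= y -> exists2 c : R, x <= c <= y & F y - F x = phi c * (y - x).
  move=> x0 xy; have [||c] := @MVT_segment R F psi x y xy.
  - by move=> c; rewrite in_itv /= => /andP[xc _]; apply: dF; lra.
  - apply: derivable_within_continuous => c; rewrite in_itv /= => /andP[xc _].
    have c1 : -1 < c by lra.
    exact: (@ex_derive _ _ _ _ _ _ _ (dF c c1)).
  - by rewrite in_itv /= => cxy ->; exists c => //; rewrite psiE //; lra.
have Fmono (x y : R) : 0 <= x -> x <= y -> 0 <= F y - F x <= A * (expR (- x) - expR (- y)).
  move=> x0 xy; apply/andP; split.
    have [c /andP[xc cy] ->] := mvt _ _ x0 xy.
    by rewrite mulr_ge0 ?subr_ge0 //; have /andP[] := pos_phi c (le_trans x0 xc).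
  (* For the upper bound: the derivative of F - A (1 - exp(-x)) is at most 0, which here is stated
     for F + A exp(-x). *)
  have hG (c : R) : -1 < c -> is_derive c 1 (fun x => F x + A * expR (- x)) (psi c + A * - expR (- c)).
    by move=> c1; apply: is_deriveDZ; [exact: dF|exact: is_derive_expRN].
  have [||c] := @MVT_segment R (fun x => F x + A * expR (- x)) (fun c => psi c + A * - expR (- c)) x y xy.
  - by move=> c; rewrite in_itv /= => /andP[xc _]; apply: hG; lra.
  - apply: derivable_within_continuous => c; rewrite in_itv /= => /andP[xc _].
    have c1 : -1 < c by lra.
    exact: (@ex_derive _ _ _ _ _ _ _ (hG c c1)).
  - rewrite in_itv /= => /andP[xc cy] E.
    have c0 : 0 <= c by lra.
    have /andP[_ h] := pos_phi c c0.
    have : (psi c + A * (- expR (- c))) * (y - x) <= 0.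
      by rewrite psiE // mulr_le0_ge0 ?subr_ge0 //; move: h; clear; lra.
    by move: E; clear; lra.
(* Taken as a supremum of values of the primitive, [J] comes with the tail bound [JF]; only then is
   it identified with the integral. *)
pose S : set R := [set v | exists2 x : R, 0 <= x & v = F x - F 0]%classic.
pose J := sup S.
have S0 : (S !=set0)%classic by exists (F 0 - F 0), 0.
have bnd (x : R) : 0 <= x -> ubound S (F x - F 0 + A * expR (- x)).
  move=> x0 _ [y y0 ->]; have [yx|/ltW xy] := leP y x.
    have /andP[h _] := Fmono y x y0 yx.
    by have : 0 <= A * expR (- x) by [nng]; move: h; clear; lra.
  have /andP[_ h] := Fmono x y x0 xy.
  by have : 0 <= A * expR (- y) by [nng]; move: h; clear; lra.
have JF (x : R) : 0 <= x -> 0 <= J - (F x - F 0) <= A * expR (- x).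
  move=> x0; apply/andP; split.
    rewrite subr_ge0; apply: ub_le_sup; last by exists x.
    by exists (F x - F 0 + A * expR (- x)); exact: bnd.
  by rewrite lerBlDr addrC; apply: ge_sup => //; exact: bnd.
exists J; split.
- have -> : (\int[mu]_(x in `]0%R, +oo[) (phi x)%:E = \int[mu]_(x in `]0%R, +oo[) (psi x)%:E)%E.
    by apply: eq_integral => x; rewrite inE /= in_itv /= andbT => x0; rewrite psiE // ltW.
  rewrite integral_itv_obnd_cbnd; last first.
    by apply/measurable_EFinP/measurable_funTS; exact: continuous_measurable_fun.
  rewrite (_ : J = J + F 0 - F 0); last by rewrite addrK.
  rewrite EFinB; apply: (@ge0_continuous_FTC2y R psi F 0 (J + F 0)).
  + by move=> x x0; rewrite psiE //; have /andP[] := pos_phi x x0.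
  + exact: continuous_subspaceT.
  + apply/cvgrPdist_le => e e0; near=> x.
    have x0 : 0 <= x by near: x; exact: nbhs_pinfty_ge.
    have /andP[h1 h2] := JF x x0.
    rewrite ger0_norm; last by move: h1; clear; lra.
    have xe : A / e <= x by near: x; apply: nbhs_pinfty_ge; rewrite num_real.
    have : A * expR (- x) <= e.
      rewrite expRN ler_pdivrMr ?expR_gt0 //; apply: le_trans (_ : e * x <= _).
        by rewrite mulrC -ler_pdivrMr.
      by apply: ler_wpM2l; [exact: ltW|have := expR_ge1Dx x; lra].
    by move: h2; clear; lra.
  + by move=> x x0; have [] := dF x (lt_trans _ x0).
  + have /derivable1_diffP/differentiable_continuous c0 : derivable F 0 1 by have [] := dF 0 (ltac:(lra)).
    by apply: cvg_at_right_filter; exact: c0.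
  + move=> x; rewrite in_itv /= andbT => x0; rewrite derive1E.
    have x1 : -1 < x by lra.
    by have H := dF x x1; exact: derive_val.
- have := JF 0 (lexx _); rewrite subrr subr0 oppr0 expR0 mulr1; exact.
- move=> h K s h01 hs; have /andP[h0 h1] := h01.
  have hK0 (a : nat) : 0 <= h * a%:R by nng.
  have piece (a : nat) : `|F (h * a.+1%:R) - F (h * a%:R) - h * phi (h * s a)| <= A * h ^+ 2 * expR (- (h * a%:R)).
    have e : h * a.+1%:R - h * a%:R = h by rewrite -natr1; ring.
    have le : h * a%:R <= h * a.+1%:R by rewrite ler_pM2l // ler_nat.
    have [c /andP[c1 c2] ->] := mvt _ _ (hK0 a) le.
    rewrite e mulrC -mulrBr normrM (gtr0_norm h0).
    have [s1 s2] := andP (hs a).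
    have hs1 : h * a%:R <= h * s a by rewrite ler_pM2l.
    have hs2 : h * s a <= h * a.+1%:R by rewrite ler_pM2l // -natr1.
    suff key (u v : R) : h * a%:R <= u -> u <= v -> v <= h * a.+1%:R ->
        `|phi v - phi u| <= A * h * expR (- (h * a%:R)).
      rewrite expr2 mulrCA -!mulrA ler_pM2l // mulrA.
      have [cs|/ltW sc] := leP c (h * s a); last exact: key.
      by rewrite distrC; apply: key.
    move=> au uv va; have u0 : 0 <= u by apply: le_trans au.
    apply: le_trans (lip_phi u v (introT andP (conj u0 uv))) _.
    apply: ler_pM; rewrite ?expR_ge0 ?mulr_ge0 ?subr_ge0 // ?ler_expR ?lerN2 //.
    by apply: ler_wpM2l => //; move: e au va; clear; lra.
  have tel : F (h * K%:R) - F 0 - h * \sum_(a < K) phi (h * s a) =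
      \sum_(a < K) (F (h * a.+1%:R) - F (h * a%:R) - h * phi (h * s a)).
    rewrite sumrB -mulr_sumr; congr (_ - _).
    by rewrite -(big_mkord xpredT (fun a => F (h * a.+1%:R) - F (h * a%:R))) telescope_sumr // mulr0.
  have : `|F (h * K%:R) - F 0 - h * \sum_(a < K) phi (h * s a)| <= A * (2 * h).
    rewrite tel; apply: le_trans (ler_norm_sum _ _ _) _.
    apply: (@le_trans _ _ (\sum_(a < K) A * h ^+ 2 * expR (- (h * a%:R)))).
      by apply: ler_sum => a _; exact: piece.
    rewrite -mulr_sumr -mulrA; apply: ler_wpM2l => //.
    apply: le_trans (ler_wpM2l _ (exp_sum_bound K h01)) _; first by nng.
    by rewrite le_eqVlt; apply/orP; left; apply/eqP; field; rewrite gt_eqF.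
  have /andP[t1 t2] := JF (h * K%:R) (hK0 K).
  rewrite !ler_norml => /andP[u1 u2]; apply/andP; split; move: t1 t2 u1 u2; clear; lra.
Unshelve. all: by end_near.
Qed.

End HalfLine.

Lemma ler_sum_subseq (R : numDomainType) (T : eqType) (s1 s2 : seq T) (F : T -> R) :
  uniq s1 -> {subset s1 <= s2} -> (forall x, 0 <= F x) ->
  \sum_(x <- s1) F x <= \sum_(x <- s2) F x.
Proof.
move=> u1 s12 F0; elim: s1 s2 u1 s12 => [|x s1 IH] s2 /=.
  by move=> _ _; rewrite big_nil; apply: sumr_ge0.
move=> /andP[xs1 u1] s12; have xs2 : x \in s2 by apply: s12; rewrite mem_head.
rewrite big_cons (perm_big _ (perm_to_rem xs2)) big_cons lerD2l.
apply: IH => // y ys1; have ys2 : y \in s2 by apply: s12; rewrite inE ys1 orbT.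
have := perm_mem (perm_to_rem xs2) y; rewrite ys2 inE => /esym/orP[/eqP yx|//].
by rewrite yx in ys1; rewrite ys1 in xs1.
Qed.

(** * Gaussian sums over the integers *)

Section LatticeGauss.
Context {R : realType}.
Local Notation mu := (@lebesgue_measure R).

Lemma gauss_fun_exp_decay : exp_decay (2 * expR 1) (@gauss_fun R).
Proof.
have E (x : R) : expR (- x ^+ 2) <= expR 1 * expR (- x).
  rewrite -expRD ler_expR -subr_ge0 [X in 0 <= X](_ : _ = (x - 1 / 2) ^+ 2 + 3 / 4); last by field.
  by apply: addr_ge0 => //; exact: sqr_ge0.
split=> [x x0|x y /andP[x0 xy]].
  rewrite gauss_fun_ge0 /= /gauss_fun; apply: le_trans (E x) _.
  by rewrite -mulrA ler_peMl ?mulr_ge0 ?expR_ge0 // ler1n.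
have dg (c : R) : is_derive c 1 (@gauss_fun R) (- (2 * c * expR (- c ^+ 2))).
  have h1 : is_derive (- c ^+ 2) 1 (@expR R) (expR (- c ^+ 2)) by exact: is_derive_expR.
  have h2 : is_derive c 1 (- (fun x : R => x ^+ 2)) (- (2 * c)).
    have -> : (fun x : R => x ^+ 2) = (id : R -> R) ^+ 2 by exact/funext.
    by apply: is_derive_eq; rewrite expr1 /GRing.scale /= mulr1.
  have h3 := @is_derive1_comp R (@expR R) (- (fun x : R => x ^+ 2)) c _ _ h1 h2.
  by apply: (is_derive_eq h3); rewrite mulrN mulrC.
have [|c] := @MVT_segment R (@gauss_fun R) (fun c => - (2 * c * expR (- c ^+ 2))) x y xy.
  by apply: continuous_subspaceT; exact: continuous_gauss_fun.
rewrite in_itv /= => /andP[xc cy] ->; rewrite normrM normrN.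
have c0 : 0 <= c by lra.
rewrite !ger0_norm ?subr_ge0 //; last by nng.
rewrite [X in _ <= X]mulrAC; apply: ler_wpM2r; first by rewrite subr_ge0.
rewrite -!mulrA; apply: ler_wpM2l => //.
have h1 : c <= expR c by have := expR_ge1Dx c; lra.
apply: le_trans (ler_wpM2r (expR_ge0 _) h1) _; rewrite -!expRD ler_expR.
rewrite -subr_ge0 [X in 0 <= X](_ : _ = (c - 1) ^+ 2 + (c - x)); last by ring.
by apply: addr_ge0; [exact: sqr_ge0 | rewrite subr_ge0].
Qed.

Lemma integral_gauss_half :
  (\int[mu]_(x in `]0%R, +oo[) (@gauss_fun R x)%:E)%E = (Num.sqrt pi / 2)%:E.
Proof.
rewrite integral_itv_obnd_cbnd ?integral0y_gauss //.
by apply/measurable_EFinP/measurable_funTS; exact: measurable_gauss_fun.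
Qed.

(** The integers split at the ceiling of [z] into two half-lines, whose i-th points lie at distance
    between i and i+1 from [z]: two Riemann sums of the half Gaussian. The error is uniform in [z],
    but a segment catches the mass only when it is long in terms of [z]; hence [M0] in the lower
    bound. *)
Lemma gauss_line_sum : exists2 A : R, 0 <= A & forall h z : R, 0 < h <= 1 ->
  (forall m n : nat, h * \sum_(a < n) gauss_fun (h * (((a : nat)%:Z - m%:Z)%:~R - z))
     <= Num.sqrt pi + A * h) /\
  (exists M0 : nat, forall M : nat, (M0 <= M)%N -> Num.sqrt pi - A * h <=
     h * \sum_(a < (M + M).+1) gauss_fun (h * (((a : nat)%:Z - M%:Z)%:~R - z))).
Proof.
have [J [Jint _ HJ]] := riemann_half_line gauss_fun_exp_decay.
move: Jint; rewrite integral_gauss_half => -[JE].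
have A0 : 0 <= 2 * expR 1 :> R by nng.
move: (2 * expR 1) A0 HJ => A A0 HJ.
exists (6 * A); first by nng.
move=> h z h01; have /andP[h0 h1] := h01.
pose c := Num.ceil z.
have /andP[c1 c2] : c%:~R - 1 < z <= c%:~R.
  by have := Num.Theory.ceil_itv z; rewrite rmorphB.
have memU (k : int) (K : nat) : c <= k -> k < c + K%:Z -> k \in [seq c + (i : nat)%:Z | i <- iota 0 K].
  move=> ck kK; apply/mapP; exists (absz (k - c)%R); first by rewrite mem_iota /= add0n; lia.
  by move: (c) ck => c' ck; lia.
have memD (k : int) (K : nat) : k <= c - 1 -> c - 1 - k < K%:Z -> k \in [seq c - 1 - (i : nat)%:Z | i <- iota 0 K].
  move=> ck kK; apply/mapP; exists (absz (c - 1 - k)%R); first by rewrite mem_iota /= add0n; lia.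
  by move: (c) ck => c' ck; lia.
have memM (k : int) (M K : nat) : - M%:Z <= k -> k + M%:Z < K%:Z -> k \in [seq (i : nat)%:Z - M%:Z | i <- iota 0 K].
  move=> ck kK; apply/mapP; exists (absz (k + M%:Z)%R); first by rewrite mem_iota /= add0n; lia.
  by lia.
pose G (k : int) := gauss_fun (h * (k%:~R - z)).
have G0 k : 0 <= G k by exact: gauss_fun_ge0.
pose s2 K := [seq c + (i : nat)%:Z | i <- iota 0 K] ++ [seq c - 1 - (i : nat)%:Z | i <- iota 0 K].
have u2 K : uniq (s2 K).
  rewrite cat_uniq !map_inj_uniq ?iota_uniq /= ?andbT; last 2 first.
  - by move=> i j /addrI /oppr_inj [].
  - by move=> i j /addrI [].
  by apply/hasPn => x /mapP[i _ ->]; apply/mapP => -[j _]; lia.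
have iE (F : nat -> R) K : \sum_(i <- iota 0 K) F i = \sum_(i < K) F i.
  by rewrite -[RHS](big_mkord xpredT) /index_iota subn0.
have S2 K : `|h * \sum_(k <- s2 K) G k - Num.sqrt pi| <= 2 * A * (2 * h + expR (- (h * K%:R))).
  rewrite big_cat /= !big_map !iE.
  have e1 : \sum_(i < K) G (c + (i : nat)%:Z) = \sum_(i < K) gauss_fun (h * ((fun a : nat => a%:R + (c%:~R - z)) i)).
    by apply: eq_bigr => i _; rewrite /G rmorphD /=; congr (gauss_fun (h * _)); ring.
  have e2 : \sum_(i < K) G (c - 1 - (i : nat)%:Z) = \sum_(i < K) gauss_fun (h * ((fun a : nat => a%:R + 1 - (c%:~R - z)) i)).
    apply: eq_bigr => i _; rewrite /G !rmorphB /=.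
    by rewrite /gauss_fun; congr (expR (- _)); rewrite -[in RHS]sqrrN; congr (_ ^+ 2); ring.
  have b1 := HJ h K (fun a : nat => a%:R + (c%:~R - z)) h01 (ltac:(by move=> a; apply/andP; split; lra)).
  have b2 := HJ h K (fun a : nat => a%:R + 1 - (c%:~R - z)) h01 (ltac:(by move=> a; apply/andP; split; lra)).
  rewrite e1 e2 (_ : _ - Num.sqrt pi = (h * \sum_(i < K) gauss_fun (h * ((fun a : nat => a%:R + (c%:~R - z)) i)) - J) +
    (h * \sum_(i < K) gauss_fun (h * ((fun a : nat => a%:R + 1 - (c%:~R - z)) i)) - J)); last first.
    by rewrite -JE; field.
  apply: le_trans (ler_normD _ _) _.
  by apply: le_trans (lerD b1 b2) _; rewrite le_eqVlt; apply/orP; left; apply/eqP; ring.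
have Klarge : exists K0 : nat, forall K : nat, (K0 <= K)%N -> expR (- (h * K%:R)) <= h.
  exists (Num.truncn (h ^- 2)).+1 => K K0.
  have hK : h ^- 2 <= K%:R.
    apply: le_trans (ltW (truncnS_gt _)) _; by rewrite ler_nat.
  have hp : 0 < h * K%:R by rewrite mulr_gt0 //; apply: lt_le_trans hK; rewrite invr_gt0 exprn_gt0.
  rewrite expRN -[leRHS]invrK lef_pV2 ?posrE ?expR_gt0 ?invr_gt0 //.
  apply: le_trans (_ : h * K%:R <= _); last by have := expR_ge1Dx (h * K%:R); lra.
  by rewrite -ler_pdivrMl // -expr2 exprVn.
have [K0 hK0] := Klarge.
have bound K : (K0 <= K)%N -> `|h * \sum_(k <- s2 K) G k - Num.sqrt pi| <= 6 * A * h.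
  move=> /hK0 hK; apply: le_trans (S2 K) _.
  rewrite (_ : 6 * A * h = 2 * A * (2 * h + h)); last by ring.
  by apply: ler_wpM2l; [nng | rewrite lerD2l].
have s1E m n : \sum_(a < n) gauss_fun (h * (((a : nat)%:Z - m%:Z)%:~R - z)) = \sum_(k <- [seq (a : nat)%:Z - m%:Z | a <- iota 0 n]) G k.
  by rewrite big_map iE.
split=> [m n|].
  pose K := (K0 + (m + n + `|c|).+1)%N.
  have /(_ (leq_addr _ _)) := bound K; rewrite ler_norml => /andP[_ b].
  rewrite s1E; apply: le_trans (_ : h * \sum_(k <- s2 K) G k <= _); last by move: b; clear; lra.
  rewrite ler_pM2l //; apply: ler_sum_subseq => //.
    by rewrite map_inj_uniq ?iota_uniq // => i j /addIr [].
  move=> k /mapP[a]; rewrite mem_iota add0n => /andP[_ an] ->.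
  rewrite mem_cat; apply/orP; case: (leP c (Posz a - Posz m)) => ca; [left|right].
    by apply: memU; rewrite /K; lia.
  by apply: memD; rewrite /K; lia.
exists (K0 + `|c| + 1)%N => M hM.
have := bound K0 (leqnn _); rewrite ler_norml => /andP[b _].
rewrite s1E; apply: le_trans (_ : h * \sum_(k <- s2 K0) G k <= _); first by move: b; clear; lra.
rewrite ler_pM2l //; apply: ler_sum_subseq => // k.
rewrite mem_cat => /orP[] /mapP[i]; rewrite mem_iota add0n => /andP[_ iK] ->; apply: memM; lia.
Qed.

End LatticeGauss.

Section ConsFunctions.
Context {d : nat}.

(** The position is a parameter because Gaussian sums eliminate coordinate 0, while orthant sums
    eliminate the last one, as [orthant_integral] does. *)
Definition finsert {T : Type} (p : 'I_d.+1) (a : T) (f : {ffun 'I_d -> T}) : {ffun 'I_d.+1 -> T} :=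
  [ffun i => if unlift p i is Some j then f j else a].

Lemma finsert_at T p (a : T) f : finsert p a f p = a.
Proof. by rewrite ffunE unlift_none. Qed.

Lemma finsert_lift T p (a : T) f j : finsert p a f (lift p j) = f j.
Proof. by rewrite ffunE liftK. Qed.

Lemma sum_ffun_insert (V : nmodType) (J : finType) (p : 'I_d.+1) (G : {ffun 'I_d.+1 -> J} -> V) :
  \sum_f G f = \sum_a \sum_f G (finsert p a f).
Proof.
rewrite pair_bigA /= (reindex (fun u : J * {ffun 'I_d -> J} => finsert p u.1 u.2)) //=.
exists (fun f : {ffun 'I_d.+1 -> J} => (f p, [ffun j => f (lift p j)])) => [[a f] _|f _] /=.
  by rewrite finsert_at; congr (_, _); apply/ffunP => j; rewrite ffunE finsert_lift.
apply/ffunP => i; rewrite ffunE; case: unliftP => [j ->|->] //.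
by rewrite ffunE.
Qed.

Lemma boxpt_cons M a (f : {ffun 'I_d -> 'I_(M + M).+1}) :
  boxpt (finsert ord0 a f) = finsert ord0 ((a : nat)%:Z - M%:Z) (boxpt f).
Proof.
apply/ffunP => i; case: (unliftP ord0 i) => [j ->|->]; rewrite ffunE.
  by rewrite !finsert_lift ffunE.
by rewrite !finsert_at.
Qed.

Lemma boxsum_cons (V : nmodType) M (F : lattice d.+1 -> V) :
  boxsum M F = boxsum M (fun y => \sum_(a < (M + M).+1) F (finsert ord0 ((a : nat)%:Z - M%:Z) y)).
Proof.
rewrite /boxsum (sum_ffun_insert ord0) exchange_big /=; apply: eq_bigr => f _.
by apply: eq_bigr => a _; rewrite boxpt_cons.
Qed.

End ConsFunctions.

Lemma boxsum_mono d (R : numDomainType) M1 M (F : lattice d -> R) :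
  (M1 <= M)%N -> (forall y, 0 <= F y) -> boxsum M1 F <= boxsum M F.
Proof.
move=> M1M F0; rewrite !boxsumE; apply: ler_sum_subseq => //.
  by rewrite map_inj_uniq ?enum_uniq //; exact: boxpt_inj.
move=> y /mapP[v _ ->].
have /boxptP[u uE] : in_box M (boxpt v).
  by apply/forallP => i; rewrite ffunE; move: (v i) => [u hu] /=; lia.
by apply/mapP; exists u; rewrite ?mem_enum.
Qed.

(** * Gaussian sums over the lattice, by Schur complements *)

Section GaussMass.
Context {R : realType}.

Definition posdef d (A : 'M[R]_d) := forall x : 'rV[R]_d, x != 0 -> 0 < qform A x.

(** For symmetric positive definite [A], the integral of exp(-qform A x / 2) over R^d. *)
Definition gauss_mass d (A : 'M[R]_d) : R := Num.sqrt ((2 * pi) ^+ d / \det A).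

Definition gsum d (A : 'M[R]_d) (h : R) (M : nat) (z : 'rV[R]_d) : R :=
  h ^+ d * boxsum M (fun y => expR (- qform A (h *: (pos y - z)) / 2)).

Definition schur d (A : 'M[R]_d.+1) : 'M[R]_d :=
  \matrix_(i, j) (A (lift ord0 i) (lift ord0 j) - A (lift ord0 i) ord0 * A ord0 (lift ord0 j) / A ord0 ord0).

Section Schur.
Variables (d : nat) (A : 'M[R]_d.+1).
Hypothesis Asym : A^T = A.
Hypothesis Apos : posdef A.

Lemma sym_entry i j : A i j = A j i.
Proof. by rewrite -[in LHS]Asym mxE. Qed.

Definition tailv (x : 'rV[R]_d.+1) : 'rV[R]_d := \row_j x 0 (lift ord0 j).
Definition headform (x : 'rV[R]_d.+1) : R := \sum_j A ord0 (lift ord0 j) * x 0 (lift ord0 j).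

Lemma schur_diag_gt0 : 0 < A ord0 ord0.
Proof.
have : delta_mx 0 ord0 != 0 :> 'rV[R]_d.+1.
  by apply/eqP => /rowP/(_ ord0)/eqP; rewrite !mxE eqxx oner_eq0.
move=> /Apos; rewrite /qform bformE (bigD1 ord0) //= [X in _ + X]big1; last first.
  by move=> i i0; rewrite big1 // => j _; rewrite !mxE (negPf i0) andbF !mul0r.
rewrite addr0 (bigD1 ord0) //= big1; last first.
  by move=> j j0; rewrite !mxE (negPf j0) andbF !mulr0.
by rewrite !mxE eqxx mul1r mulr1 addr0.
Qed.

(** Completing the square in coordinate 0: the sum over that coordinate becomes a one-dimensional
    Gaussian sum with a shifted centre. *)
Lemma qform_schur x : qform A x =
  A ord0 ord0 * (x 0 ord0 + headform x / A ord0 ord0) ^+ 2 + qform (schur A) (tailv x).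
Proof.
have a0 := schur_diag_gt0; set a := A ord0 ord0 in a0 *.
have E1 : qform A x = a * x 0 ord0 ^+ 2 + 2 * x 0 ord0 * headform x +
   \sum_i \sum_j x 0 (lift ord0 i) * A (lift ord0 i) (lift ord0 j) * x 0 (lift ord0 j).
  rewrite /qform bformE big_ord_recl.
  under [X in _ + X]eq_bigr do rewrite big_ord_recl.
  rewrite big_split /= big_ord_recl /= -/a.
  have -> : \sum_(i < d) x 0 ord0 * A ord0 (lift ord0 i) * x 0 (lift ord0 i) = x 0 ord0 * headform x.
    by rewrite /headform mulr_sumr; apply: eq_bigr => i _; rewrite mulrA.
  have -> : \sum_(i < d) x 0 (lift ord0 i) * A (lift ord0 i) ord0 * x 0 ord0 = x 0 ord0 * headform x.
    by rewrite /headform mulr_sumr; apply: eq_bigr => i _; rewrite sym_entry; ring.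
  by ring.
have E2 : qform (schur A) (tailv x) = \sum_i \sum_j x 0 (lift ord0 i) * A (lift ord0 i) (lift ord0 j) * x 0 (lift ord0 j) - headform x ^+ 2 / a.
  rewrite /qform bformE.
  have -> : headform x ^+ 2 / a = \sum_i \sum_j x 0 (lift ord0 i) * (A (lift ord0 i) ord0 * A ord0 (lift ord0 j) / a) * x 0 (lift ord0 j).
    rewrite expr2 {1}/headform !mulr_suml; apply: eq_bigr => i _.
    rewrite /headform mulr_sumr mulr_suml; apply: eq_bigr => j _.
    by rewrite [A (lift _ i) ord0]sym_entry; ring.
  rewrite -sumrB; apply: eq_bigr => i _; rewrite -sumrB; apply: eq_bigr => j _.
  by rewrite !mxE; ring.
rewrite E1 E2; move: (headform x) (\sum_i _) => t s.
by field; rewrite gt_eqF.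
Qed.

Lemma schur_sym : (schur A)^T = schur A.
Proof.
apply/matrixP => i j; rewrite !mxE sym_entry; congr (_ - _ / _).
by rewrite mulrC; congr (_ * _); exact: sym_entry.
Qed.

Lemma schur_posdef : posdef (schur A).
Proof.
move=> x x0.
(* The first entry is chosen to cancel the square in [qform_schur], so only the Schur complement at
   [x] is left. *)
pose y : 'rV[R]_d.+1 := \row_i (if unlift ord0 i is Some j then x 0 j else
   - (\sum_j A ord0 (lift ord0 j) * x 0 j) / A ord0 ord0).
have yl j : y 0 (lift ord0 j) = x 0 j by rewrite mxE liftK.
have ty : tailv y = x by apply/rowP => j; rewrite mxE yl.
have hy : headform y = \sum_j A ord0 (lift ord0 j) * x 0 j.
  by apply: eq_bigr => j _; rewrite yl.
have : y != 0.
  apply: contra x0 => /eqP y0; apply/eqP/rowP => j.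
  by rewrite -yl y0 !mxE.
move=> /Apos; rewrite qform_schur ty hy.
have -> : y 0 ord0 = - (\sum_j A ord0 (lift ord0 j) * x 0 j) / A ord0 ord0 by rewrite mxE unlift_none.
by rewrite mulNr addNr expr0n mulr0 add0r.
Qed.

Lemma det_schur : \det A = A ord0 ord0 * \det (schur A).
Proof.
have a0 := schur_diag_gt0.
pose B : 'M[R]_(1 + d) := A.
pose L : 'M[R]_(1 + d) := block_mx 1%:M 0 ((A ord0 ord0)^-1 *: dlsubmx B) 1%:M.
pose U : 'M[R]_(1 + d) := block_mx (ulsubmx B) (ursubmx B) 0 (schur A).
have lsh : lshift d (0 : 'I_1) = ord0 by apply/val_inj.
have rsh (j : 'I_d) : rshift 1 j = lift ord0 j by apply/val_inj.
have E : B = L *m U.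
  rewrite /L /U mulmx_block !(mul1mx, mul0mx, mulmx0, addr0).
  rewrite -[LHS]submxK; congr block_mx.
    apply/matrixP => i j; rewrite mxE [RHS]mxE big_ord1 !mxE (ord1 j) lsh !rsh.
    by rewrite mulrAC mulVf ?mul1r // gt_eqF.
  apply/matrixP => i j; rewrite [RHS]mxE [X in _ = X + _]mxE big_ord1 !mxE !lsh !rsh.
  by field; rewrite gt_eqF.
transitivity (\det (L *m U)); first by rewrite -E.
rewrite det_mulmx /L /U det_lblock det_ublock !det1 !mul1r; congr (_ * _).
by rewrite det_mx11 !mxE lsh.
Qed.

End Schur.

Lemma posdef_det_gt0 d (A : 'M[R]_d) : A^T = A -> posdef A -> 0 < \det A.
Proof.
elim: d A => [|d IH] A As Ap; first by rewrite det_mx00.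
rewrite det_schur // mulr_gt0 ?schur_diag_gt0 //.
by apply: IH; [exact: schur_sym | exact: schur_posdef].
Qed.

Lemma gauss_mass_schur d (A : 'M[R]_d.+1) : A^T = A -> posdef A ->
  gauss_mass A = (Num.sqrt (A ord0 ord0 / 2))^-1 * Num.sqrt pi * gauss_mass (schur A).
Proof.
move=> As Ap; have a0 := schur_diag_gt0 Ap.
rewrite /gauss_mass det_schur // -sqrtrV; last by rewrite divr_ge0 // ltW.
have p0 : 0 <= (A ord0 ord0 / 2)^-1 :> R by rewrite invr_ge0 divr_ge0 // ltW.
rewrite -!sqrtrM ?mulr_ge0 ?pi_ge0 //; congr Num.sqrt.
rewrite exprS; have := posdef_det_gt0 (schur_sym As) (schur_posdef As Ap).
by move=> ?; field; rewrite !gt_eqF.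
Qed.

(** The centre [w y] of the inner sum varies with [y], which is why line sums had to be controlled
    uniformly in the centre. The factor sqrt(A_00 / 2) appears because [gauss_fun] is exp(-x^2). *)
Lemma gsum_schur d (A : 'M[R]_d.+1) (h : R) (z : 'rV[R]_d.+1) :
  A^T = A -> posdef A -> h != 0 ->
  exists w : lattice d -> R, forall M, gsum A h M z =
    h ^+ d * boxsum M (fun y => expR (- qform (schur A) (h *: (pos y - tailv z)) / 2) *
      ((Num.sqrt (A ord0 ord0 / 2))^-1 * (Num.sqrt (A ord0 ord0 / 2) * h *
        \sum_(a < (M + M).+1) gauss_fun (Num.sqrt (A ord0 ord0 / 2) * h * (((a : nat)%:Z - M%:Z)%:~R - w y))))).
Proof.
move=> As Ap h0; have a0 := schur_diag_gt0 Ap; set c := Num.sqrt _.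
have c0 : 0 < c by rewrite sqrtr_gt0 divr_gt0.
have cc : c ^+ 2 = A ord0 ord0 / 2 by rewrite sqr_sqrtr // divr_ge0 // ltW.
pose w (y : lattice d) : R := z 0 ord0 - (\sum_j A ord0 (lift ord0 j) * (pos y 0 j - z 0 (lift ord0 j))) / A ord0 ord0.
exists w => M; rewrite /gsum exprSr -mulrA boxsum_cons {1}/boxsum mulr_sumr; congr (_ * _).
apply: eq_bigr => v _.
rewrite -[c * h * \sum_(a < _) _]mulrA (mulKf (lt0r_neq0 c0)) [RHS]mulrCA; congr (_ * _).
rewrite mulr_sumr.
apply: eq_bigr => a _; set k := (_ - _ : int); set y := boxpt v.
have E1 : tailv (h *: (pos (finsert ord0 k y) - z)) = h *: (pos y - tailv z).
  by apply/rowP => j; rewrite !mxE finsert_lift.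
have E2 : headform A (h *: (pos (finsert ord0 k y) - z)) = h * \sum_j A ord0 (lift ord0 j) * (pos y 0 j - z 0 (lift ord0 j)).
  rewrite /headform mulr_sumr; apply: eq_bigr => j _.
  by rewrite !mxE finsert_lift mulrCA.
have E3 : (h *: (pos (finsert ord0 k y) - z)) 0 ord0 = h * (k%:~R - z 0 ord0).
  by rewrite !mxE finsert_at.
rewrite qform_schur // E1 E2 E3 /gauss_fun -expRD; congr expR.
rewrite !exprMn cc /w.
move: (\sum_j _) (qform _ _) (k%:~R) => s u kk.
by field; rewrite gt_eqF.
Qed.

(** Induction on the dimension. [h0] is chosen before the centre [z], whereas [M0] may depend on it:
    the kernel of [j] steps has mesh j^(-1/2) and a centre that moves with [j]. *)
Lemma gauss_mass_lim d (A : 'M[R]_d) : A^T = A -> posdef A -> forall e : R, 0 < e ->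
  exists2 h0 : R, 0 < h0 & forall (h : R) (z : 'rV[R]_d), 0 < h <= h0 ->
    (forall M, gsum A h M z <= gauss_mass A + e) /\
    (exists M0 : nat, forall M, (M0 <= M)%N -> gauss_mass A - e <= gsum A h M z).
Proof.
elim: d A => [|d IH] A As Ap e e0.
  exists 1 => // h z _.
  have E M : gsum A h M z = 1.
    rewrite /gsum /boxsum expr0 mul1r.
    rewrite (eq_bigr (fun=> 1)) ?sumr_const ?card_ffun ?card_ord ?expn0 // => v _.
    by rewrite /qform bformE big_ord0 oppr0 mul0r expR0.
  have -> : gauss_mass A = 1 by rewrite /gauss_mass expr0 det_mx00 divr1 sqrtr1.
  by split=> [M|]; [|exists 0%N => M _]; rewrite E; move: e0; clear; lra.
have a0 := schur_diag_gt0 Ap.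
set S := schur A; set c := Num.sqrt (A ord0 ord0 / 2).
have c0 : 0 < c by rewrite sqrtr_gt0 divr_gt0.
set I := c^-1 * Num.sqrt pi; set m := gauss_mass S.
have I0 : 0 < I by apply: mulr_gt0; [rewrite invr_gt0 | rewrite sqrtr_gt0 pi_gt0].
have m0 : 0 <= m by exact: sqrtr_ge0.
have mE : gauss_mass A = I * m by rewrite gauss_mass_schur.
(* These bounds give (I + dl)(m + dl) <= I m + e, the matching lower bound, and I - dl >= 0. *)
pose dl := Num.min 1 (Num.min I (e / (I + m + 1))).
have dl0 : 0 < dl by rewrite !lt_min ltr01 I0 divr_gt0 //; move: I0 m0; clear; lra.
have dl1 : dl <= 1 by rewrite ge_min lexx.
have dlI : dl <= I by rewrite !ge_min lexx orbT.
have dle : dl * (I + m + 1) <= e.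
  rewrite -ler_pdivlMr; last by move: I0 m0; clear; lra.
  by rewrite !ge_min lexx !orbT.
clearbody dl.
have [h1 h10 H1] := IH S (schur_sym As) (schur_posdef As Ap) dl dl0.
have [B B0 HB] := @gauss_line_sum R.
exists (Num.min h1 (Num.min c^-1 (dl / (B + 1)))).
  by rewrite !lt_min h10 invr_gt0 c0 divr_gt0 //; move: B0; clear; lra.
move=> h z /andP[hp]; rewrite !le_min => /and3P[hh1 hc hB].
have hBd : B * h <= dl.
  move: hB; rewrite ler_pdivlMr; last by move: B0; clear; lra.
  by move: hp B0; clear; nra.
have Hch : 0 < c * h <= 1.
  by rewrite mulr_gt0 //= -[leRHS](mulfV (lt0r_neq0 c0)) ler_pM2l.
have [up lo] := H1 h (tailv z) (introT andP (conj hp hh1)).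
have hne : h != 0 by rewrite gt_eqF.
have line y : let L M := c^-1 * (c * h * \sum_(a < (M + M).+1) gauss_fun (c * h * (((a : nat)%:Z - M%:Z)%:~R - y))) in
  (forall M, L M <= I + dl) /\ exists M0 : nat, forall M, (M0 <= M)%N -> I - dl <= L M.
  have [u [M0 l]] := HB (c * h) y Hch.
  have cB : c^-1 * (B * (c * h)) <= dl.
    by rewrite (_ : c^-1 * _ = B * h) //; field; rewrite gt_eqF.
  have ci : 0 <= c^-1 by rewrite invr_ge0 ltW.
  split=> [M|]; last exists M0 => M /l lM.
    apply: le_trans (ler_wpM2l ci (u M _)) _.
    by rewrite mulrDr lerD2l.
  apply: le_trans (ler_wpM2l ci lM); rewrite mulrBr -/I.
  by move: cB; clear; lra.
have e_ge0 (x : R) := expR_ge0 x.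
have hd : 0 <= h ^+ d by rewrite exprn_ge0 // ltW.
have [w Ew] := gsum_schur z As Ap hne; rewrite -/c -/S in Ew.
split=> [M|].
  rewrite Ew; apply: le_trans (_ : (I + dl) * gsum S h M (tailv z) <= _).
    rewrite /gsum mulrCA; apply: ler_wpM2l => //.
    rewrite /boxsum mulr_sumr; apply: ler_sum => v _.
    rewrite [leRHS]mulrC; apply: ler_wpM2l => //.
    by have [] := line (w (boxpt v)).
  apply: le_trans (ler_wpM2l _ (up M)) _; first by apply: addr_ge0; exact: ltW.
  rewrite mE -/m; move: dle dl0 dl1 I0 m0; clear; nra.
have [M1 hM1] := lo.
(* Only the finitely many tails in the cube of size [M1] need long lines, so one [M] serves them
   all; the other tails only add nonnegative terms. *)
have /fin_all_exists[f hf] : forall v : {ffun 'I_d -> 'I_(M1 + M1).+1}, exists M0 : nat, forall M, (M0 <= M)%N ->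
   I - dl <= c^-1 * (c * h * \sum_(a < (M + M).+1) gauss_fun (c * h * (((a : nat)%:Z - M%:Z)%:~R - w (boxpt v)))).
  by move=> v; have [] := line (w (boxpt v)).
exists (maxn M1 (\max_v f v)) => M; rewrite geq_max => /andP[M1M fM].
rewrite Ew; apply: le_trans (ler_wpM2l hd (boxsum_mono M1M _)); last first.
  by move=> y; rewrite !mulr_ge0 ?invr_ge0 ?(ltW c0) ?(ltW hp) //; apply: sumr_ge0 => a _; exact: gauss_fun_ge0.
apply: le_trans (_ : (I - dl) * gsum S h M1 (tailv z) <= _).
  apply: le_trans (ler_wpM2l _ (hM1 M1 (leqnn _))); last by rewrite subr_ge0.
  by rewrite mE -/m; move: dle dl0 dl1 I0 m0 dlI; clear; nra.
rewrite /gsum mulrCA; apply: ler_wpM2l => //.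
rewrite /boxsum mulr_sumr; apply: ler_sum => v _.
rewrite [leLHS]mulrC; apply: ler_wpM2l => //.
by apply: hf; apply: leq_trans fM; exact: leq_bigmax.
Qed.

End GaussMass.

(** * Riemann sums over the positive orthant *)

Section OrthantSums.
Context {R : realType}.
Local Notation mu := (@lebesgue_measure R).
Implicit Types (g : (nat -> R) -> R) (u : nat -> R).

Definition upd (u : nat -> R) (c : nat) (x : R) : nat -> R := fun i => if i == c then x else u i.

(** [exp_decay] in each of the first [c] coordinates, the other ones keeping their exponential
    factors; fixing the last coordinate preserves this form. *)
Definition orthant_decay (c : nat) (A : R) (g : (nat -> R) -> R) :=
  (forall u : nat -> R, (forall i, 0 <= u i) -> 0 <= g u <= A * \prod_(l < c) expR (- u l)) /\
  (forall (i : 'I_c) (u : nat -> R) (x y : R), (forall i, 0 <= u i) -> 0 <= x <= y ->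
    `|g (upd u i y) - g (upd u i x)| <= A * (y - x) * expR (- x) * \prod_(l < c | l != i) expR (- u l)).

(** Coordinates from [c] on are 0, as in the base case of [orthant_integral]. *)
Definition lpt (h : R) (N c : nat) (v : {ffun 'I_c -> 'I_N}) : nat -> R :=
  fun i => if insub i is Some j then h * (v j)%:R else 0.

Definition orthant_sum (h : R) (N c : nat) (g : (nat -> R) -> R) : R :=
  h ^+ c * \sum_(v : {ffun 'I_c -> 'I_N}) g (lpt h v).

Lemma lpt_insert (h : R) (N c : nat) (v : {ffun 'I_c -> 'I_N}) (a : 'I_N) :
  lpt h (finsert ord_max a v) = upd (lpt h v) c (h * a%:R).
Proof.
apply/funext => i; rewrite /lpt /upd.
have [->|ic] := eqVneq i c.
  case: insubP => [j _ jc|]; last by rewrite ltnSn.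
  by have -> : j = ord_max by [apply/val_inj]; rewrite finsert_at.
case: insubP => [j _ ji|]; case: insubP => [j' _ j'i|] //=.
- have -> : j = lift ord_max j'.
    by apply/val_inj; rewrite /= /bump ji -j'i leqNgt ltn_ord add0n.
  by rewrite finsert_lift.
- by have := ltn_ord j; rewrite ji; lia.
- by have := ltn_ord j'; rewrite j'i; lia.
Qed.

Lemma orthant_sumS (h : R) (N c : nat) g :
  orthant_sum h N c.+1 g = h * \sum_(a < N) orthant_sum h N c (fun u => g (upd u c (h * a%:R))).
Proof.
rewrite /orthant_sum (sum_ffun_insert ord_max) exprS -mulrA; congr (_ * _).
rewrite mulr_sumr; apply: eq_bigr => a _; congr (_ * _).
by apply: eq_bigr => v _; rewrite lpt_insert.
Qed.

Lemma lpt_ge0 (h : R) (N c : nat) (v : {ffun 'I_c -> 'I_N}) i : 0 <= h -> 0 <= lpt h v i.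
Proof. by move=> h0; rewrite /lpt; case: insub => // j; rewrite mulr_ge0. Qed.

Lemma exp_mesh_bound (h : R) (N : nat) : 0 < h <= 1 -> h * \sum_(a < N) expR (- (h * a%:R)) <= 2.
Proof. by move=> h01; have := exp_sum_bound N h01; case/andP: h01 => h0 _; rewrite ler_pdivlMr // mulrC. Qed.

Lemma upd_ge0 u c (x : R) : (forall i, 0 <= u i) -> 0 <= x -> forall i, 0 <= upd u c x i.
Proof. by move=> u0 x0 i; rewrite /upd; case: eqP. Qed.

Lemma prod_upd c u (x : R) (P : pred 'I_c) :
  \prod_(l < c | P l) expR (- upd u c x l) = \prod_(l < c | P l) expR (- u l).
Proof. by apply: eq_bigr => l _; rewrite /upd ltn_eqF. Qed.

Lemma orthant_sum_bound (h : R) (N c : nat) g (B : R) : 0 < h <= 1 -> 0 <= B ->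
  (forall u, (forall i, 0 <= u i) -> `|g u| <= B * \prod_(l < c) expR (- u l)) ->
  `|orthant_sum h N c g| <= B * 2 ^+ c.
Proof.
move=> h01; have /andP[h0 _] := h01.
elim: c g B => [|c IH] g B B0 gB.
  rewrite /orthant_sum expr0 mul1r mulr1 (big_pred1 [ffun x : 'I_0 => match x with Ordinal _ p => False_rect _ (notF p) end]).
    by apply: le_trans (gB _ _) _; rewrite ?big_ord0 ?mulr1 // => i; apply: lpt_ge0; exact: ltW.
  by move=> v; apply/esym/eqP/ffunP => -[].
rewrite orthant_sumS normrM gtr0_norm //.
have Ba (a : 'I_N) : `|orthant_sum h N c (fun u => g (upd u c (h * a%:R)))| <= B * expR (- (h * a%:R)) * 2 ^+ c.
  apply: IH; first by nng.
  move=> u u0; apply: le_trans (gB _ _) _.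
    by apply: upd_ge0 => //; nng.
  by rewrite big_ord_recr /= prod_upd /upd eqxx le_eqVlt; apply/orP; left; apply/eqP; ring.
apply: le_trans (ler_wpM2l (ltW h0) (le_trans (ler_norm_sum _ _ _) (ler_sum _ (fun a _ => Ba a)))) _.
rewrite -mulr_suml -mulr_sumr exprS.
have := exp_mesh_bound N h01; move: (\sum_(a < N) _) => S hS.
rewrite (_ : h * (B * S * 2 ^+ c) = B * 2 ^+ c * (h * S)); last by ring.
rewrite (_ : B * (2 * 2 ^+ c) = B * 2 ^+ c * 2); last by ring.
by apply: ler_wpM2l => //; nng.
Qed.

Lemma orthant_sumB (h : R) (N c : nat) g g' :
  orthant_sum h N c (fun u => g u - g' u) = orthant_sum h N c g - orthant_sum h N c g'.
Proof. by rewrite /orthant_sum sumrB mulrBr. Qed.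

Lemma orthant_decay_slice c (A : R) g (x : R) : orthant_decay c.+1 A g -> 0 <= x ->
  orthant_decay c (A * expR (- x)) (fun u => g (upd u c x)).
Proof.
move=> [g1 g2] x0; split=> [u u0|i u y z u0 yz].
  have := g1 _ (upd_ge0 c u0 x0); rewrite big_ord_recr /= prod_upd {3}/upd eqxx.
  by rewrite mulrAC -mulrA.
have E w : upd (upd u i w) c x = upd (upd u c x) (widen_ord (leqnSn c) i) w.
  apply/funext => j; rewrite /upd /=; have [->|//] := eqVneq j c.
  by rewrite gtn_eqF.
rewrite !E; apply: le_trans (g2 (widen_ord (leqnSn c) i) _ _ _ (upd_ge0 c u0 x0) yz) _.
rewrite big_mkcond big_ord_recr /=.
have -> : (ord_max != widen_ord (leqnSn c) i) = true.
  by apply/eqP => /(congr1 val) /= e; have := ltn_ord i; rewrite -e ltnn.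
rewrite {2}/upd eqxx -big_mkcond /=.
have -> : \prod_(l < c | widen_ord (leqnSn c) l != widen_ord (leqnSn c) i) expR (- upd u c x l) =
   \prod_(l < c | l != i) expR (- u l).
  by rewrite -(prod_upd u x); apply: eq_bigl => l; rewrite -!val_eqE.
by rewrite le_eqVlt; apply/orP; left; apply/eqP; ring.
Qed.

Lemma mesh_error_small (e : R) : 0 < e -> exists2 h : R, 0 < h <= 1 & exists N : nat, 2 * h + expR (- (h * N%:R)) <= e.
Proof.
move=> e0; pose h := Num.min 1 (e / 4).
have h0 : 0 < h by rewrite lt_min ltr01 divr_gt0.
have h1 : h <= 1 by rewrite ge_min lexx.
have h4 : h <= e / 4 by rewrite ge_min lexx orbT.
exists h; first by rewrite h0.
exists (Num.truncn (h ^- 2)).+1.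
have hK : h ^- 2 <= (Num.truncn (h ^- 2)).+1%:R by exact: ltW (truncnS_gt _).
set K := (Num.truncn (h ^- 2)).+1 in hK *.
have hp : 0 < h * K%:R by rewrite mulr_gt0 // ltr0n.
have : expR (- (h * K%:R)) <= h.
  rewrite expRN -[leRHS]invrK lef_pV2 ?posrE ?expR_gt0 ?invr_gt0 //.
  apply: le_trans (_ : h * K%:R <= _); last by have := expR_ge1Dx (h * K%:R); lra.
  by rewrite -ler_pdivrMl // -expr2 exprVn.
by move: h4 e0; clear; lra.
Qed.

(** Induction on [c]: the integral over a slice is a function of the last coordinate, to which the
    half-line estimate applies. [K] depends on [c] only, as the constant of a slice at x is A
    exp(-x). The first conclusion says that the integral is finite, so that [fine] loses nothing. *)
Lemma orthant_riemann c : exists2 K : R, 0 <= K & forall (A : R) g, orthant_decay c A g ->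
  let J := fine (orthant_integral c (fun u => (g u)%:E)) in
  [/\ orthant_integral c (fun u => (g u)%:E) = J%:E, 0 <= J <= K * A &
   forall (h : R) (N : nat), 0 < h <= 1 ->
     `|orthant_sum h N c g - J| <= K * A * (2 * h + expR (- (h * N%:R)))].
Proof.
elim: c => [|c [K K0 IH]].
  exists 1 => // A g [g1 _] J.
  have := g1 (fun=> 0) (fun=> lexx _); rewrite big_ord0 mulr1 => gA.
  have A0 : 0 <= A by case/andP: gA => /le_trans h /h.
  split; [by []|by rewrite mul1r|].
  move=> h N /andP[h0 _]; rewrite /orthant_sum expr0 mul1r (big_pred1 [ffun x : 'I_0 => match x with Ordinal _ p => False_rect _ (notF p) end]).
    have -> : lpt h [ffun x : 'I_0 => match x with Ordinal _ p => False_rect 'I_N (notF p) end] = fun=> 0.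
      by apply/funext => i; rewrite /lpt; case: insubP => // -[].
    by rewrite /J /= subrr normr0; nng.
  by move=> v; apply/esym/eqP/ffunP => -[].
(* 2K pays for replacing slice sums by slice integrals, the mesh sum of exp(-x) being at most 2; K +
   2^c is the decay constant of the slice integral [phi]. *)
exists (2 * K + (K + 2 ^+ c)); first by nng.
move=> A g gA.
have A0 : 0 <= A.
  have [g1 _] := gA; have := g1 (fun=> 0) (fun=> lexx _) => /andP[] /le_trans h /h.
  by rewrite big1 ?mulr1 // => i _; rewrite oppr0 expR0.
pose phi (x : R) := fine (orthant_integral c (fun u => (g (upd u c x))%:E)).
have sl (x : R) : 0 <= x -> [/\ orthant_integral c (fun u => (g (upd u c x))%:E) = (phi x)%:E,
    0 <= phi x <= K * (A * expR (- x)) & forall (h : R) (N : nat), 0 < h <= 1 ->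
     `|orthant_sum h N c (fun u => g (upd u c x)) - phi x| <= K * (A * expR (- x)) * (2 * h + expR (- (h * N%:R)))].
  by move=> x0; exact: IH (orthant_decay_slice gA x0).
have dphi : exp_decay ((K + 2 ^+ c) * A) phi.
  split=> [x x0|x y /andP[x0 xy]].
    have [_ /andP[-> h] _] := sl x x0; apply: le_trans h _.
    rewrite mulrA; apply: ler_wpM2r; first exact: expR_ge0.
    by apply: ler_wpM2r => //; rewrite lerDl exprn_ge0.
  have y0 : 0 <= y by apply: le_trans xy.
  apply: le_trans (_ : 2 ^+ c * A * (y - x) * expR (- x) <= _); last first.
    apply: ler_wpM2r; first exact: expR_ge0.
    by apply: ler_wpM2r; rewrite ?subr_ge0 //; apply: ler_wpM2r; rewrite // lerDr.
  (* The Lipschitz bound holds for mesh sums, which are linear in [g]; it passes to [phi] through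
     the error bound of the slices, for a mesh depending on [e]. *)
  apply/ler_addgt0Pr => e e0.
  have e2 : 0 < e / (2 * K * A + 1) by apply: divr_gt0 => //; apply: ltr_wpDl => //; nng.
  have [h h01 [N hN]] := mesh_error_small e2.
  have [_ _ /(_ h N h01) hx] := sl x x0; have [_ _ /(_ h N h01) hy] := sl y y0.
  have hd : `|orthant_sum h N c (fun u => g (upd u c y) - g (upd u c x))| <= A * (y - x) * expR (- x) * 2 ^+ c.
    apply: orthant_sum_bound => //.
      by rewrite !mulr_ge0 ?subr_ge0 ?expR_ge0.
    move=> u u0; have [_ g2] := gA.
    have := g2 ord_max u x y u0; rewrite x0 xy => /(_ isT) /le_trans; apply.
    rewrite big_mkcond big_ord_recr /= eqxx mulr1 -big_mkcond /=.
    rewrite (eq_bigl xpredT) // => l; apply/eqP => /(congr1 val) /= e'.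
    by have := ltn_ord l; rewrite e' ltnn.
  rewrite orthant_sumB in hd.
  have ex1 (t : R) : 0 <= t -> K * (A * expR (- t)) * (2 * h + expR (- (h * N%:R))) <= K * A * (e / (2 * K * A + 1)).
    move=> t0; apply: ler_pM => //; [by nng| by case/andP: h01 => h0 _; nng |].
    rewrite mulrA ler_piMr //; first by nng.
    by rewrite -expR0 ler_expR oppr_le0.
  have E : K * A * (e / (2 * K * A + 1)) *+ 2 <= e.
    have KA : 0 <= K * A by nng.
    rewrite -mulr_natr (_ : _ * 2%:R = e * ((2 * K * A) / (2 * K * A + 1))); last by ring.
    apply: ler_piMr; first exact: ltW.
    by rewrite ler_pdivrMr; move: KA; clear; lra.
  rewrite (_ : phi y - phi x = (orthant_sum h N c (fun u => g (upd u c y)) - orthant_sum h N c (fun u => g (upd u c x)))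
     - (orthant_sum h N c (fun u => g (upd u c y)) - phi y) + (orthant_sum h N c (fun u => g (upd u c x)) - phi x)); last by ring.
  apply: le_trans (ler_normD _ _) _; apply: le_trans (lerD (ler_normB _ _) (lexx _)) _.
  have := ex1 x x0; have := ex1 y y0; rewrite mulr2n in E.
  move: hd hx hy E; clear; lra.
have [J [JE J0 HJ]] := riemann_half_line dphi.
have OI : orthant_integral c.+1 (fun u => (g u)%:E) = J%:E.
  rewrite /= -JE; apply: eq_integral => x; rewrite inE /= in_itv /= andbT => x0.
  by have [-> _ _] := sl x (ltW x0).
rewrite OI; split => //.
  case/andP: J0 => -> /le_trans; apply; apply: ler_wpM2r => //; rewrite lerDr; nng.
move=> h N h01; have /andP[h0 h1] := h01.
have HN : forall a : nat, a%:R <= (a%:R : R) <= a%:R + 1 by move=> a; rewrite lexx lerDl ler01.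
have b1 := HJ h N (fun a => a%:R) h01 HN.
have b2 : `|h * \sum_(a < N) (orthant_sum h N c (fun u => g (upd u c (h * a%:R))) - phi (h * a%:R))| <=
   2 * K * A * (2 * h + expR (- (h * N%:R))).
  rewrite normrM gtr0_norm //.
  have er0 : 0 <= 2 * h + expR (- (h * N%:R)) by nng.
  apply: le_trans (_ : h * \sum_(a < N) (K * (A * expR (- (h * a%:R))) * (2 * h + expR (- (h * N%:R)))) <= _).
    apply: ler_wpM2l; first exact: ltW.
    apply: le_trans (ler_norm_sum _ _ _) _; apply: ler_sum => a _.
    by have [_ _] := sl (h * a%:R) (mulr_ge0 (ltW h0) (ler0n _ _)); apply.
  rewrite -mulr_suml -!mulr_sumr.
  have := exp_mesh_bound N h01; move: (\sum_(a < N) _) => S hS.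
  rewrite mulrA; apply: ler_wpM2r => //.
  rewrite (_ : h * (K * (A * S)) = K * A * (h * S)); last by ring.
  rewrite (_ : 2 * K * A = K * A * 2); last by ring.
  by apply: ler_wpM2l => //; nng.
rewrite orthant_sumS.
rewrite (_ : _ - J = h * \sum_(a < N) (orthant_sum h N c (fun u => g (upd u c (h * a%:R))) - phi (h * a%:R))
  + (h * \sum_(a < N) phi (h * a%:R) - J)); last by rewrite sumrB; ring.
apply: le_trans (ler_normD _ _) _; apply: le_trans (lerD b2 b1) _.
by rewrite le_eqVlt; apply/orP; left; apply/eqP; ring.
Qed.

End OrthantSums.

(** * Replacement of the steps by Gaussians *)

Section Weights.
Context {R : realType} {d : nat}.

(** The cut-off at [N] makes all supports finite. It is later put above the thresholds, where it
    does not change the probability. *)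
Definition phi1 (z : R) (N : nat) (a : int) : R :=
  if (0 <= a) && (a <= N%:Z) then z ^+ absz a else 0.

(** A discrete primitive of [phi1]. For z < 1 it is bounded by 1/(1-z) uniformly in [N], which is
    why exactly the directions with z < 1 yield a factor n^(-1/2). *)
Definition cumul1 (z : R) (N : nat) (a : int) : R :=
  \sum_(k < N.+1) (if (k : nat)%:Z <= a then z ^+ k else 0).

Lemma cumul1_diff z N a : cumul1 z N a - cumul1 z N (a - 1) = phi1 z N a.
Proof.
rewrite /cumul1 -sumrB /phi1.
have E (k : 'I_N.+1) : (if (k : nat)%:Z <= a then z ^+ k else 0) -
   (if (k : nat)%:Z <= a - 1 then z ^+ k else 0) = if (k : nat)%:Z == a then z ^+ k else 0.
  have [e|ne] := eqVneq ((k : nat)%:Z) a.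
    by rewrite e lexx (_ : (a <= a - 1) = false) ?subr0 //; apply/negbTE; rewrite -ltNge; lia.
  by case: ifP; case: ifP; rewrite ?subrr ?subr0 // => h1 h2; exfalso; move: (k : nat) ne h1 h2 => ?; lia.
under eq_bigr do rewrite E.
case: ifP => [/andP[a0 aN]|h].
  have aN' : (absz a < N.+1)%N by lia.
  rewrite (bigD1 (Ordinal aN')) //= big1 ?addr0; first by rewrite gez0_abs ?eqxx.
  move=> k /eqP ne; case: eqP => // e; exfalso; apply: ne; apply/val_inj => /=.
  by move: e; move: (k : nat) => ?; lia.
rewrite big1 // => k _; case: eqP => // e; exfalso; move: h; rewrite -e.
by have := ltn_ord k; move: (k : nat) => ?; lia.
Qed.

Lemma phi1_bounds (z : R) N a : 0 <= z <= 1 -> 0 <= phi1 z N a <= 1.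
Proof.
move=> /andP[z0 z1]; rewrite /phi1; case: ifP => _; last by rewrite lexx ler01.
by rewrite exprn_ge0 // exprn_ile1.
Qed.

Lemma geometric_bound (z : R) N : 0 <= z < 1 -> \sum_(k < N) z ^+ k <= (1 - z)^-1.
Proof.
move=> /andP[z0 z1].
have h : (1 - z) * \sum_(k < N) z ^+ k = 1 - z ^+ N.
  elim: N => [|N IH]; first by rewrite big_ord0 mulr0 expr0 subrr.
  by rewrite big_ord_recr /= mulrDr IH exprS; ring.
have zz : 0 < 1 - z by lra.
by rewrite -[leRHS]mulr1 ler_pdivlMl // h gerBl exprn_ge0.
Qed.

Lemma cumul1_bounds (z : R) N a : 0 <= z < 1 -> 0 <= cumul1 z N a <= (1 - z)^-1.
Proof.
move=> z01; have /andP[z0 z1] := z01; apply/andP; split.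
  by apply: sumr_ge0 => k _; case: ifP => // _; rewrite exprn_ge0.
apply: le_trans (geometric_bound N.+1 z01); apply: ler_sum => k _.
by case: ifP => // _; rewrite exprn_ge0.
Qed.

Variables (z : 'I_d -> R) (D : {set 'I_d}).
Hypothesis z0 : forall i, 0 <= z i <= 1.
Hypothesis zD : forall i, i \in D -> z i < 1.

Definition weight N (x : lattice d) : R := \prod_i phi1 (z i) N (x i).

(** For S = [D] this is the bounded function of which [weight] is an iterated difference; smaller
    sets occur as the differences are taken one by one. *)
Definition pweight (S : {set 'I_d}) N (x : lattice d) : R :=
  \prod_i (if i \in S then cumul1 (z i) N (x i) else phi1 (z i) N (x i)).

Lemma bdiff_pweight (S : {set 'I_d}) N i : i \in S -> bdiff i (pweight S N) = pweight (S :\ i) N.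
Proof.
move=> iS; apply/funext => x; rewrite bdiffE /pweight.
rewrite (bigD1 i) //= [X in _ - X](bigD1 i) //= [RHS](bigD1 i) //= iS !inE eqxx /=.
have E j : j != i -> (x - stepv (unitp i)) j = x j.
  by move=> ji; rewrite !ffunE (negPf ji) subr0.
rewrite [X in _ - _ * X](_ : _ = \prod_(j < d | j != i) (if j \in S then cumul1 (z j) N (x j) else phi1 (z j) N (x j))); last first.
  by apply: eq_bigr => j ji; rewrite E.
have -> : (x - stepv (unitp i)) i = x i - 1 by rewrite !ffunE eqxx.
rewrite -mulrBl cumul1_diff; congr (_ * _).
by apply: eq_bigr => j ji; rewrite !inE ji.
Qed.

Lemma foldr_bdiff_pweight N (l : seq 'I_d) (S : {set 'I_d}) : uniq l -> {subset l <= S} ->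
  foldr (fun i => bdiff i) (pweight S N) l = pweight (S :\: [set i in l]) N.
Proof.
elim: l => [|i l IH] /=; first by rewrite (_ : [set i in [::]] = finset.set0) ?finset.setD0 //; apply/setP => i; rewrite !inE.
move=> /andP[il ul] lS; rewrite IH //; last by move=> j jl; apply: lS; rewrite inE jl orbT.
rewrite bdiff_pweight; last by rewrite !inE il lS // mem_head.
by congr (pweight _ N); apply/setP => j; rewrite !inE negb_or andbA.
Qed.

Lemma foldr_bdiff_weight N : foldr (fun i => bdiff i) (pweight D N) (enum D) = weight N.
Proof.
rewrite foldr_bdiff_pweight ?enum_uniq //; last by move=> i; rewrite mem_enum.
apply/funext => x; apply: eq_bigr => i _.
by rewrite !inE mem_enum andNb.
Qed.

Lemma pweight_bound N x : `|pweight D N x| <= \prod_(i in D) (1 - z i)^-1.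
Proof.
rewrite normr_prod [leRHS]big_mkcond /=; apply: ler_prod => i _.
rewrite normr_ge0 /=; case: ifPn => iD.
  have := cumul1_bounds N (x i) (introT andP (conj (proj1 (andP (z0 i))) (zD iD))).
  by move=> /andP[h ?]; rewrite ger0_norm.
by have /andP[h ?] := phi1_bounds N (x i) (z0 i); rewrite ger0_norm.
Qed.

Lemma weight_bounds N x : 0 <= weight N x <= 1.
Proof.
apply/andP; split.
  by apply: prodr_ge0 => i _; have /andP[] := phi1_bounds N (x i) (z0 i).
apply: (@le_trans _ _ (\prod_(i < d) 1)); last by rewrite big1.
by apply: ler_prod => i _; exact: phi1_bounds.
Qed.

Variable q : pattern d -> R.
Hypothesis q_gt0 : forall b, 0 < q b.
Hypothesis q_sum1 : \sum_b q b = 1.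

Lemma iter_weight_bound : exists2 C : R, 0 <= C & forall n N x,
  `|iter n (wavg q) (weight N) x| <= C / Num.sqrt n.+1%:R ^+ #|D|.
Proof.
have [C C0 HC] := walk_bdiffs_bound q_gt0 q_sum1 (enum D).
have K0 : 0 <= \prod_(i in D) (1 - z i)^-1.
  by apply: prodr_ge0 => i iD; rewrite invr_ge0 subr_ge0 ltW // zD.
exists (C * \prod_(i in D) (1 - z i)^-1); first exact: mulr_ge0.
move=> n N x; have := HC n (pweight D N) _ (pweight_bound N) x.
by rewrite foldr_bdiff_weight -cardE.
Qed.

(** One difference beyond those along [D] gains one more n^(-1/2): on bounded distances the averaged
    weight is constant up to a lower order. *)
Lemma iter_weight_bdiff_bound : exists2 C : R, 0 <= C & forall n N i x,
  `|bdiff i (iter n (wavg q) (weight N)) x| <= C / Num.sqrt n.+1%:R ^+ #|D|.+1.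
Proof.
have K0 : 0 <= \prod_(i in D) (1 - z i)^-1.
  by apply: prodr_ge0 => i iD; rewrite invr_ge0 subr_ge0 ltW // zD.
have H i : exists C : R, 0 <= C /\ forall n N x,
  `|bdiff i (iter n (wavg q) (weight N)) x| <= C / Num.sqrt n.+1%:R ^+ #|D|.+1.
  have [C C0 HC] := walk_bdiffs_bound q_gt0 q_sum1 (i :: enum D).
  exists (C * \prod_(i in D) (1 - z i)^-1); split; first exact: mulr_ge0.
  move=> n N x; have := HC n (pweight D N) _ (pweight_bound N) x.
  by rewrite /= foldr_bdiff_weight -cardE -iter_wavgC.
have [C HC] := fin_all_exists H.
exists (\sum_i C i); first by apply: sumr_ge0 => i _; case: (HC i).
move=> n N i x; have [_ /(_ n N x) h] := HC i; apply: le_trans h _.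
apply: ler_wpM2r; first by nng.
by rewrite (bigD1 i) //= lerDl; apply: sumr_ge0 => j _; case: (HC j).
Qed.

End Weights.

Section Lipschitz.
Context {R : realType} {d : nat}.

Definition lnorm1 (y : lattice d) : nat := \sum_i absz (y i).

Lemma lattice_lipschitz (u : lattice d -> R) (L : R) : (forall i x, `|bdiff i u x| <= L) ->
  forall x y, `|u (x - y) - u x| <= L * (lnorm1 y)%:R.
Proof.
move=> uL x y; move: {2}(lnorm1 y) (erefl (lnorm1 y)) => n.
elim: n y => [|n IH] y yn.
  have -> : y = 0.
    apply/ffunP => i; rewrite ffunE; apply/eqP; rewrite -absz_eq0; apply/eqP.
    by move/eqP: yn; rewrite sum_nat_eq0 => /forallP /(_ i) /eqP.
  by rewrite subr0 subrr normr0 /lnorm1 big1 ?mulr0 // => i _; rewrite ffunE.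
have /existsP[i yi] : [exists i, y i != 0].
  apply: contraT; rewrite negb_exists => /forallP h.
  by move: yn; rewrite /lnorm1 big1 // => j _; have /negPn/eqP -> := h j.
pose e := stepv (unitp i) : lattice d.
have ei j : e j = (j == i)%:Z by rewrite !ffunE.
pose y' := if 0 <= y i then y - e else y + e.
have y'n : lnorm1 y' = n.
  move: yn; rewrite /lnorm1 (bigD1 i) //= [X in _ -> X = _](bigD1 i) //=.
  have -> : (\sum_(j < d | j != i) absz (y' j) = \sum_(j < d | j != i) absz (y j))%N.
    by apply: eq_bigr => j /negPf ji; rewrite /y'; case: ifP => _; rewrite !ffunE ?ei ji ?subr0 ?addr0.
  have -> : y' i = if 0 <= y i then y i - 1 else y i + 1.
    by rewrite /y'; case: ifP => _; rewrite !ffunE eqxx.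
  by move: (y i) yi (\sum_(j < d | _) _)%N => t t0 s; case: ifP => h; lia.
rewrite (_ : u (x - y) - u x = (u (x - y) - u (x - y')) + (u (x - y') - u x)); last by rewrite addrA subrK.
apply: le_trans (ler_normD _ _) _; rewrite yn -natr1 mulrDr mulr1 addrC.
apply: lerD; first by rewrite -y'n; exact: IH.
rewrite /y'; case: ifP => _.
  have -> : x - y = (x - (y - e)) - e by rewrite opprB addrA addrAC addrK.
  by rewrite distrC -bdiffE.
have -> : x - (y + e) = (x - y) - e by rewrite opprD addrA.
by rewrite -bdiffE.
Qed.

Variable q : pattern d -> R.
Hypothesis q_gt0 : forall b, 0 < q b.
Hypothesis q_sum1 : \sum_b q b = 1.

Lemma lnorm1_stepv (b : pattern d) : (lnorm1 (stepv b) <= d)%N.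
Proof.
rewrite /lnorm1 -[X in (_ <= X)%N]card_ord -sum1_card; apply: leq_sum => i _.
by rewrite ffunE; case: (b i).
Qed.

Lemma iter_wavg_lipschitz (u : lattice d -> R) (L : R) j : (forall i x, `|bdiff i u x| <= L) ->
  forall x, `|iter j (wavg q) u x - u x| <= L * (j * d)%:R.
Proof.
move=> uL; elim: j => [|j IH] x; first by rewrite mul0n mulr0 subrr normr0.
(* For d = 0 the hypothesis gives no sign for [L], but there is a single lattice point and the
   averaging is the identity. *)
case: (posnP d) => [d0|d0].
  have e0 b : stepv b = 0 :> lattice d by apply/ffunP => -[i hi]; exfalso; rewrite d0 in hi.
  have T v y : wavg q v y = v y.
    by rewrite /wavg; under eq_bigr do rewrite e0 subr0; rewrite -mulr_suml q_sum1 mul1r.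
  have E k : (k * d = 0)%N by rewrite d0 muln0.
  by rewrite iterS T E; move: (IH x); rewrite E.
have L0 : 0 <= L by apply: le_trans (uL (Ordinal d0) 0).
rewrite iterS (_ : _ - u x = \sum_b q b * ((iter j (wavg q) u (x - stepv b) - u (x - stepv b)) + (u (x - stepv b) - u x))); last first.
  rewrite [in LHS]/wavg -[X in _ - X]mul1r -q_sum1 mulr_suml -sumrB.
  by apply: eq_bigr => b _; rewrite subrKA mulrBr.
apply: sum_law_bound => [b|//|b]; first exact: ltW.
apply: le_trans (ler_normD _ _) _; rewrite mulSn natrD mulrDr addrC.
apply: lerD; last exact: IH.
apply: le_trans (lattice_lipschitz uL x (stepv b)) _.
by apply: ler_wpM2l => //; rewrite ler_nat lnorm1_stepv.
Qed.

Lemma iter_weight_support (z : 'I_d -> R) N m x : iter m (wavg q) (weight z N) x != 0 ->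
  forall i, 0 <= x i <= (N + m)%:Z.
Proof.
elim: m x => [|m IH] x /=.
  move=> h i; apply: contraNT h => xi; apply/eqP; rewrite /weight (bigD1 i) //= /phi1.
  by rewrite addn0 in xi; rewrite (negPf xi) mul0r.
move=> h i; have /existsP[b] : [exists b, iter m (wavg q) (weight z N) (x - stepv b) != 0].
  apply: contraNT h; rewrite negb_exists => /forallP h; apply/eqP; rewrite /wavg big1 // => b _.
  by have /negPn/eqP -> := h b; rewrite mulr0.
by move=> /IH /(_ i); rewrite !ffunE; case: (b i) => /=; lia.
Qed.

End Lipschitz.

Section Decay.
Context {R : realType} {d : nat}.

Definition edk (t : R) (c : 'rV[R]_d) (y : lattice d) : R := expR (- (t * rnorm1 (pos y - c))).

Lemma edkE t c y : edk t c y = \prod_i expR (- (t * `|(y i)%:~R - c 0 i|)).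
Proof.
rewrite /edk /rnorm1 mulr_sumr -sumrN expR_sum; apply: eq_bigr => i _.
by rewrite !mxE.
Qed.

Lemma edk_ge0 t c y : 0 <= edk t c y. Proof. exact: expR_ge0. Qed.

Lemma boxsum_edk t c M : 0 < t <= 1 -> boxsum M (edk t c) <= (4 / t) ^+ d.
Proof.
move=> t01.
have -> : edk t c = fun y => \prod_i expR (- (t * `|(y i)%:~R - c 0 i|)).
  by apply/funext => y; exact: edkE.
rewrite (boxsum_prod M (fun i (a : int) => expR (- (t * `|a%:~R - c 0 i|)))).
have -> : (4 / t) ^+ d = \prod_(i < d) (4 / t) by rewrite prodr_const card_ord.
apply: ler_prod => i _; rewrite exp_line_sum // andbT.
by apply: sumr_ge0 => a _; exact: expR_ge0.
Qed.

Lemma phi1_line_sum (z : R) N (s : int) n : 0 <= z < 1 ->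
  \sum_(a < n) phi1 z N (s - (a : nat)%:Z) <= (1 - z)^-1.
Proof.
move=> z01.
have -> : \sum_(a < n) phi1 z N (s - (a : nat)%:Z) = cumul1 z N s - cumul1 z N (s - n%:Z).
  elim: n => [|n IH]; first by rewrite big_ord0 subr0 subrr.
  rewrite big_ord_recr /= IH -cumul1_diff (_ : s - n.+1%:Z = s - n%:Z - 1); last by lia.
  by rewrite addrA subrK.
have /andP[_ h1] := cumul1_bounds N s z01.
have /andP[h2 _] := cumul1_bounds N (s - n%:Z) z01.
by move: h1 h2; clear; lra.
Qed.

Variables (z : 'I_d -> R) (D : {set 'I_d}).
Hypothesis z0 : forall i, 0 <= z i <= 1.
Hypothesis zD : forall i, i \in D -> z i < 1.

(** The sum factors over coordinates. Those in [D] are summed by the geometric weight, the others by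
    the exponential, so 1/t occurs to the power #|~: D| rather than d. *)
Lemma boxsum_edk_weight t c M N (w : lattice d) : 0 < t <= 1 ->
  boxsum M (fun y => edk t c y * weight z N (w - y)) <=
    (4 / t) ^+ #|~: D| * \prod_(i in D) (1 - z i)^-1.
Proof.
move=> t01; have /andP[t0 _] := t01.
have -> : (fun y => edk t c y * weight z N (w - y)) =
   fun y => \prod_i (expR (- (t * `|(y i)%:~R - c 0 i|)) * phi1 (z i) N (w i - y i)).
  apply/funext => y; rewrite edkE /weight big_split /=; congr (_ * _).
  by apply: eq_bigr => i _; rewrite !ffunE.
rewrite (boxsum_prod M (fun i (a : int) => expR (- (t * `|a%:~R - c 0 i|)) * phi1 (z i) N (w i - a))).
have -> : (4 / t) ^+ #|~: D| * \prod_(i in D) (1 - z i)^-1 =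
    \prod_i (if i \in D then (1 - z i)^-1 else 4 / t).
  rewrite [RHS](bigID (mem D)) /= mulrC; congr (_ * _).
    by apply: eq_bigr => i ->.
  rewrite -prodr_const; apply/esym.
  by apply: eq_big => [i|i /negPf ->]; rewrite ?inE.
apply: ler_prod => i _; have p a := phi1_bounds N a (z0 i).
apply/andP; split.
  by apply: sumr_ge0 => a _; rewrite mulr_ge0 ?expR_ge0 //; case/andP: (p (w i - ((a : nat)%:Z - M%:Z))).
case: ifPn => iD.
  have zi : 0 <= z i < 1 by rewrite zD // andbT; case/andP: (z0 i).
  apply: le_trans (phi1_line_sum N (w i + M%:Z) (M + M).+1 zi).
  apply: ler_sum => a _; rewrite (_ : w i - ((a : nat)%:Z - M%:Z) = w i + M%:Z - (a : nat)%:Z); last first.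
    by rewrite opprB addrA addrAC.
  rewrite ler_piMl //; first by case/andP: (p (w i + M%:Z - (a : nat)%:Z)).
  by rewrite -expR0 ler_expR oppr_le0 mulr_ge0 // ltW.
apply: le_trans (exp_line_sum (c 0 i) M (M + M).+1 t01).
apply: ler_sum => a _; rewrite ler_piMr ?expR_ge0 //.
by case/andP: (p (w i - ((a : nat)%:Z - M%:Z))).
Qed.

Variable q : pattern d -> R.
Hypothesis q_gt0 : forall b, 0 < q b.
Hypothesis q_sum1 : \sum_b q b = 1.

Lemma iter_weight_ge0 m N x : 0 <= iter m (wavg q) (weight z N) x.
Proof.
elim: m x => [|m IH] x /=; first by case/andP: (weight_bounds z0 N x).
by apply: sumr_ge0 => b _; apply: mulr_ge0 => //; exact: ltW.
Qed.

(** The previous bound does not depend on [w], hence survives averaging over the steps. *)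
Lemma boxsum_edk_iter_weight t c M N m (w : lattice d) : 0 < t <= 1 ->
  boxsum M (fun y => edk t c y * iter m (wavg q) (weight z N) (w - y)) <=
    (4 / t) ^+ #|~: D| * \prod_(i in D) (1 - z i)^-1.
Proof.
move=> t01; elim: m w => [|m IH] w; first exact: boxsum_edk_weight.
have -> : boxsum M (fun y => edk t c y * iter m.+1 (wavg q) (weight z N) (w - y)) =
   \sum_b q b * boxsum M (fun y => edk t c y * iter m (wavg q) (weight z N) (w - stepv b - y)).
  rewrite /boxsum; under [RHS]eq_bigr do rewrite mulr_sumr.
  rewrite [RHS]exchange_big /=; apply: eq_bigr => v _.
  have wE (f : lattice d -> R) x : wavg q f x = \sum_b q b * f (x - stepv b) by [].
  rewrite wE mulr_sumr; apply: eq_bigr => b _.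
  by rewrite mulrCA addrAC.
apply: le_trans (_ : \sum_b q b * ((4 / t) ^+ #|~: D| * \prod_(i in D) (1 - z i)^-1) <= _).
  by apply: ler_sum => b _; apply: ler_wpM2l; [exact: ltW|exact: IH].
by rewrite -mulr_suml q_sum1 mul1r.
Qed.

End Decay.

(** * The exchange, step by step *)

Section Stages.
Context {R : realType} {d : nat}.
Variables (z : 'I_d -> R) (D : {set 'I_d}).
Hypothesis z0 : forall i, 0 <= z i <= 1.
Hypothesis zD : forall i, i \in D -> z i < 1.
Variable q : pattern d -> R.
Hypothesis q_gt0 : forall b, 0 < q b.
Hypothesis q_sum1 : \sum_b q b = 1.

Let g := gker (precm q) (meanv q).
Let u N m := iter m (wavg q) (weight z N).

(* Interpolates between [j = n], a Gaussian sum, and small [j], essentially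
   the value of the walk itself. *)
Definition stage M N n j (w : lattice d) : R :=
  boxsum M (fun y => g j y * u N (n - j) (w - y)).

Definition box_large M N n (w : lattice d) := forall i, (absz (w i) + (N + n).+1 <= M)%N.

(** One walk step is moved from the weight onto the kernel by translating the sum; [box_large] keeps
    the supports inside the cube. *)
Lemma stage_step M N n j w : (j < n)%N -> box_large M N n w ->
  stage M N n j w - stage M N n j.+1 w =
  boxsum M (fun y => (wavg q (g j) y - g j.+1 y) * u N (n - j.+1) (w - y)).
Proof.
move=> jn hM; rewrite /stage.
have -> : boxsum M (fun y => g j y * u N (n - j) (w - y)) = boxsum M (fun y => wavg q (g j) y * u N (n - j.+1) (w - y)).
  rewrite (_ : (n - j = (n - j.+1).+1)%N); last by lia.
  set m := (n - j.+1)%N; have mn : (m < n)%N by rewrite /m; lia.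
  transitivity (\sum_b q b * boxsum M (fun y => g j y * u N m (w - y - stepv b))).
    rewrite /boxsum; under [RHS]eq_bigr do rewrite mulr_sumr.
    rewrite [RHS]exchange_big /=; apply: eq_bigr => v _.
    by rewrite /u /= {1}/wavg mulr_sumr; apply: eq_bigr => b _; rewrite mulrCA.
  transitivity (\sum_b q b * boxsum M (fun y => g j (y - stepv b) * u N m (w - y))).
    apply: eq_bigr => b _; congr (_ * _).
    rewrite -(@boxsum_shift d _ M (fun y => g j y * u N m (w - y - stepv b)) (stepv b)).
      rewrite /boxsum; apply: eq_bigr => v _; congr (_ * u N m _).
      by rewrite opprB addrA addrAC addrK.
    move=> y; rewrite mulf_eq0 negb_or => /andP[_ /(@iter_weight_support _ _ q z) h] i.
    move: (h i) (hM i); rewrite !ffunE; case: (b i); move: (w i) (y i) => /= s t; lia.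
  rewrite /boxsum; under eq_bigr do rewrite mulr_sumr.
  rewrite exchange_big /=; apply: eq_bigr => v _.
  by rewrite /wavg mulr_suml; apply: eq_bigr => b _; rewrite mulrA.
by rewrite /boxsum -sumrB; apply: eq_bigr => v _; rewrite mulrBl.
Qed.

Lemma stage_step_bound : exists2 C : R, 0 <= C & forall M N n j w,
  (0 < j < n)%N -> box_large M N n w ->
  `|stage M N n j w - stage M N n j.+1 w| <=
    C * (Num.sqrt j%:R)^-1 ^+ 3 * (Num.sqrt n%:R)^-1 ^+ #|D|.
Proof.
have [C C0 HC] := gauss_step q_gt0 q_sum1.
have [C1 C10 HC1] := iter_weight_bound z0 zD q_gt0 q_sum1.
pose Kz : R := \prod_(i in D) (1 - z i)^-1.
have K0 : 0 <= Kz by apply: prodr_ge0 => i iD; rewrite invr_ge0 subr_ge0 ltW // zD.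
exists (C * (2 ^+ #|D| * (4 ^+ d * C1) + 2 ^+ #|D| * (4 ^+ #|~: D| * Kz))); first by nng.
move=> M N n j w /andP[j0 jn] hM; rewrite stage_step //.
have n0 : (0 < n)%N by lia.
set t : R := (Num.sqrt j%:R)^-1; set s : R := (Num.sqrt n%:R)^-1.
have t0 : 0 < t by rewrite invr_gt0 sqrtr_gt0 ltr0n.
have s0 : 0 < s by rewrite invr_gt0 sqrtr_gt0 ltr0n.
have t1 : t <= 1.
  by rewrite invf_le1 ?sqrtr_gt0 ?ltr0n // -[leLHS]sqrtr1 ler_wsqrtr // ler1n.
have t01 : 0 < t <= 1 by rewrite t0.
pose E y := edk t (j.+1%:R *: meanv q) y.
have hE y : `|wavg q (g j) y - g j.+1 y| <= C * t ^+ 3 * t ^+ d * E y.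
  by rewrite -[leRHS]mulrA; exact: HC.
apply: le_trans (ler_norm_boxsum _ _) _.
have un y : 0 <= u N (n - j.+1) (w - y) by exact: (iter_weight_ge0 z0 q_gt0).
apply: le_trans (_ : C * t ^+ 3 * t ^+ d * boxsum M (fun y => E y * u N (n - j.+1) (w - y)) <= _).
  rewrite /boxsum mulr_sumr; apply: ler_sum => v _.
  by rewrite normrM [`|u _ _ _|]ger0_norm // mulrA; apply: ler_wpM2r.
have tb (e : nat) : t ^+ e * (4 / t) ^+ e = 4 ^+ e by rewrite -exprMn mulrCA mulfV ?mulr1 // gt_eqF.
(* In the first case the remaining steps make [u] uniformly O(n^(-|D|/2)), and t^d times the profile
   has bounded mass. In the second case j is comparable to n, and summing [u] along [D] saves the
   factor t^|D|, of the same order. *)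
have [jn2|nj] := leqP n (4 * (n - j))%N.
  apply: le_trans (_ : C * t ^+ 3 * t ^+ d * ((4 / t) ^+ d * (C1 * (2 * s) ^+ #|D|)) <= _).
    apply: ler_wpM2l; first by nng.
    apply: le_trans (_ : boxsum M (fun y => E y * (C1 * (2 * s) ^+ #|D|)) <= _).
      apply: ler_boxsum => y; apply: ler_wpM2l; first exact: edk_ge0.
      apply: le_trans (ler_norm _) _; apply: le_trans (HC1 _ _ _) _.
      rewrite -exprVn; apply: ler_wpM2l => //; apply: lerXn2r; rewrite ?nnegrE.
      - by nng.
      - by nng.
      - by rewrite -subSn // subSS; apply: inv_sqrt_le => //; lia.
    rewrite /boxsum -mulr_suml; apply: ler_wpM2r; first by nng.
    exact: boxsum_edk.
  rewrite (_ : C * t ^+ 3 * t ^+ d * ((4 / t) ^+ d * (C1 * (2 * s) ^+ #|D|)) =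
    C * (2 ^+ #|D| * ((t ^+ d * (4 / t) ^+ d) * C1)) * t ^+ 3 * s ^+ #|D|); last first.
    by rewrite [(2 * s) ^+ _]exprMn; ring.
  rewrite tb; apply: ler_wpM2r; first by nng.
  apply: ler_wpM2r; first by nng.
  by apply: ler_wpM2l => //; rewrite lerDl; nng.
apply: le_trans (_ : C * t ^+ 3 * t ^+ d * ((4 / t) ^+ #|~: D| * Kz) <= _).
  apply: ler_wpM2l; first by nng.
  exact: (boxsum_edk_iter_weight z0 zD q_gt0 q_sum1).
have dE : (d = #|D| + #|~: D|)%N by rewrite cardsC card_ord.
rewrite (_ : C * t ^+ 3 * t ^+ d * ((4 / t) ^+ #|~: D| * Kz) =
    C * (t ^+ #|D| * ((t ^+ #|~: D| * (4 / t) ^+ #|~: D|) * Kz)) * t ^+ 3); last first.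
  by rewrite [in t ^+ d]dE exprD; ring.
rewrite tb.
apply: le_trans (_ : C * ((2 * s) ^+ #|D| * (4 ^+ #|~: D| * Kz)) * t ^+ 3 <= _).
  apply: ler_wpM2r; first by nng.
  apply: ler_wpM2l => //; apply: ler_wpM2r; first by nng.
  apply: lerXn2r; rewrite ?nnegrE; [by nng|by nng|].
  by apply: inv_sqrt_le => //; lia.
rewrite exprMn (_ : C * (2 ^+ #|D| * s ^+ #|D| * (4 ^+ #|~: D| * Kz)) * t ^+ 3 =
   C * (2 ^+ #|D| * (4 ^+ #|~: D| * Kz)) * t ^+ 3 * s ^+ #|D|); last by ring.
apply: ler_wpM2r; first by nng.
apply: ler_wpM2r; first by nng.
by apply: ler_wpM2l => //; rewrite lerDr; nng.
Qed.

(** Makes the costs j^(-3/2) telescope. With a = sqrt j and b = sqrt(j+1), the difference of the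
    inverses is 1/(ab(a+b)), and b <= 3a/2 gives ab(a+b) <= 4 a^3. *)
Lemma inv_sqrt_cube (j : nat) : (0 < j)%N ->
  (Num.sqrt j%:R)^-1 ^+ 3 <= 4 * ((Num.sqrt j%:R)^-1 - (Num.sqrt j.+1%:R)^-1) :> R.
Proof.
move=> j0; have jR : 1 <= j%:R :> R by rewrite ler1n.
set a : R := Num.sqrt j%:R; set b : R := Num.sqrt j.+1%:R.
have aa : a * a = j%:R by rewrite -expr2 sqr_sqrtr // ler0n.
have bb : b * b = j%:R + 1 by rewrite -expr2 sqr_sqrtr ?natr1 // ler0n.
have a0 : 0 < a by rewrite sqrtr_gt0 ltr0n.
have b0 : 0 < b by rewrite sqrtr_gt0 ltr0n.
clearbody a b.
have b2 : b <= 3 / 2 * a by nra.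
have e : a^-1 - b^-1 = (a * b * (a + b))^-1.
  have ab : 0 < a + b by lra.
  have h : (b - a) * (a + b) = 1 by rewrite (_ : _ * _ = b * b - a * a); [rewrite aa bb; ring | ring].
  rewrite -[RHS]mul1r -{1}h; field.
  by rewrite !gt_eqF //; nra.
have c : a * b * (a + b) <= 4 * a ^+ 3.
  rewrite (_ : 4 * a ^+ 3 = a * (a * (4 * a))); last by ring.
  rewrite -mulrA; apply: ler_wpM2l; first exact: ltW.
  by nra.
have p : 0 < a * b * (a + b) by rewrite !mulr_gt0 ?addr_gt0.
rewrite e exprVn -ler_pdivrMl // -invfM lef_pV2 ?posrE ?mulr_gt0 ?exprn_gt0 //.
by rewrite addr_gt0.
Qed.

(** Relative to n^(-|D|/2) the error is O(j^(-1/2)), uniformly in [n]: small for a large [j] fixed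
    before [n]. *)
Lemma stage_telescope : exists2 C : R, 0 <= C & forall M N n j w,
  (0 < j <= n)%N -> box_large M N n w ->
  `|stage M N n j w - stage M N n n w| <= C * (Num.sqrt j%:R)^-1 * (Num.sqrt n%:R)^-1 ^+ #|D|.
Proof.
have [C C0 HC] := stage_step_bound.
exists (C * 4); first by nng.
move=> M N n j w /andP[j0 jn] hM.
have s0 : 0 <= (Num.sqrt n%:R)^-1 ^+ #|D| :> R by nng.
suff key k : (j + k <= n)%N -> `|stage M N n j w - stage M N n (j + k) w| <=
    C * 4 * ((Num.sqrt j%:R)^-1 - (Num.sqrt (j + k)%:R)^-1) * (Num.sqrt n%:R)^-1 ^+ #|D|.
  have := key (n - j)%N; rewrite subnKC // => /(_ (leqnn _)) /le_trans; apply.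
  apply: ler_wpM2r => //; apply: ler_wpM2l; first by nng.
  by rewrite gerBl; nng.
elim: k => [|k IH] hk; first by rewrite addn0 !subrr normr0 mulr0 mul0r.
have hk' : (j + k <= n)%N by lia.
have jk : (0 < j + k < n)%N by lia.
rewrite (_ : stage M N n j w - _ = (stage M N n j w - stage M N n (j + k) w) +
  (stage M N n (j + k) w - stage M N n (j + k).+1 w)); last by rewrite addrA subrK addnS.
apply: le_trans (ler_normD _ _) _; apply: le_trans (lerD (IH hk') (HC _ _ _ _ _ jk hM)) _.
have jk0 : (0 < j + k)%N by lia.
have := ler_wpM2l C0 (inv_sqrt_cube jk0); rewrite addnS => h.
rewrite -mulrDl; apply: ler_wpM2r => //.
by lra.
Qed.

(** The kernel at [j] has a bounded first moment and [u] a Lipschitz constant smaller by one power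
    of n^(-1/2) than its bound, so [u] comes out of the sum. [K] depends on [j], which stays fixed
    as [n] grows. *)
Lemma stage_smoothing j : (0 < j)%N -> exists2 K : R, 0 <= K & forall M N n w, (j <= n)%N ->
  `|stage M N n j w - boxsum M (g j) * u N n w| <= K * (Num.sqrt (n - j).+1%:R)^-1 ^+ #|D|.+1.
Proof.
move=> j0.
have [C C0 HC] := iter_weight_bdiff_bound z0 zD q_gt0 q_sum1.
set t : R := (Num.sqrt j%:R)^-1.
have sj : 0 < Num.sqrt (j%:R : R) by rewrite sqrtr_gt0 ltr0n.
have t0 : 0 < t by rewrite invr_gt0.
have t1 : t <= 1.
  by rewrite invf_le1 // -[leLHS]sqrtr1 ler_wsqrtr // ler1n.
have t01 : 0 < t <= 1 by rewrite t0.
pose c : R := (d%:R + 1) ^- 2 / 2.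
have c0 : 0 < c by rewrite divr_gt0 // invr_gt0 exprn_gt0 //; have := ler0n R d; lra.
pose B : R := Num.sqrt j%:R + (j%:R * rnorm1 (meanv q) + (j * d)%:R).
have B0 : 0 <= B by rewrite /B; nng; exact: rnorm1_ge0.
pose G : R := 256 * expR ((0 + 2) ^+ 2 / (4 * c)).
have G0 : 0 <= G by rewrite /G; nng.
(* The factor is the total displacement: [lnorm1 y] from the kernel and at most j d from [j] walk
   steps. Gaussian decay absorbs it. *)
have gb y : g j y * ((lnorm1 y)%:R + (j * d)%:R) <= t ^+ d * B * G * edk t (j%:R *: meanv q) y.
  set x := pos y - j%:R *: meanv q.
  have gE : g j y = t ^+ d * expR (- qform (precm q) (t *: x) / 2) by [].
  have N0 := rnorm1_ge0 x.
  have lE : (lnorm1 y)%:R = rnorm1 (pos y) :> R.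
    rewrite /lnorm1 /rnorm1 natr_sum; apply: eq_bigr => i _.
    by rewrite mxE -intr_norm natr_absz.
  have l1 : (lnorm1 y)%:R <= rnorm1 x + j%:R * rnorm1 (meanv q) :> R.
    rewrite lE -[j%:R in leRHS]ger0_norm // -rnorm1Z /rnorm1 -big_split /=; apply: ler_sum => i _.
    rewrite -[X in `|X| <= _](_ : x 0 i + (j%:R *: meanv q) 0 i = _); last by rewrite !mxE subrK.
    exact: ler_normD.
  have l2 : (lnorm1 y)%:R + (j * d)%:R <= B * (1 + t * rnorm1 x).
    have : rnorm1 x = Num.sqrt j%:R * (t * rnorm1 x) by rewrite mulrA mulfV ?mul1r // gt_eqF.
    have : 0 <= (j%:R * rnorm1 (meanv q) + (j * d)%:R) * (t * rnorm1 x).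
      by apply: mulr_ge0; nng; exact: rnorm1_ge0.
    have := ltW sj.
    rewrite /B; clear HC gE; lra.
  have e1 : expR (- qform (precm q) (t *: x) / 2) <= expR (- (c * (t * rnorm1 x) ^+ 2)).
    rewrite ler_expR /c; have := precm_coercive q_gt0 q_sum1 (t *: x).
    by rewrite rnorm1Z (gtr0_norm t0); clear HC gE; lra.
  have tN : 0 <= t * rnorm1 x by nng.
  have := gauss_absorb 0 c0 tN; rewrite -/G mul0r expR0 mulr1 => GA.
  have e2 : (1 + t * rnorm1 x) * expR (- (c * (t * rnorm1 x) ^+ 2)) <= G * edk t (j%:R *: meanv q) y.
    apply: le_trans GA; apply: ler_wpM2r; first exact: expR_ge0.
    by rewrite ler_eXnr // lerDl.
  rewrite gE; clearbody G B.
  rewrite -mulrA -[X in _ <= X]mulrA -[X in _ <= X]mulrA; apply: ler_wpM2l; first by nng.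
  apply: le_trans (ler_pM _ _ e1 l2) _; rewrite ?expR_ge0 ?addr_ge0 //.
  by rewrite mulrCA; apply: ler_wpM2l => //; rewrite mulrC.
exists (t ^+ d * B * G * (4 / t) ^+ d * C); first by nng.
move=> M N n w jn.
set L := C * (Num.sqrt (n - j).+1%:R)^-1 ^+ #|D|.+1.
have L0 : 0 <= L by rewrite /L; nng.
have hL i x : `|bdiff i (u N (n - j)) x| <= L by rewrite /L exprVn; exact: HC.
have g0 y : 0 <= g j y by rewrite /g /gker; nng.
have -> : stage M N n j w - boxsum M (g j) * u N n w =
   boxsum M (fun y => g j y * ((u N (n - j) (w - y) - u N (n - j) w) - (u N n w - u N (n - j) w))).
  rewrite /stage /boxsum mulr_suml -sumrB; apply: eq_bigr => v _.
  by ring.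
apply: le_trans (ler_norm_boxsum _ _) _.
apply: le_trans (_ : boxsum M (fun y => L * (g j y * ((lnorm1 y)%:R + (j * d)%:R))) <= _).
  apply: ler_boxsum => y; rewrite normrM ger0_norm // mulrCA; apply: ler_wpM2l => //.
  apply: le_trans (ler_normB _ _) _; rewrite mulrDr; apply: lerD.
    exact: lattice_lipschitz.
  have -> : u N n w = iter j (wavg q) (u N (n - j)) w by rewrite /u -iterD subnKC.
  exact: iter_wavg_lipschitz.
apply: le_trans (_ : boxsum M (fun y => L * (t ^+ d * B * G * edk t (j%:R *: meanv q) y)) <= _).
  by apply: ler_boxsum => y; apply: ler_wpM2l.
rewrite /boxsum -mulr_sumr -mulr_sumr.
apply: le_trans (_ : L * (t ^+ d * B * G * (4 / t) ^+ d) <= _).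
  apply: ler_wpM2l => //; apply: ler_wpM2l; first by nng.
  exact: boxsum_edk.
by rewrite /L le_eqVlt; apply/orP; left; apply/eqP; ring.
Qed.

Lemma boxsum_gker_gsum j M : boxsum M (g j) = gsum (precm q) (Num.sqrt j%:R)^-1 M (j%:R *: meanv q).
Proof. by rewrite /gsum /boxsum mulr_sumr; apply: eq_bigr. Qed.

End Stages.

(** * Local limit theorem *)

Section GaussProfile.
Context {R : realType} {d : nat}.
Variable q : pattern d -> R.
Hypothesis q_gt0 : forall b, 0 < q b.
Hypothesis q_sum1 : \sum_b q b = 1.

Definition gprofile (A : 'M[R]_d) (x : 'rV[R]_d) : R := expR (- qform A x / 2).

Lemma precm_posdef : posdef (precm q).
Proof.
move=> x x0; have /existsP[i xi] : [exists i, x 0 i != 0].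
  apply: contraR x0; rewrite negb_exists => /forallP h.
  by apply/eqP/rowP => i; have /negPn/eqP -> := h i; rewrite mxE.
apply: lt_le_trans (precm_coercive_entry q_gt0 q_sum1 x i).
by rewrite lt0r sqrf_eq0 xi sqr_ge0.
Qed.

Lemma gprofile_decay : exists2 K : R, 0 <= K &
  forall x, (1 + rnorm1 x) * gprofile (precm q) x <= K * expR (- rnorm1 x).
Proof.
pose c : R := (d%:R + 1) ^- 2 / 2.
have c0 : 0 < c by rewrite divr_gt0 // invr_gt0 exprn_gt0 //; have := ler0n R d; lra.
exists (256 * expR ((0 + 2) ^+ 2 / (4 * c))); first by nng.
move=> x; have N0 := rnorm1_ge0 x.
have := gauss_absorb 0 c0 N0; rewrite mul0r expR0 mulr1; apply: le_trans.
apply: ler_pM; rewrite ?addr_ge0 ?expR_ge0 //.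
  by rewrite ler_eXnr // lerDl.
rewrite ler_expR /c; have := precm_coercive q_gt0 q_sum1 x.
by lra.
Qed.

Lemma expRN_diff (a b : R) : `|expR (- a) - expR (- b)| <= `|a - b| * (expR (- a) + expR (- b)).
Proof.
wlog ab : a b / a <= b => [H|].
  have [/H//|/ltW /H] := leP a b.
  by rewrite distrC [`|b - a|]distrC [_ + expR (- a)]addrC.
rewrite ger0_norm; last by rewrite subr_ge0 ler_expR lerN2.
rewrite ler0_norm ?subr_le0 //.
have E : expR (- b) = expR (- a) * expR (- (b - a)) by rewrite -expRD; congr expR; ring.
have := expR_ge1Dx (- (b - a)); have := expR_ge0 (- a); have := expR_ge0 (- b).
move=> h1 h2 h3.
have : expR (- a) * (1 - (b - a)) <= expR (- b) by rewrite E; apply: ler_wpM2l => //; lra.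
have : 0 <= (b - a) * expR (- b) by rewrite mulr_ge0 // subr_ge0.
lra.
Qed.

Lemma gprofile_lipschitz : exists2 K : R, 0 <= K & forall x y,
  `|gprofile (precm q) x - gprofile (precm q) y| <=
    K * rnorm1 (x - y) * (expR (- rnorm1 x) + expR (- rnorm1 y)).
Proof.
have [K K0 HK] := gprofile_decay.
set A := precm q in HK *; have As : A^T = A by exact: precm_sym.
have S0 := entry_norm_ge0 A; set S := entry_norm A in S0.
exists (S * K + K); first by nng.
move=> x y; have nx := rnorm1_ge0 x; have ny := rnorm1_ge0 y; have nxy := rnorm1_ge0 (x - y).
have tri (u v : 'rV[R]_d) : rnorm1 (u + v) <= rnorm1 u + rnorm1 v.
  by rewrite /rnorm1 -big_split /=; apply: ler_sum => i _; rewrite mxE; exact: ler_normD.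
have rN u : rnorm1 (- u) = rnorm1 u by apply: eq_bigr => i _; rewrite mxE normrN.
have gx0 : 0 <= gprofile A x by exact: expR_ge0.
have gy0 : 0 <= gprofile A y by exact: expR_ge0.
have kx : gprofile A x <= K * expR (- rnorm1 x).
  by apply: le_trans (HK x); rewrite ler_peMl // lerDl.
have ky : gprofile A y <= K * expR (- rnorm1 y).
  by apply: le_trans (HK y); rewrite ler_peMl // lerDl.
have ex := expR_ge0 (- rnorm1 x); have ey := expR_ge0 (- rnorm1 y).
have Sall : 0 <= S * K * rnorm1 (x - y) * (expR (- rnorm1 x) + expR (- rnorm1 y)) by nng.
have Kall : 0 <= K * rnorm1 (x - y) * (expR (- rnorm1 x) + expR (- rnorm1 y)) by nng.
(* At distance above 1 the two values themselves are within the bound. Otherwise the norms differ by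
   at most 1, and the linear growth of the gradient is absorbed by the decay of either value. *)
have [small|big] := leP (rnorm1 (x - y)) 1; last first.
  apply: le_trans (ler_normB _ _) _; rewrite !ger0_norm //.
  have : K * (expR (- rnorm1 x) + expR (- rnorm1 y)) <= K * (expR (- rnorm1 x) + expR (- rnorm1 y)) * rnorm1 (x - y).
    by rewrite ler_peMr //; [nng | exact: ltW].
  by move: kx ky Sall; lra.
have dQ : qform A x - qform A y = bform A (x - y) (x + y).
  have bD (u v w : 'rV[R]_d) : bform A u (v + w) = bform A u v + bform A u w.
    by rewrite -{1}[w]opprK bformBr -[- w]scaleN1r bformZr; ring.
  by rewrite /qform bformBl !bD (bformC y x As); ring.
have qb : `|qform A x / 2 - qform A y / 2| <= S * rnorm1 (x - y) * (rnorm1 x + rnorm1 y) / 2.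
  rewrite -mulrBl normrM [`|2^-1|]ger0_norm ?invr_ge0 //; apply: ler_wpM2r => //.
  rewrite dQ -mulrA; apply: le_trans (bform_bound _ (rnorm1_entry _) (rnorm1_entry _) nxy) _.
  by apply: ler_wpM2l => //; apply: ler_wpM2l.
have gE u : expR (- (qform A u / 2)) = gprofile A u by rewrite /gprofile mulNr.
have := expRN_diff (qform A x / 2) (qform A y / 2); rewrite !gE.
move/le_trans; apply.
apply: le_trans (_ : S * rnorm1 (x - y) * (rnorm1 x + rnorm1 y) / 2 * (gprofile A x + gprofile A y) <= _).
  by apply: ler_wpM2r => //; exact: addr_ge0.
have t1 : rnorm1 x <= rnorm1 y + 1 by have := tri (x - y) y; rewrite subrK; lra.
have t2 : rnorm1 y <= rnorm1 x + 1.
  by have := tri (- (x - y)) x; rewrite opprB subrK -opprB rN; lra.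
have a1 : (rnorm1 x + rnorm1 y) / 2 * gprofile A x <= K * expR (- rnorm1 x).
  by apply: le_trans (HK x); apply: ler_wpM2r => //; lra.
have a2 : (rnorm1 x + rnorm1 y) / 2 * gprofile A y <= K * expR (- rnorm1 y).
  by apply: le_trans (HK y); apply: ler_wpM2r => //; lra.
have := ler_wpM2l (mulr_ge0 S0 nxy) (lerD a1 a2).
by move: Kall; lra.
Qed.

End GaussProfile.

(** Group by the restriction to the coordinates outside [D]: these alone enter [Phi] and have weight
    1, while those in [D] range freely and factor out. *)
Lemma sum_ffun_factor (R : comPzRingType) (d c : nat) (J : finType) (D : {set 'I_d}) (iota : 'I_c -> 'I_d)
  (F : 'I_d -> J -> R) (Phi : {ffun 'I_c -> J} -> R) :
  injective iota -> (forall i, (i \notin D) = [exists a, iota a == i]) ->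
  (forall i j, i \notin D -> F i j = 1) ->
  \sum_(v : {ffun 'I_d -> J}) (\prod_i F i (v i)) * Phi [ffun a => v (iota a)] =
  (\prod_(i in D) \sum_j F i j) * \sum_u Phi u.
Proof.
move=> inj im F1.
rewrite (partition_big (fun v : {ffun 'I_d -> J} => [ffun a => v (iota a)]) xpredT) //= mulr_sumr.
apply: eq_bigr => u _.
transitivity (\sum_(v : {ffun 'I_d -> J} | [ffun a => v (iota a)] == u) (\prod_i F i (v i)) * Phi u).
  by apply: eq_bigr => v /eqP ->.
rewrite -mulr_suml; congr (_ * _).
pose Q i j := [forall a, (iota a == i) ==> (j == u a)].
rewrite (eq_bigl (fun v => v \in family Q)); last first.
  move=> v; apply/eqP/familyP => [vu i|h].
    by apply/forallP => a; apply/implyP => /eqP <-; rewrite -vu ffunE.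
  by apply/ffunP => a; rewrite ffunE; have /forallP/(_ a) := h (iota a); rewrite eqxx => /eqP.
rewrite -bigA_distr_big_dep (bigID (mem D)) /= [X in _ * X]big1 ?mulr1.
  apply: eq_bigr => i iD; apply: eq_bigl => j; apply/forallP => a.
  apply/implyP => /eqP ai; have := im i; rewrite iD => /esym/negbT.
  by rewrite negb_exists => /forallP/(_ a); rewrite ai eqxx.
move=> i iD; have := im i; rewrite iD => /esym/existsP[a /eqP ai].
rewrite (bigD1 (u a)) /=; last first.
  by apply/forallP => b; apply/implyP => /eqP bi; rewrite -(inj a b) // ai.
rewrite F1 // big1 ?addr0 // => j /andP[/forallP/(_ a)].
by rewrite ai eqxx /= => ->.
Qed.

Section LastStage.
Context {R : realType} {d : nat}.
Variables (z : 'I_d -> R) (D : {set 'I_d}).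
Variable q : pattern d -> R.

Definition natpt N (v : {ffun 'I_d -> 'I_N.+1}) : lattice d := [ffun i => (v i : nat)%:Z].

(** No walk step is left, and the support of [weight] reduces the cube to the points y = w - v. *)
Lemma stage_last M N n (w : lattice d) : box_large M N n w ->
  stage z q M N n n w =
  \sum_(v : {ffun 'I_d -> 'I_N.+1}) (\prod_i z i ^+ v i) * gker (precm q) (meanv q) n (w - natpt v).
Proof.
move=> hM; rewrite /stage subnn /= boxsumE.
transitivity (\sum_(y <- [seq w - natpt v | v <- enum {: {ffun 'I_d -> 'I_N.+1}}])
    gker (precm q) (meanv q) n y * weight z N (w - y)); last first.
  rewrite big_map big_enum; apply: eq_bigr => v _; rewrite mulrC; congr (_ * _).
  apply: eq_bigr => i _; rewrite subKr /phi1 ffunE /=.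
  by rewrite ifT // lez_nat -ltnS ltn_ord.
apply: sum_uniq_support.
- by rewrite map_inj_uniq ?enum_uniq //; exact: boxpt_inj.
- rewrite map_inj_uniq ?enum_uniq // => v v' /addrI /oppr_inj /ffunP h.
  by apply/ffunP => i; apply/val_inj; have := h i; rewrite !ffunE => -[].
move=> y; rewrite mulf_eq0 negb_or => /andP[_ h].
have {h} h i : 0 <= w i - y i <= N%:Z.
  by have := @iter_weight_support R d q z N 0 (w - y) h i; rewrite !ffunE addn0.
apply/andP; split.
  have /boxptP[v <-] : in_box M y.
    by apply/forallP => i; move: (h i) (hM i); move: (w i) (y i) => s t; lia.
  by apply/map_f; rewrite mem_enum.
apply/mapP; exists [ffun i => inord (absz (w i - y i)%R)]; rewrite ?mem_enum //.
apply/ffunP => i; rewrite !ffunE inordK; last by have := h i; lia.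
by rewrite gez0_abs ?subKr //; case/andP: (h i).
Qed.

End LastStage.

Section SequenceLimits.
Context {R : realType}.
Local Open Scope classical_set_scope.

Lemma inv_sqrt_small (e : R) : 0 < e -> exists n0 : nat, forall n, (n0 <= n)%N ->
  (0 < n)%N /\ (Num.sqrt n%:R)^-1 <= e.
Proof.
move=> e0; exists (Num.truncn (e ^- 2)).+1 => n hn; have n0 : (0 < n)%N by lia.
split=> //; have en : e ^- 2 <= n%:R.
  by apply: le_trans (ltW (truncnS_gt _)) _; rewrite ler_nat.
rewrite -[leRHS]invrK lef_pV2 ?posrE ?invr_gt0 ?sqrtr_gt0 ?ltr0n //.
have e1 : 0 <= e^-1 by rewrite invr_ge0 ltW.
by rewrite -(ger0_norm e1) -sqrtr_sqr; apply: ler_wsqrtr; rewrite exprVn.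
Qed.

Lemma cvg_seq_le (u : nat -> R) (l : R) :
  (forall e, 0 < e -> exists n0 : nat, forall n, (n0 <= n)%N -> `|u n - l| <= e) -> u @ \oo --> l.
Proof.
move=> H; apply/cvgrPdist_le => e /H[n0 hn].
by exists n0 => // n /= n0n; rewrite distrC; exact: hn.
Qed.

Lemma cvg_prod (I : Type) (s : seq I) (f : I -> nat -> R) (l : I -> R) :
  (forall i, f i @ \oo --> l i) ->
  (fun n => \prod_(i <- s) f i n) @ \oo --> \prod_(i <- s) l i.
Proof.
move=> fl; elim: s => [|i s IH].
  rewrite big_nil (_ : (fun n => _) = fun=> 1); last by apply/funext => n; rewrite big_nil.
  exact: cvg_cst.
rewrite big_cons (_ : (fun n => _) = fun n => f i n * \prod_(j <- s) f j n); last first.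
  by apply/funext => n; rewrite big_cons.
by apply: cvgM.
Qed.

Lemma cvg_geometric_sum (z : R) : 0 <= z < 1 ->
  (fun n : nat => \sum_(k < n.+2) z ^+ k) @ \oo --> (1 - z)^-1.
Proof.
move=> /andP[z0 z1].
have h : `|z| < 1 by rewrite ger0_norm.
have := @cvg_geometric_series R 1 z h; rewrite mul1r => H.
have := H; rewrite -(cvg_shiftn 2) => {}H.
rewrite (_ : (fun n => _) = (fun n : nat => series (geometric 1 z) (n + 2)%N)) //.
apply/funext => n; rewrite /series /= addn2 big_mkord; apply: eq_bigr => k _.
by rewrite /geometric /= mul1r.
Qed.

Lemma geometric_deriv_bound (z : R) N : 0 <= z < 1 ->
  \sum_(k < N) z ^+ k * (1 + k%:R) <= (1 - z) ^- 2.
Proof.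
move=> /andP[z0 z1].
have h : (1 - z) ^+ 2 * \sum_(k < N) z ^+ k * (1 + k%:R) = 1 - z ^+ N - N%:R * z ^+ N * (1 - z).
  elim: N => [|N IH]; first by rewrite big_ord0 mulr0 expr0 mul0r mul0r subrr subr0.
  by rewrite big_ord_recr /= mulrDr IH [z ^+ N.+1]exprS -[N.+1%:R]natr1; ring.
have zz : 0 < 1 - z by lra.
rewrite -[leRHS]mulr1 ler_pdivlMl ?exprn_gt0 // h.
have : 0 <= z ^+ N by rewrite exprn_ge0.
have : 0 <= N%:R * z ^+ N * (1 - z) by apply: mulr_ge0; [nng | exact: ltW].
by lra.
Qed.

End SequenceLimits.

(** * Limit of the final Gaussian sum *)

Section LocalLimit.
Context {R : realType} {d c : nat}.
Variables (z : 'I_d -> R) (D : {set 'I_d}) (iota : 'I_c -> 'I_d).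
Hypothesis z0 : forall i, 0 <= z i.
Hypothesis zD : forall i, i \in D -> z i < 1.
Hypothesis zC : forall i, i \notin D -> z i = 1.
Hypothesis iota_inj : injective iota.
Hypothesis iota_im : forall i, (i \notin D) = [exists a, iota a == i].
Variable q : pattern d -> R.
Hypothesis q_gt0 : forall b, 0 < q b.
Hypothesis q_sum1 : \sum_b q b = 1.

Let A := precm q.
Let th := meanv q.

Lemma big_iota (T : Type) (idx : T) (op : Monoid.com_law idx) (F : 'I_d -> T) :
  (forall i, i \in D -> F i = idx) -> \big[op/idx]_i F i = \big[op/idx]_a F (iota a).
Proof.
move=> FD.
have -> : \big[op/idx]_a F (iota a) = \big[op/idx]_(a in [set: 'I_c]%SET) F (iota a).
  by apply: eq_bigl => a; rewrite inE.
rewrite -(big_imset F (fun a b _ _ => @iota_inj a b)) /=.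
rewrite [LHS]big_mkcond /=; rewrite [RHS]big_mkcond /=; apply: eq_bigr => i _.
case: ifPn => // h; apply: FD; apply: contraT => iD; exfalso.
move: iD; rewrite iota_im => /existsP[a /eqP ai]; move: h; rewrite -ai.
by rewrite imset_f ?inE.
Qed.

Lemma iota_notin a : iota a \in D = false.
Proof. by apply/negbTE; rewrite iota_im; apply/existsP; exists a. Qed.

Lemma dim_split : d = (#|D| + c)%N.
Proof.
rewrite -[LHS]card_ord -(cardsC D); congr (_ + _)%N.
rewrite -[RHS]card_ord -(card_imset predT iota_inj) /=; apply: eq_card => i.
rewrite inE iota_im; apply/existsP/imsetP => [[a /eqP <-]|[a _ ->]]; exists a => //.
Qed.

Definition emb (u : nat -> R) : 'rV[R]_d := \row_i \sum_(a < c) (iota a == i)%:R * u a.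

Lemma emb_iota u a : emb u 0 (iota a) = u a.
Proof.
rewrite mxE (bigD1 a) //= eqxx mul1r big1 ?addr0 // => b ba.
by rewrite (inj_eq iota_inj) (negPf ba) mul0r.
Qed.

Lemma emb_D u i : i \in D -> emb u 0 i = 0.
Proof.
move=> iD; rewrite mxE big1 // => a _; case: eqP => [ai|_]; last by rewrite mul0r.
by have := iota_notin a; rewrite ai iD.
Qed.

Lemma rnorm1_emb u : rnorm1 (emb u) = \sum_(a < c) `|u a|.
Proof.
rewrite /rnorm1 (big_iota _ (F := fun i => `|emb u 0 i|)); last first.
  by move=> i iD; rewrite emb_D ?normr0.
by apply: eq_bigr => a _; rewrite emb_iota.
Qed.

Lemma qform_emb (B : 'M[R]_d) u :
  qform B (emb u) = \sum_(a < c) \sum_(b < c) u a * B (iota a) (iota b) * u b.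
Proof.
rewrite /qform bformE (big_iota _ (F := fun i => \sum_j emb u 0 i * B i j * emb u 0 j)); last first.
  by move=> i iD; rewrite big1 // => j _; rewrite emb_D ?mul0r.
apply: eq_bigr => a _; rewrite (big_iota _ (F := fun j => emb u 0 (iota a) * B (iota a) j * emb u 0 j)); last first.
  by move=> i iD; rewrite (emb_D u iD) mulr0.
by apply: eq_bigr => b _; rewrite !emb_iota.
Qed.

Definition gorthant (u : nat -> R) : R := gprofile A (emb u).

Lemma gorthant_decay : exists K : R, orthant_decay c K gorthant.
Proof.
have [K1 K10 HK1] := gprofile_decay q_gt0 q_sum1.
have [K2 K20 HK2] := gprofile_lipschitz q_gt0 q_sum1.
exists (K1 + 2 * K2); split=> [u u0|i u x y u0 /andP[x0 xy]].
  rewrite expR_ge0 /=.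
  have E : \prod_(l < c) expR (- u l) = expR (- rnorm1 (emb u)).
    rewrite rnorm1_emb -sumrN expR_sum; apply: eq_bigr => l _.
    by rewrite ger0_norm.
  rewrite E; apply: le_trans (_ : K1 * expR (- rnorm1 (emb u)) <= _); last first.
    by apply: ler_wpM2r; [exact: expR_ge0 | rewrite lerDl; nng].
  by apply: le_trans (HK1 _); rewrite ler_peMl ?expR_ge0 // lerDl rnorm1_ge0.
have y0 : 0 <= y by apply: le_trans xy.
have E t : 0 <= t -> expR (- rnorm1 (emb (upd u i t))) = expR (- t) * \prod_(l < c | l != i) expR (- u l).
  move=> t0; rewrite rnorm1_emb -sumrN expR_sum (bigD1 i) //= /upd eqxx ger0_norm //; congr (_ * _).
  by apply: eq_bigr => l li; rewrite (_ : (l == i :> nat) = false) ?ger0_norm //; apply/negbTE.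
have Dn : rnorm1 (emb (upd u i y) - emb (upd u i x)) = y - x.
  have -> : emb (upd u i y) - emb (upd u i x) = emb (fun l => upd u i y l - upd u i x l).
    apply/rowP => l; rewrite !mxE -sumrB; apply: eq_bigr => a _; ring.
  rewrite rnorm1_emb (bigD1 i) //= /upd eqxx big1 ?addr0 ?ger0_norm ?subr_ge0 //.
  by move=> l li; rewrite (_ : (l == i :> nat) = false) ?subrr ?normr0 //; apply/negbTE.
have := HK2 (emb (upd u i y)) (emb (upd u i x)); rewrite Dn !E //.
move/le_trans; apply.
set P := \prod_(l < c | _) _; have P0 : 0 <= P by apply: prodr_ge0 => l _; exact: expR_ge0.
have eyx : expR (- y) <= expR (- x) by rewrite ler_expR lerN2.
have yx : 0 <= y - x by rewrite subr_ge0.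
apply: le_trans (_ : K2 * (y - x) * (2 * expR (- x) * P) <= _).
  apply: ler_wpM2l; first by nng.
  by rewrite -mulrDl; apply: ler_wpM2r => //; lra.
rewrite (_ : K2 * (y - x) * (2 * expR (- x) * P) = 2 * K2 * (y - x) * expR (- x) * P); last by ring.
apply: ler_wpM2r => //; apply: ler_wpM2r; first exact: expR_ge0.
by apply: ler_wpM2r => //; rewrite lerDr.
Qed.

Definition gauss_orthant : R := fine (orthant_integral c (fun u => (gorthant u)%:E)).

Variable w : nat -> lattice d.
Hypothesis w_near : forall n i, `|(w n i)%:~R - n%:R * th 0 i| <= 1.

(** Of the d factors n^(-1/2) in [gker] only c are kept, as the mesh volume of a Riemann sum along
    the coordinates outside [D]; the other #|D| are normalised away. *)
Definition last_sum (n : nat) : R :=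
  \sum_(v : {ffun 'I_d -> 'I_n.+2}) (\prod_i z i ^+ v i) *
    ((Num.sqrt n%:R)^-1 ^+ c * gprofile A ((Num.sqrt n%:R)^-1 *: (pos (w n - natpt v) - n%:R *: th))).

(** [last_sum] with the Gaussian evaluated at the coordinates outside [D] only, and without the
    offset w - n th. Along [D] the weights z^v keep v essentially bounded, which is negligible after
    division by sqrt n. *)
Definition flat_sum (n : nat) : R :=
  \sum_(v : {ffun 'I_d -> 'I_n.+2}) (\prod_i z i ^+ v i) *
    ((Num.sqrt n%:R)^-1 ^+ c * gorthant (lpt (Num.sqrt n%:R)^-1 [ffun a => v (iota a)])).

Lemma flat_sumE n : flat_sum n =
  (\prod_(i in D) \sum_(k < n.+2) z i ^+ k) * orthant_sum (Num.sqrt n%:R)^-1 n.+2 c gorthant.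
Proof.
rewrite /flat_sum /orthant_sum.
rewrite (@sum_ffun_factor R d c 'I_n.+2 D iota (fun i k => z i ^+ k)
  (fun u => (Num.sqrt n%:R)^-1 ^+ c * gorthant (lpt (Num.sqrt n%:R)^-1 u))) //.
  by rewrite -mulr_sumr.
by move=> i j /zC ->; rewrite expr1n.
Qed.

Lemma cvg_flat_sum : (flat_sum @ \oo --> (\prod_(i in D) (1 - z i)^-1) * gauss_orthant)%classic.
Proof.
rewrite (_ : flat_sum = fun n => (\prod_(i in D) \sum_(k < n.+2) z i ^+ k) * orthant_sum (Num.sqrt n%:R)^-1 n.+2 c gorthant); last first.
  by apply/funext => n; exact: flat_sumE.
apply: cvgM.
  rewrite [X in (_ --> X)%classic](_ : _ = \prod_i (if i \in D then (1 - z i)^-1 else 1)); last by rewrite big_mkcond.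
  rewrite (_ : (fun n => _) = fun n => \prod_i (if i \in D then \sum_(k < n.+2) z i ^+ k else 1)); last first.
    by apply/funext => n; rewrite big_mkcond.
  apply: (cvg_prod _ (f := fun i n => if i \in D then \sum_(k < n.+2) z i ^+ k else 1)) => i.
  case: ifPn => iD; last exact: cvg_cst.
  by apply: cvg_geometric_sum; rewrite z0 zD.
have [K GK] := gorthant_decay.
have [K' K'0 /(_ _ _ GK)[_ _ HO]] := @orthant_riemann R c.
apply: cvg_seq_le => e e0.
have KK : 0 <= K' * K.
  apply: mulr_ge0 => //; have [g1 _] := GK; have := g1 (fun=> 0) (fun=> lexx _).
  by rewrite big1 ?mulr1 => [/andP[/le_trans h /h]|l _] //; rewrite oppr0 expR0.
have e1 : 0 < Num.min 1 (e / (3 * (K' * K) + 1)).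
  by rewrite lt_min ltr01 divr_gt0 //; apply: ltr_wpDl => //; nng.
have [n0 hn0] := inv_sqrt_small e1; exists n0 => n /hn0[n_gt0].
set h := (Num.sqrt n%:R)^-1; rewrite le_min => /andP[h1 he].
have s0 : 0 < Num.sqrt (n%:R : R) by rewrite sqrtr_gt0 ltr0n.
have h0 : 0 < h by rewrite invr_gt0.
have := HO h n.+2 (introT andP (conj h0 h1)) => /le_trans; apply.
(* The n + 2 mesh points cover a length of at least sqrt n, so the tail is smaller than the mesh
   size. *)
have ex : expR (- (h * n.+2%:R)) <= h.
  have hn : Num.sqrt n%:R <= h * n.+2%:R.
    have {1}-> : Num.sqrt n%:R = h * n%:R :> R.
      by rewrite -[X in _ = _ * X]sqr_sqrtr ?ler0n // expr2 mulrA mulVf ?mul1r // gt_eqF.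
    by apply: ler_wpM2l; [exact: ltW | rewrite ler_nat; lia].
  rewrite expRN lef_pV2 ?posrE ?expR_gt0 //.
  by apply: le_trans hn _; have := expR_ge1Dx (h * n.+2%:R); lra.
apply: le_trans (_ : K' * K * (3 * h) <= _).
  by apply: ler_wpM2l => //; lra.
have := he; rewrite ler_pdivlMr; last by apply: ltr_wpDl => //; nng.
by have := ltW h0; lra.
Qed.

Lemma last_sum_flat : exists2 K : R, 0 <= K & forall n, (0 < n)%N ->
  `|last_sum n - flat_sum n| <= K * (Num.sqrt n%:R)^-1.
Proof.
have [K K0 HK] := gprofile_lipschitz q_gt0 q_sum1.
pose Pz : R := \prod_(i in D) (1 - z i) ^- 2.
have Pz0 : 0 <= Pz by apply: prodr_ge0 => i _; rewrite invr_ge0 sqr_ge0.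
exists (K * (d%:R + 1) * (expR d%:R + 1) * (Pz * 2 ^+ c)); first by nng.
move=> n n_gt0; set h : R := (Num.sqrt n%:R)^-1.
have s0 : 0 < Num.sqrt (n%:R : R) by rewrite sqrtr_gt0 ltr0n.
have h0 : 0 < h by rewrite invr_gt0.
have h1 : h <= 1 by rewrite invf_le1 // -[leLHS]sqrtr1 ler_wsqrtr // ler1n.
(* The factors 1 + v_i bound the displacement along [D]; with them each geometric sum is still at
   most (1 - z)^(-2). *)
pose F i (k : 'I_n.+2) : R := if i \in D then z i ^+ k * (1 + k%:R) else 1.
pose Phi (u : {ffun 'I_c -> 'I_n.+2}) : R := h ^+ c * \prod_(l < c) expR (- lpt h u l).
have term (v : {ffun 'I_d -> 'I_n.+2}) :
  `|gprofile A (h *: (pos (w n - natpt v) - n%:R *: th)) - gorthant (lpt h [ffun a => v (iota a)])| <=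
   K * (d%:R + 1) * (expR d%:R + 1) * h * ((\prod_(i in D) (1 + (v i)%:R)) * \prod_(l < c) expR (- lpt h [ffun a => v (iota a)] l)).
  set x := h *: _; set u := lpt h _.
  have ua (a : 'I_c) : u a = h * (v (iota a))%:R.
    rewrite /u /lpt; case: insubP => [j _ ja|]; last by rewrite ltn_ord.
    by have -> : j = a by [apply/val_inj]; rewrite ffunE.
  have gN y : gprofile A (- y) = gprofile A y.
    by rewrite /gprofile -[- y]scaleN1r qformZ sqrrN expr1n mul1r.
  have xE i : x 0 i = h * (((w n i)%:~R - n%:R * th 0 i) - (v i)%:R).
    by rewrite !mxE !ffunE rmorphB /=; ring.
  have re : rnorm1 (emb u) = h * \sum_(a < c) (v (iota a))%:R.
    rewrite rnorm1_emb mulr_sumr; apply: eq_bigr => a _.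
    by rewrite ua ger0_norm //; nng.
  have PE : \prod_(l < c) expR (- u l) = expR (- rnorm1 (emb u)).
    rewrite rnorm1_emb -sumrN expR_sum; apply: eq_bigr => l _.
    by rewrite ger0_norm // ua; nng.
  (* The profile is even, and [x] is close to [- emb u] since v enters [x] with a minus sign. *)
  rewrite /gorthant -(gN (emb u)); apply: le_trans (HK x (- emb u)) _.
  have rNe : rnorm1 (- emb u) = rnorm1 (emb u) by apply: eq_bigr => i _; rewrite mxE normrN.
  have rx : rnorm1 (emb u) - d%:R <= rnorm1 x.
    rewrite lerBlDr -[X in _ + X%:R]card_ord -sumr_const /rnorm1 -big_split /=; apply: ler_sum => i _.
    case: (boolP (i \in D)) => iD; first by rewrite emb_D // normr0; nng.
    move: iD; rewrite iota_im => /existsP[a /eqP <-]; rewrite emb_iota ua xE.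
    rewrite !normrM (ger0_norm (ltW h0)) [`|(v _)%:R|]ger0_norm //.
    have := w_near n (iota a); set y := _ - _ => yb.
    have := ler_norm ((v (iota a))%:R - y); rewrite distrC => t.
    have t2 : (v (iota a))%:R <= `|y - (v (iota a))%:R| + 1 by have := ler_norm y; lra.
    apply: le_trans (ler_wpM2l (ltW h0) t2) _; rewrite mulrDr mulr1.
    by rewrite lerD2l.
  have dx : rnorm1 (x + emb u) <= h * ((d%:R + 1) * \prod_(i in D) (1 + (v i)%:R)).
    apply: le_trans (_ : h * (d%:R + \sum_(i in D) (v i)%:R) <= _).
      have -> : h * (d%:R + \sum_(i in D) (v i)%:R) = \sum_(i < d) (h + (if i \in D then h * (v i)%:R else 0)).
        by rewrite big_split /= sumr_const card_ord -big_mkcond -mulr_sumr mulrDr mulr_natr.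
      rewrite /rnorm1; apply: ler_sum => i _.
      rewrite [(x + _) 0 i]mxE xE; case: (boolP (i \in D)) => iD.
        rewrite emb_D // addr0 normrM (ger0_norm (ltW h0)) [X in _ <= X](_ : _ = h * (1 + (v i)%:R)); last by ring.
        apply: ler_wpM2l; first exact: ltW.
        by apply: le_trans (ler_normB _ _) _; rewrite [`|(v i)%:R|]ger0_norm // lerD2r w_near.
      move: iD; rewrite iota_im => /existsP[a /eqP <-]; rewrite emb_iota ua addr0.
      rewrite -mulrDr subrK normrM (ger0_norm (ltW h0)) -[leRHS]mulr1.
      by apply: ler_wpM2l; [exact: ltW | exact: w_near].
    apply: ler_wpM2l; first exact: ltW.
    have P1 (s : seq 'I_d) : 1 <= \prod_(i <- s | i \in D) (1 + (v i)%:R) :> R /\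
        \sum_(i <- s | i \in D) (v i)%:R <= \prod_(i <- s | i \in D) (1 + (v i)%:R) :> R.
      elim: s => [|i s [IH1 IH2]]; first by rewrite !big_nil lexx ler01.
      rewrite !big_cons; case: ifP => // _.
      have := ler0n R (v i); move: ((v i)%:R : R) => t t0.
      move: (\sum_(j <- s | _) _) (\prod_(j <- s | _) _) IH1 IH2 => S P IH1 IH2.
      by split; nra.
    have [P1a P1b] := P1 (index_enum 'I_d).
    move: P1a P1b; move: (\prod_(i in D) _) (\sum_(i in D) _) => P S P1a P1b.
    have := ler_wpM2l (ler0n R d) P1a.
    by lra.
  have e1 : expR (- rnorm1 x) <= expR d%:R * expR (- rnorm1 (emb u)).
    by rewrite -expRD ler_expR; lra.
  rewrite opprK rNe PE.
  apply: le_trans (_ : K * (h * ((d%:R + 1) * \prod_(i in D) (1 + (v i)%:R))) *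
     (expR d%:R * expR (- rnorm1 (emb u)) + expR (- rnorm1 (emb u))) <= _).
    apply: ler_pM; [|by nng| |].
    - by apply: mulr_ge0 => //; exact: rnorm1_ge0.
    - by apply: ler_wpM2l.
    - by rewrite lerD2r.
  by rewrite le_eqVlt; apply/orP; left; apply/eqP; ring.
rewrite /last_sum /flat_sum -sumrB.
apply: le_trans (ler_norm_sum _ _ _) _.
apply: (@le_trans _ _ (\sum_(v : {ffun 'I_d -> 'I_n.+2}) K * (d%:R + 1) * (expR d%:R + 1) * h *
   ((\prod_i F i (v i)) * Phi [ffun a => v (iota a)]))).
  apply: ler_sum => v _; rewrite -mulrBr -mulrBr normrM ger0_norm; last first.
    by apply: prodr_ge0 => i _; exact: exprn_ge0.
  rewrite normrM ger0_norm; last by nng.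
  apply: le_trans (ler_wpM2l _ (ler_wpM2l _ (term v))) _; [|by nng|].
    by apply: prodr_ge0 => i _; exact: exprn_ge0.
  have -> : \prod_i F i (v i) = (\prod_i z i ^+ v i) * \prod_(i in D) (1 + (v i)%:R).
    rewrite [X in _ * X]big_mkcond -big_split /=; apply: eq_bigr => i _; rewrite /F.
    by case: ifPn => // iD; rewrite zC // expr1n mul1r.
  by rewrite /Phi le_eqVlt; apply/orP; left; apply/eqP; ring.
rewrite -mulr_sumr (@sum_ffun_factor R d c 'I_n.+2 D iota F Phi) //; last first.
  by move=> i j /negPf iD; rewrite /F iD.
have B1 : \prod_(i in D) \sum_j F i j <= Pz.
  rewrite /Pz; apply: ler_prod => i iD; apply/andP; split.
    by apply: sumr_ge0 => j _; rewrite /F iD; apply: mulr_ge0; [exact: exprn_ge0 | nng].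
  rewrite (eq_bigr (fun j : 'I_n.+2 => z i ^+ j * (1 + j%:R))); last by move=> j _; rewrite /F iD.
  by apply: geometric_deriv_bound; rewrite z0 zD.
have B2 : \sum_u Phi u <= 2 ^+ c.
  have -> : \sum_u Phi u = orthant_sum h n.+2 c (fun u => \prod_(l < c) expR (- u l)).
    by rewrite /orthant_sum mulr_sumr.
  apply: le_trans (ler_norm _) _; rewrite -[leRHS]mul1r; apply: orthant_sum_bound => //.
    by rewrite h0.
  move=> u _; rewrite mul1r ger0_norm //; apply: prodr_ge0 => l _; exact: expR_ge0.
rewrite mulrAC; apply: ler_wpM2r; first exact: ltW.
apply: ler_wpM2l; first by nng.
apply: ler_pM => //.
  by apply: prodr_ge0 => i iD; apply: sumr_ge0 => j _; rewrite /F iD; apply: mulr_ge0; [exact: exprn_ge0 | nng].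
by apply: sumr_ge0 => u _; apply: mulr_ge0; [nng | apply: prodr_ge0 => l _; exact: expR_ge0].
Qed.

Lemma cvg_last_sum : (last_sum @ \oo --> (\prod_(i in D) (1 - z i)^-1) * gauss_orthant)%classic.
Proof.
have [K K0 HK] := last_sum_flat.
rewrite -[X in (_ --> X)%classic]addr0.
rewrite (_ : last_sum = fun n => flat_sum n + (last_sum n - flat_sum n)); last first.
  by apply/funext => n; rewrite addrC subrK.
apply: cvgD; first exact: cvg_flat_sum.
apply: cvg_seq_le => e e0.
have e1 : 0 < e / (K + 1) by rewrite divr_gt0 //; lra.
have [n0 hn0] := inv_sqrt_small e1; exists n0 => n /hn0[n_gt0 he].
rewrite subr0; apply: le_trans (HK n n_gt0) _.
move: he; rewrite ler_pdivlMr; last by lra.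
have : 0 <= (Num.sqrt n%:R)^-1 :> R by nng.
by lra.
Qed.

End LocalLimit.

Section LocalLimitTheorem.
Context {R : realType} {d c : nat}.
Variables (z : 'I_d -> R) (D : {set 'I_d}) (iota : 'I_c -> 'I_d).
Hypothesis z0 : forall i, 0 <= z i.
Hypothesis zD : forall i, i \in D -> z i < 1.
Hypothesis zC : forall i, i \notin D -> z i = 1.
Hypothesis iota_inj : injective iota.
Hypothesis iota_im : forall i, (i \notin D) = [exists a, iota a == i].
Variable q : pattern d -> R.
Hypothesis q_gt0 : forall b, 0 < q b.
Hypothesis q_sum1 : \sum_b q b = 1.
Variable w : nat -> lattice d.
Hypothesis w_near : forall n i, `|(w n i)%:~R - n%:R * meanv q 0 i| <= 1.

Let a n := Num.sqrt n%:R ^+ #|D| * iter n (wavg q) (weight z n.+1) (w n).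

Lemma z01 i : 0 <= z i <= 1.
Proof. by rewrite z0 /=; case: (boolP (i \in D)) => [/zD/ltW|/zC ->]. Qed.

Lemma last_sum_stage M n : (0 < n)%N -> box_large M n.+1 n (w n) ->
  Num.sqrt n%:R ^+ #|D| * stage z q M n.+1 n n (w n) = last_sum (c := c) z q w n.
Proof.
move=> n0 hM; rewrite stage_last // mulr_sumr; apply: eq_bigr => v _.
rewrite mulrCA; congr (_ * _); rewrite /gker mulrA; congr (_ * _).
have s0 : Num.sqrt (n%:R : R) != 0 by rewrite gt_eqF // sqrtr_gt0 ltr0n.
have E (x : R) : x ^+ d = x ^+ #|D| * x ^+ c.
  by rewrite -exprD; congr (_ ^+ _); exact: (dim_split iota_inj iota_im).
by rewrite E mulrA -exprMn divff // expr1n mul1r.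
Qed.

(** Three errors of size e/3: the mass of the kernel at [j0] against [gauss_mass], the smoothing at
    [j0], and the exchange from [j0] to [n]. The parameters are chosen in the order e, j0, n, M. *)
Lemma walk_vs_last_sum (e : R) : 0 < e -> exists n0 : nat, forall n, (n0 <= n)%N ->
  `|gauss_mass (precm q) * a n - last_sum (c := c) z q w n| <= e.
Proof.
move=> e0.
have [C C0 HC] := stage_telescope z01 zD q_gt0 q_sum1.
have [C1 C10 HC1] := iter_weight_bound z01 zD q_gt0 q_sum1.
have e3 : 0 < e / 3 by rewrite divr_gt0.
have e1 : 0 < e / 3 / (C1 + 1) by rewrite divr_gt0 //; lra.
have [h0 h00 Hh] := gauss_mass_lim (precm_sym q) (precm_posdef q_gt0 q_sum1) e1.
have e2 : 0 < Num.min h0 (e / 3 / (C + 1)) by rewrite lt_min h00 divr_gt0 //; lra.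
have [j0 hj0] := inv_sqrt_small e2.
have [j_gt0] := hj0 j0 (leqnn _); rewrite le_min => /andP[jh jC].
have [K K0 HK] := stage_smoothing z01 zD q_gt0 q_sum1 j_gt0.
have e4 : 0 < e / 3 / (K * 2 ^+ #|D|.+1 + 1).
  by rewrite divr_gt0 //; apply: ltr_wpDl => //; nng.
have [n1 hn1] := inv_sqrt_small e4.
exists (maxn n1 (2 * j0)%N) => n; rewrite geq_max => /andP[/hn1[n_gt0 hn] nj].
set s : R := Num.sqrt n%:R in hn *.
have s0 : 0 < s by rewrite sqrtr_gt0 ltr0n.
have sj : 0 < (Num.sqrt j0%:R)^-1 :> R by rewrite invr_gt0 sqrtr_gt0 ltr0n.
have [up [M0 lo]] := Hh _ (j0%:R *: meanv q) (introT andP (conj sj jh)).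
(* Large enough both for the kernel at [j0] to have nearly full mass in the cube and for the
   supports around [w n] to fit. *)
pose M := (M0 + (lnorm1 (w n) + (n.+1 + n).+1))%N.
have hM : box_large M n.+1 n (w n).
  move=> i; have : (absz (w n i) <= lnorm1 (w n))%N by rewrite /lnorm1 (bigD1 i) //= leq_addr.
  by rewrite /M => hle; apply: leq_trans (leq_addl _ _); rewrite leq_add2r.
have M0M : (M0 <= M)%N by rewrite /M leq_addr.
clearbody M.
have jn : (0 < j0 <= n)%N by rewrite j_gt0 /=; apply: leq_trans nj; rewrite leq_pmull.
have T1 := HC M n.+1 n j0 (w n) jn hM.
have T2 := HK M n.+1 n (w n) (proj2 (andP jn)).
rewrite -(last_sum_stage n_gt0 hM) -/s.
have an : `|a n| <= C1.
  rewrite /a -/s normrM ger0_norm; last by nng.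
  rewrite -[leRHS](mulfK (expf_neq0 #|D| (lt0r_neq0 s0))) mulrC [C1 * _ / _]mulrAC; apply: ler_wpM2r; first by nng.
  apply: le_trans (HC1 n n.+1 (w n)) _; apply: ler_wpM2l => //.
  rewrite lef_pV2 ?posrE ?exprn_gt0 ?sqrtr_gt0 ?ltr0n //.
  apply: lerXn2r; rewrite ?nnegrE ?sqrtr_ge0 //.
  by rewrite ler_wsqrtr // ler_nat.
set gs := boxsum M (gker (precm q) (meanv q) j0) in T2.
have gsb : `|gauss_mass (precm q) - gs| <= e / 3 / (C1 + 1).
  have := up M; have := lo M M0M; rewrite -boxsum_gker_gsum -/gs => b1 b2.
  by rewrite ler_norml; apply/andP; split; lra.
have P1 : `|(gauss_mass (precm q) - gs) * a n| <= e / 3.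
  rewrite normrM; apply: le_trans (ler_pM _ _ gsb an) _ => //.
  rewrite mulrAC ler_pdivrMr; last by lra.
  by apply: ler_wpM2l; [exact: ltW | rewrite lerDl].
have P2 : `|gs * a n - s ^+ #|D| * stage z q M n.+1 n j0 (w n)| <= e / 3.
  rewrite /a -/s mulrCA -mulrBr normrM ger0_norm; last by nng.
  rewrite distrC; apply: le_trans (ler_wpM2l _ T2) _; first by nng.
  have b : (Num.sqrt (n - j0).+1%:R)^-1 <= 2 / s :> R.
    by apply: inv_sqrt_le => //; move: nj; clear; lia.
  apply: le_trans (_ : s ^+ #|D| * (K * (2 / s) ^+ #|D|.+1) <= _).
    apply: ler_wpM2l; first by nng.
    apply: ler_wpM2l => //; apply: lerXn2r; rewrite ?nnegrE //; nng.
  rewrite (_ : s ^+ #|D| * (K * (2 / s) ^+ #|D|.+1) = K * 2 ^+ #|D|.+1 * s^-1); last first.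
    rewrite expr_div_n [s ^+ _.+1]exprS.
    have := exprn_gt0 #|D| s0; move: (s ^+ _) (2 ^+ _) => b' a' b0.
    by field; rewrite !gt_eqF.
  have KK : 0 <= K * 2 ^+ #|D|.+1 by nng.
  move: hn; rewrite ler_pdivlMr; last by lra.
  have : 0 <= s^-1 by nng.
  by move: (K * _) KK => k0 KK; lra.
have P3 : `|s ^+ #|D| * stage z q M n.+1 n j0 (w n) - s ^+ #|D| * stage z q M n.+1 n n (w n)| <= e / 3.
  rewrite -mulrBr normrM ger0_norm; last by nng.
  apply: le_trans (ler_wpM2l _ T1) _; first by nng.
  rewrite -/s exprVn mulrCA divff ?mulr1; last by rewrite expf_neq0 // gt_eqF.
  move: jC; rewrite ler_pdivlMr; last by lra.
  by move: (Num.sqrt j0%:R)^-1 sj => y sj; lra.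
rewrite (_ : gauss_mass (precm q) * a n - _ = (gauss_mass (precm q) - gs) * a n +
  ((gs * a n - s ^+ #|D| * stage z q M n.+1 n j0 (w n)) +
   (s ^+ #|D| * stage z q M n.+1 n j0 (w n) - s ^+ #|D| * stage z q M n.+1 n n (w n)))); last by ring.
apply: le_trans (ler_normD _ _) _; apply: le_trans (lerD (lexx _) (ler_normD _ _)) _.
by have := lerD P1 (lerD P2 P3); lra.
Qed.

Lemma det_covm_gt0 : 0 < \det (covm q).
Proof.
have := posdef_det_gt0 (precm_sym q) (precm_posdef q_gt0 q_sum1).
by rewrite /precm det_inv invr_gt0.
Qed.

Theorem local_limit :
  ((fun n => Num.sqrt n%:R ^+ #|D| * iter n (wavg q) (weight z n.+1) (w n)) @ \oo -->
    (\prod_(i in D) (1 - z i)^-1) * gauss_orthant iota q / Num.sqrt ((2 * pi) ^+ d * \det (covm q)))%classic.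
Proof.
have mE : gauss_mass (precm q) = Num.sqrt ((2 * pi) ^+ d * \det (covm q)).
  by rewrite /gauss_mass /precm det_inv invrK.
have m0 : 0 < gauss_mass (precm q).
  by rewrite mE sqrtr_gt0 mulr_gt0 ?det_covm_gt0 ?exprn_gt0 ?mulr_gt0 ?pi_gt0.
rewrite -mE.
have -> : (fun n => Num.sqrt n%:R ^+ #|D| * iter n (wavg q) (weight z n.+1) (w n)) =
  fun n => (last_sum (c := c) z q w n + (gauss_mass (precm q) * a n - last_sum (c := c) z q w n)) / gauss_mass (precm q).
  by apply/funext => n; rewrite [X in X / _]addrC subrK mulrAC divff ?mul1r // gt_eqF.
apply: cvgMl.
rewrite -[X in (_ --> X)%classic]addr0; apply: cvgD.
  exact: (cvg_last_sum z0 zD zC iota_inj iota_im q_gt0 q_sum1 w_near).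
by apply: cvg_seq_le => e /walk_vs_last_sum[n0 h]; exists n0 => n /h; rewrite subr0.
Qed.

End LocalLimitTheorem.

(** * Positivity of the orthant integral *)

Section OrthantPositive.
Context {R : realType} {d c : nat}.
Variables (D : {set 'I_d}) (iota : 'I_c -> 'I_d).
Hypothesis iota_inj : injective iota.
Hypothesis iota_im : forall i, (i \notin D) = [exists a, iota a == i].
Variable q : pattern d -> R.
Hypothesis q_gt0 : forall b, 0 < q b.
Hypothesis q_sum1 : \sum_b q b = 1.

(** Asymptotic equivalence divides by this integral. Fine mesh sums are at least [g0], and the error
    bound of [orthant_riemann] carries half of that over to the integral. *)
Lemma gauss_orthant_gt0 : 0 < gauss_orthant iota q.
Proof.
have [K GK] := gorthant_decay iota_inj iota_im q_gt0 q_sum1.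
have [K' K'0 /(_ _ _ GK)[_ _ HO]] := @orthant_riemann R c.
have KK : 0 <= K' * K.
  apply: mulr_ge0 => //; have [g1 _] := GK; have := g1 (fun=> 0) (fun=> lexx _).
  by rewrite big1 ?mulr1 // => [/andP[/le_trans h /h]|l _] //; rewrite oppr0 expR0.
pose S := entry_norm (precm q); have S0 : 0 <= S := entry_norm_ge0 _.
(* A lower bound of the integrand on the unit cube, where the 1-norm is at most c. *)
pose g0 : R := expR (- (S * (c%:R * c%:R)) / 2).
have g00 : 0 < g0 by exact: expR_gt0.
have lower (m N : nat) : (0 < m <= N)%N -> g0 <= orthant_sum m%:R^-1 N c (gorthant iota q).
  move=> /andP[m0 mN]; have mR : 0 < m%:R :> R by rewrite ltr0n.
  rewrite /orthant_sum.
  apply: le_trans (_ : m%:R^-1 ^+ c * \sum_(v : {ffun 'I_c -> 'I_N}) g0 * \prod_(l < c) (v l < m)%N%:R <= _).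
    rewrite -mulr_sumr -(bigA_distr_bigA (fun (l : 'I_c) (a : 'I_N) => ((a < m)%N%:R : R))).
    have -> : \prod_(l < c) \sum_(a < N) (a < m)%N%:R = m%:R ^+ c :> R.
      rewrite -[X in _ ^+ X]card_ord -prodr_const; apply: eq_bigr => l _.
      rewrite -natr_sum; congr (_%:R).
      transitivity (\sum_(a < m) 1)%N; last by rewrite sum1_card card_ord.
      rewrite (big_ord_widen N (fun=> 1%N) mN) [RHS]big_mkcond; apply: eq_bigr => a _.
      by case: (a < m)%N.
    by rewrite mulrCA -exprMn mulVf ?gt_eqF // expr1n mulr1.
  apply: ler_wpM2l; first by nng.
  apply: ler_sum => v _.
  case: (boolP [forall l, (v l < m)%N]) => [/forallP vm|]; last first.
    rewrite negb_forall => /existsP[l /negPf lm].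
    by rewrite (bigD1 l) //= lm mul0r mulr0 expR_ge0.
  rewrite big1 ?mulr1 => [|l _]; last by rewrite vm.
  rewrite /gorthant /gprofile ler_expR !mulNr lerN2 ler_pM2r ?invr_gt0 //.
  apply: le_trans (ler_norm _) _.
  have rn : rnorm1 (emb iota (lpt (m%:R^-1 : R) v)) <= c%:R.
    rewrite (rnorm1_emb iota_inj iota_im) -[X in _ <= X%:R]card_ord -sumr_const; apply: ler_sum => a _.
    rewrite /lpt; case: insubP => [j _ _|]; last by rewrite normr0 ler01.
    rewrite normrM !ger0_norm ?invr_ge0 // ler_pdivrMl // mulr1 ler_nat ltnW //.
  have r0 := rnorm1_ge0 (emb iota (lpt (m%:R^-1 : R) v)).
  apply: le_trans (bform_bound _ (rnorm1_entry _) (rnorm1_entry _) r0) _.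
  by apply: ler_wpM2l => //; apply: ler_pM.
have e0 : 0 < g0 / (2 * (K' * K + 1)) by rewrite divr_gt0 //; lra.
have [h h01 [N hN]] := mesh_error_small e0.
have /andP[h0 h1] := h01.
(* The mesh is refined to the inverse of an integer, so that the m^c mesh points with coordinates
   a/m, a < m, stand for the unit cube. *)
pose m := (Num.truncn h^-1).+1.
have m0 : (0 < m)%N by [].
have mR : 0 < m%:R :> R by rewrite ltr0n.
have hm : m%:R^-1 <= h.
  by rewrite -[leRHS]invrK lef_pV2 ?posrE ?invr_gt0 //; exact: ltW (truncnS_gt _).
have [n0 hn0] : exists n0 : nat, expR (- (m%:R^-1 * n0%:R)) <= expR (- (h * N%:R)).
  exists (Num.truncn (m%:R * (h * N%:R))).+1; rewrite ler_expR lerN2 -ler_pdivrMl ?invr_gt0 // invrK.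
  exact: ltW (truncnS_gt _).
pose N1 := (n0 + m)%N.
have m01 : 0 < (m%:R^-1 : R) <= 1 by rewrite invr_gt0 mR invf_le1 // ler1n.
have := HO _ N1 m01; have := lower m N1 (introT andP (conj m0 (leq_addl _ _))).
have er : 2 * m%:R^-1 + expR (- (m%:R^-1 * N1%:R)) <= g0 / (2 * (K' * K + 1)).
  apply: le_trans hN; apply: lerD; first by rewrite ler_pM2l.
  apply: le_trans hn0; rewrite ler_expR lerN2 ler_pM2l ?invr_gt0 // ler_nat.
  exact: leq_addr.
move=> lo /le_trans /(_ (ler_wpM2l KK er)).
have b : K' * K * (g0 / (2 * (K' * K + 1))) <= g0 / 2.
  rewrite mulrA ler_pdivrMr; last by lra.
  rewrite (_ : g0 / 2 * (2 * (K' * K + 1)) = (K' * K) * g0 + g0); last by field.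
  by rewrite lerDl ltW.
move=> /le_trans /(_ b); rewrite ler_norml => /andP[_ h2].
by rewrite /gauss_orthant; move: lo h2 g00; lra.
Qed.

End OrthantPositive.

(** * Exponential tilting *)

Section LogPartition.
Context {R : realType} {d : nat}.
Variable q0 : pattern d -> R.
Hypothesis q0_gt0 : forall b, 0 < q0 b.

Definition dotp (b : pattern d) (t : 'rV[R]_d) : R := \sum_i (b i)%:R * t 0 i.
Definition partf (t : 'rV[R]_d) : R := \sum_b q0 b * expR (dotp b t).
Definition tilt (t : 'rV[R]_d) (b : pattern d) : R := q0 b * expR (dotp b t) / partf t.

Lemma partf_gt0 t : 0 < partf t.
Proof.
rewrite /partf (bigD1 nopat) //= ltr_pwDl ?mulr_gt0 ?expR_gt0 //.
by apply: sumr_ge0 => b _; rewrite mulr_ge0 ?expR_ge0 // ltW.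
Qed.

Lemma tilt_gt0 t b : 0 < tilt t b.
Proof. by rewrite divr_gt0 ?mulr_gt0 ?expR_gt0 ?partf_gt0. Qed.

Lemma tilt_sum1 t : \sum_b tilt t b = 1.
Proof. by rewrite -mulr_suml divff // gt_eqF ?partf_gt0. Qed.

Lemma dotp_line b i t (s : R) : dotp b (s *: delta_mx 0 i + t) = s * (b i)%:R + dotp b t.
Proof.
rewrite /dotp (bigD1 i) //= [X in _ = _ + X](bigD1 i) //= !mxE !eqxx mulr1 mulrDr -addrA mulrC; congr (_ + (_ + _)).
by apply: eq_bigr => j ji; rewrite !mxE (negPf ji) andbF mulr0 add0r.
Qed.

(* [f] is any weight; [f = 1] gives [partf], [f b = b j] its [j]-th derivative. *)
Definition expsum (f : pattern d -> R) (t : 'rV[R]_d) : R := \sum_b q0 b * expR (dotp b t) * f b.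

(** Entries of patterns are 0 or 1, so along an axis every exponential sum is affine in exp s, and
    all derivatives below reduce to those of A + B exp s. *)
Lemma expsum_line f i t (s : R) : expsum f (s *: delta_mx 0 i + t) =
  expsum (fun b => f b * (1 - (b i)%:R)) t + expsum (fun b => f b * (b i)%:R) t * expR s.
Proof.
rewrite /expsum mulr_suml -big_split /=; apply: eq_bigr => b _.
rewrite dotp_line expRD; case: (b i); rewrite ?mulr1 ?mulr0 ?subrr ?subr0 ?expR0 ?mulr1 ?mulr0 ?mul0r ?mul1r ?addr0 ?add0r //; ring.
Qed.

Lemma is_derive_affine_expR (A B s : R) : is_derive s 1 (fun x : R => A + B * expR x) (B * expR s).
Proof.
rewrite -[B * expR s]add0r; exact: (@is_deriveDZ R (cst A) (@expR R)).
Qed.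

Lemma derive_line (f : 'rV[R]_d -> R) (t : 'rV[R]_d) (i : 'I_d) (l : R) :
  is_derive (0 : R) 1 (fun s : R => f (s *: delta_mx 0 i + t)) l -> derive f t (delta_mx 0 i) = l.
Proof.
set g := fun s : R => _; move=> H; rewrite -(@derive_val _ _ _ _ _ _ _ H) /derive.
have -> // : (fun h : R => h^-1 *: ((f \o shift t) (h *: delta_mx 0 i) - f t)) =
  (fun h : R => h^-1 *: ((g \o shift 0) (h *: (1 : R)) - g 0)).
by apply/funext => h; rewrite /g /= addr0 scale0r add0r [h *: 1]mulr1.
Qed.

Lemma meanv_tilt t i : meanv (tilt t) 0 i = expsum (fun b => (b i)%:R) t / partf t.
Proof.
rewrite mxE /expsum mulr_suml; apply: eq_bigr => b _.
by rewrite /tilt mulrAC.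
Qed.

Lemma partf_expsum t : partf t = expsum (fun=> 1) t.
Proof. by apply: eq_bigr => b _; rewrite mulr1. Qed.

Lemma partf_line i t (s : R) : partf (s *: delta_mx 0 i + t) =
  (partf t - expsum (fun b => (b i)%:R) t) + expsum (fun b => (b i)%:R) t * expR s.
Proof.
rewrite !partf_expsum expsum_line; congr (_ + _ * _).
  by rewrite /expsum -sumrB; apply: eq_bigr => b _; ring.
by apply: eq_bigr => b _; rewrite mul1r.
Qed.

Lemma is_derive_ln_partf t i (s : R) : is_derive s 1 (fun s : R => ln (partf (s *: delta_mx 0 i + t)))
  (expsum (fun b => (b i)%:R) t * expR s / partf (s *: delta_mx 0 i + t)).
Proof.
set A := partf t - expsum (fun b => (b i)%:R) t; set B := expsum (fun b => (b i)%:R) t.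
have E : (fun s : R => partf (s *: delta_mx 0 i + t)) = fun s : R => A + B * expR s.
  by apply/funext => x; exact: partf_line.
have p : 0 < A + B * expR s by rewrite -partf_line partf_gt0.
have h := @is_derive1_comp R (@ln R) (fun x : R => A + B * expR x) s _ _ (is_derive1_ln p) (is_derive_affine_expR A B s).
rewrite partf_line -/A -/B mulrC.
suff -> : (fun s : R => ln (partf (s *: delta_mx 0 i + t))) = @ln R \o (fun x : R => A + B * expR x) by [].
by apply/funext => x; rewrite /= partf_line.
Qed.

Lemma derive_ln_partf t i : derive (fun t => ln (partf t)) t (delta_mx 0 i) = meanv (tilt t) 0 i.
Proof.
apply: derive_line; have := is_derive_ln_partf t i 0.
by rewrite scale0r add0r expR0 mulr1 -meanv_tilt.
Qed.

Lemma covm_tilt t i j : covm (tilt t) i j =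
  expsum (fun b => (b j)%:R * (b i)%:R) t / partf t - meanv (tilt t) 0 i * meanv (tilt t) 0 j.
Proof.
rewrite /covm summxE.
transitivity (\sum_b (tilt t b * ((b j)%:R * (b i)%:R) - meanv (tilt t) 0 i * (tilt t b * (b j)%:R)
   - meanv (tilt t) 0 j * (tilt t b * (b i)%:R) + meanv (tilt t) 0 i * meanv (tilt t) 0 j * tilt t b)).
  apply: eq_bigr => b _; rewrite mxE [in LHS]mxE big_ord1 [in LHS]mxE.
  have e l : devv (tilt t) b 0 l = (b l)%:R - meanv (tilt t) 0 l by rewrite /devv entryB mxE.
  by rewrite !e; ring.
rewrite big_split sumrB sumrB /= -!mulr_sumr tilt_sum1.
have m l : \sum_b tilt t b * (b l)%:R = meanv (tilt t) 0 l by rewrite mxE.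
have -> : \sum_b tilt t b * ((b j)%:R * (b i)%:R) = expsum (fun b => (b j)%:R * (b i)%:R) t / partf t.
  by rewrite /expsum mulr_suml; apply: eq_bigr => b _; rewrite /tilt mulrAC.
by rewrite !m; ring.
Qed.

(** The mean is the gradient of the logarithm of [partf], so this identifies the Hessian with the
    covariance of the tilted law. *)
Lemma derive_meanv t i j :
  derive (fun t => meanv (tilt t) 0 j) t (delta_mx 0 i) = covm (tilt t) i j.
Proof.
apply: derive_line.
set A := partf t - expsum (fun b => (b i)%:R) t; set B := expsum (fun b => (b i)%:R) t.
set A' := expsum (fun b => (b j)%:R) t - expsum (fun b => (b j)%:R * (b i)%:R) t.
set B' := expsum (fun b => (b j)%:R * (b i)%:R) t.
have Ep (s : R) : partf (s *: delta_mx 0 i + t) = A + B * expR s by exact: partf_line.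
have Em (s : R) : expsum (fun b => (b j)%:R) (s *: delta_mx 0 i + t) = A' + B' * expR s.
  rewrite expsum_line; congr (_ + _).
  by rewrite /A' /expsum -sumrB; apply: eq_bigr => b _; ring.
have p (s : R) : 0 < A + B * expR s by rewrite -Ep partf_gt0.
have hden := is_derive_affine_expR A B 0.
have hnum := is_derive_affine_expR A' B' 0.
have hinv := @is_deriveV R (fun s : R => A + B * expR s) 0 (B * expR 0) 1 (lt0r_neq0 (p 0)) hden.
have h := @is_deriveM _ _ _ _ (0 : R) 1 _ _ hnum hinv.
have E : (fun s : R => meanv (tilt (s *: delta_mx 0 i + t)) 0 j) =
   (fun s : R => A' + B' * expR s) * (fun s : R => (A + B * expR s)^-1).
  by apply/funext => s; rewrite meanv_tilt Ep Em.
rewrite E; apply: (is_derive_eq h).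
rewrite covm_tilt !meanv_tilt expR0 !mulr1 /GRing.scale /=.
have AB : A + B = partf t by rewrite /A subrK.
have AB' : A' + B' = expsum (fun b => (b j)%:R) t by rewrite /A' subrK.
rewrite AB AB' -/B -/B'; have P0 := lt0r_neq0 (partf_gt0 t).
by clear -P0; clearbody B B'; field.
Qed.

(** First-order condition on each axis: the derivative of the objective in direction i is [th i]
    minus the tilted mean. *)
Lemma stationary (th : 'I_d -> R) t :
  (forall t', - ln (partf t') + \sum_i th i * t' 0 i <= - ln (partf t) + \sum_i th i * t 0 i) ->
  forall i, meanv (tilt t) 0 i = th i.
Proof.
move=> max i.
pose F (s : R) := - 1 * ln (partf (s *: delta_mx 0 i + t)) + (\sum_l th l * t 0 l + th i * s).
have lin s : \sum_l th l * (s *: delta_mx 0 i + t) 0 l = \sum_l th l * t 0 l + th i * s.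
  rewrite (bigD1 i) //= [in RHS](bigD1 i) //= !mxE !eqxx mulr1.
  rewrite (eq_bigr (fun l => th l * t 0 l)); first by ring.
  by move=> l li; rewrite !mxE (negPf li) andbF mulr0 add0r.
have dF (s : R) : is_derive s 1 F ((th i) + - 1 * (expsum (fun b => (b i)%:R) t * expR s / partf (s *: delta_mx 0 i + t))).
  have h1 : is_derive s 1 (fun x : R => \sum_l th l * t 0 l + th i * x) (0 + th i * 1).
    exact: (@is_deriveDZ R (cst (\sum_l th l * t 0 l)) id).
  rewrite add0r mulr1 in h1.
  have := is_deriveDZ (- 1) h1 (is_derive_ln_partf t i s).
  by rewrite (_ : (fun x : R => _) = F) //; apply/funext => x; rewrite /F addrC.
have H : is_derive (0 : R) 1 F 0.
  apply: (@derive1_at_max R F (-1) 1 0).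
  - by lra.
  - by move=> s _; exact: (@ex_derive _ _ _ _ _ _ _ (dF s)).
  - by rewrite in_itv /=; apply/andP; split; lra.
  - by move=> s _; rewrite /F mulr0 addr0 scale0r add0r -lin !mulN1r; exact: max.
have := @derive_val _ _ _ _ _ _ _ H; rewrite (@derive_val _ _ _ _ _ _ _ (dF 0)).
rewrite scale0r add0r expR0 mulr1 -meanv_tilt => e.
by move: e; lra.
Qed.

End LogPartition.

(** * Rankings *)

Section RankingPatterns.
Context {R : realType} {k : nat}.
Variable p : ranking k -> R.
Hypothesis p_gt0 : forall r, 0 < p r.
Variables X Y : {set 'I_k}.
Hypothesis XY : [disjoint X & Y].
Local Notation d := #|X :|: Y|.
Local Notation idx := (XYidx k X Y).

Lemma XYidx_inj : injective idx. Proof. exact: enum_val_inj. Qed.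

Lemma XYidx_in i : idx i \in X :|: Y. Proof. exact: enum_valP. Qed.

Lemma XYidx_onto j : j \in X :|: Y -> exists i, idx i = j.
Proof. by move=> jXY; exists (enum_rank_in jXY j); rewrite /XYidx enum_rankK_in. Qed.

(* The i-th entry records the event counted by the exponent of the i-th
   variable of [PXY]: the adversary is above [m] (in [X]), below [m] (in [Y]). *)
Definition rpat (r : ranking k) : pattern d :=
  [ffun i => if idx i \in X then idx i \in above_m k r else idx i \notin above_m k r].

Definition patlaw (b : pattern d) : R := \sum_(r | rpat r == b) p r.

Lemma sum_patlaw (F : pattern d -> R) : \sum_r p r * F (rpat r) = \sum_b patlaw b * F b.
Proof.
rewrite (partition_big rpat xpredT) //=; apply: eq_bigr => b _.
by rewrite /patlaw mulr_suml; apply: eq_bigr => r /eqP ->.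
Qed.

(** List [Z], then [m], then the other adversaries, and rank by index in the list. This makes every
    pattern possible, hence every weight of the walk positive. *)
Lemma exists_ranking (Z : {set 'I_k}) : exists r : ranking k, above_m k r = Z.
Proof.
pose s := [seq adv k j | j <- enum Z] ++ cand_m k :: [seq adv k j | j <- enum (~: Z)].
have adv_inj : injective (adv k) by move=> i j /(congr1 val) /= h; apply/val_inj.
have adv_m j : (cand_m k == adv k j) = false.
  by apply/eqP => /(congr1 val) /= h; have := ltn_ord j; rewrite -h ltnn.
have ms (c : 'I_k.+1) : c \in s.
  rewrite mem_cat inE; case: (unliftP ord_max c) => [j ->|->]; last by rewrite eqxx orbT.
  have -> : lift ord_max j = adv k j by apply/val_inj; rewrite /= /bump leqNgt ltn_ord.
  by rewrite !mem_map // !mem_enum inE; case: (j \in Z); rewrite ?orbT.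
have size_s : size s = k.+1.
  rewrite size_cat /= !size_map -!cardE addnS; congr _.+1.
  by rewrite cardsC card_ord.
pose f (c : 'I_k.+1) : 'I_k.+1 := inord (index c s).
have fE c : f c = index c s :> nat by rewrite inordK // -[X in (_ < X)%N]size_s index_mem.
have f_inj : injective f.
  move=> c c' /(congr1 val); rewrite /= !fE => /index_inj; apply => //; exact: ms.
exists (perm f_inj); apply/setP => j; rewrite inE /ranks_above !permE !fE.
rewrite /s !index_cat.
have -> : (cand_m k \in [seq adv k j | j <- enum Z]) = false.
  by apply/mapP => -[i _ /eqP]; rewrite adv_m.
rewrite mem_map // mem_enum /= eqxx addn0.
case: (boolP (j \in Z)) => jZ.
  by rewrite index_mem mem_map // mem_enum jZ.
by apply/negbTE; rewrite -leqNgt leq_addr.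
Qed.

Lemma patlaw_gt0 b : 0 < patlaw b.
Proof.
have [r rZ] := exists_ranking [set j | [exists i, (idx i == j) && (if idx i \in X then b i else ~~ b i)]].
have rb : rpat r == b.
  apply/eqP/ffunP => i; rewrite ffunE rZ inE.
  have -> : [exists i0, (idx i0 == idx i) && (if idx i0 \in X then b i0 else ~~ b i0)] = (if idx i \in X then b i else ~~ b i).
    apply/existsP/idP => [[i0 /andP[/eqP/XYidx_inj ->]]//|h]; by exists i; rewrite eqxx.
  by case: (idx i \in X); rewrite // negbK.
rewrite /patlaw (bigD1 r) //= ltr_pwDl //.
by apply: sumr_ge0 => r' _; exact: ltW.
Qed.

Lemma prod_XYidx (F : 'I_k -> R) : \prod_(j in X :|: Y) F j = \prod_i F (idx i).
Proof. exact: big_enum_val. Qed.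

(** For j in [Y], the leading factor z_j cancels 1/z_j when j is above m and survives otherwise; so
    the exponent of z_j is the entry recorded by [rpat]. *)
Lemma PXY_partition (z : 'I_k -> R) : (forall j, z j != 0) ->
  PXY R k p X Y z = \sum_r p r * \prod_i z (idx i) ^+ rpat r i.
Proof.
move=> z0; rewrite /PXY /Ppoly.
set x := (fun j : 'I_k => if j \in X then z j else if j \in Y then (z j)^-1 else 1).
have -> : \sum_Z pZ R k p Z * \prod_(j in Z) x j = \sum_r p r * \prod_(j in above_m k r) x j.
  rewrite [RHS](partition_big (above_m k) xpredT) //=; apply: eq_bigr => Z _.
  by rewrite /pZ mulr_suml; apply: eq_bigr => r /eqP ->.
rewrite mulr_sumr; apply: eq_bigr => r _; rewrite mulrCA; congr (_ * _).
under [RHS]eq_bigr do rewrite ffunE.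
rewrite -(prod_XYidx (fun j => z j ^+ (if j \in X then j \in above_m k r else j \notin above_m k r))).
rewrite big_mkcond [in X in _ * X]big_mkcond [RHS]big_mkcond -big_split.
apply: eq_bigr => j _ /=; rewrite /x finset.in_setU.
have := disjointFr XY (x := j).
case: (boolP (j \in X)) => jX /=; first by move=> -> //; rewrite mul1r; case: (j \in above_m k r).
move=> _; case: (boolP (j \in Y)) => jY; case: (j \in above_m k r); rewrite /= ?mulr1 //.
by rewrite mulfV.
Qed.

Lemma tcoord_XYidx (t : 'rV[R]_d) i : tcoord R k X Y t (idx i) = t 0 i.
Proof.
rewrite /tcoord (bigD1 i) //= big1 ?addr0 // => i' /andP[/eqP/XYidx_inj ->].
by rewrite eqxx.
Qed.

Lemma PXY_partf (t : 'rV[R]_d) : PXY R k p X Y (zeta_of R k X Y t) = partf patlaw t.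
Proof.
rewrite PXY_partition => [|j]; last by rewrite gt_eqF // expR_gt0.
rewrite (sum_patlaw (fun b => \prod_i zeta_of R k X Y t (idx i) ^+ b i)).
apply: eq_bigr => b _; congr (_ * _); rewrite /dotp expR_sum.
by apply: eq_bigr => i _; rewrite /zeta_of tcoord_XYidx -expRM_natl.
Qed.

Lemma Ktilde_partf : Ktilde R k p X Y = fun t => ln (partf patlaw t).
Proof. by apply/funext => t; rewrite /Ktilde -PXY_partf. Qed.

Lemma hessian_covm (t : 'rV[R]_d) : hessian R k p X Y t = covm (tilt patlaw t).
Proof.
apply/matrixP => i j; rewrite mxE Ktilde_partf -(derive_meanv patlaw_gt0).
congr (derive _ t _); apply/funext => u; exact: (derive_ln_partf patlaw_gt0).
Qed.

Lemma objective_stationary (alpha : 'I_k -> R) (t : 'rV[R]_d) :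
  (forall t', objective R k p alpha X Y t' <= objective R k p alpha X Y t) ->
  forall i, meanv (tilt patlaw t) 0 i
    = if idx i \in X then 1 - alpha (idx i) else alpha (idx i).
Proof.
move=> t_max i.
apply: (stationary patlaw_gt0 (th := fun i => if idx i \in X then 1 - alpha (idx i) else alpha (idx i))).
by move=> t'; have := t_max t'; rewrite /objective Ktilde_partf.
Qed.

(** Voters are independent, so peeling off the first one is one application of the averaging
    operator. *)
Lemma sum_profiles n (f : lattice d -> R) (x : lattice d) :
  \sum_(prof : n.-tuple (ranking k)) (\prod_(v < n) p (tnth prof v))
     * f (x - \sum_(v < n) stepv (rpat (tnth prof v)))
  = iter n (wavg patlaw) f x.
Proof.
elim: n x => [|n IHn] x.
  rewrite (big_pred1 [tuple]) => [|prof]; last by apply/esym/eqP; exact: tuple0.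
  by rewrite !big_ord0 mul1r subr0.
rewrite iterS /wavg -(sum_patlaw (fun b => iter n (wavg patlaw) f (x - stepv b))).
under [RHS]eq_bigr do rewrite -IHn mulr_sumr.
rewrite pair_big /=.
rewrite (reindex (fun u : ranking k * n.-tuple (ranking k) => [tuple of u.1 :: u.2])) /=; last first.
  exists (fun prof : n.+1.-tuple (ranking k) => (thead prof, [tuple of behead prof])) => [[r prof] _|prof _] /=.
    by congr (_, _); apply/val_inj.
  by rewrite [RHS](tuple_eta prof).
apply: eq_bigr => -[r prof] _ /=; rewrite !big_ord_recl !tnth0 mulrA.
congr (_ * _ * f _); first by apply: eq_bigr => v _; rewrite tnthS.
by rewrite opprD addrA; congr (_ - _); apply: eq_bigr => v _; rewrite tnthS.
Qed.
End RankingPatterns.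

(** Change of measure: replacing x by x - b multiplies exp(-t.x) by exp(t.b), which with one factor
    [partf] turns [q0] into its tilt. For n = 0 the prefactor cancels the weights exp(t_i)^(x_i). *)
Lemma iter_wavg_tilt (R : realType) (d : nat) (q0 : pattern d -> R) (t : 'rV[R]_d)
    (N n : nat) (x : lattice d) : (forall b, 0 < q0 b) ->
  iter n (wavg q0) (weight (fun=> 1) N) x
  = partf q0 t ^+ n * expR (- \sum_i t 0 i * (x i)%:~R)
    * iter n (wavg (tilt q0 t)) (weight (fun i => expR (t 0 i)) N) x.
Proof.
move=> q0_gt0; elim: n x => [|n IHn] x.
  rewrite /= mul1r -sumrN expR_sum /weight -big_split; apply: eq_bigr => i _ /=.
  rewrite /phi1; case: ifP => [/andP[x_ge0 _]|_]; last by rewrite mulr0.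
  rewrite expr1n -expRM_natl -expRD.
  have -> : (x i)%:~R = (absz (x i))%:R :> R.
    by rewrite -[in LHS](gez0_abs x_ge0).
  by rewrite mulrC addNr expR0.
rewrite !iterS /wavg mulr_sumr; apply: eq_bigr => b _; rewrite IHn /tilt.
set u := iter _ _ _ _.
have -> : - (\sum_i t 0 i * ((x - stepv b) i)%:~R) = - (\sum_i t 0 i * (x i)%:~R) + dotp b t.
  rewrite /dotp -!sumrN -big_split; apply: eq_bigr => i _ /=.
  rewrite !ffunE rmorphB /=; lra.
rewrite expRD exprS; have := partf_gt0 q0_gt0 t.
move: (partf _ _) (expR _) (expR _) => P e1 e2 P0.
by field; rewrite gt_eqF.
Qed.

Arguments patlaw {R k} p X Y b.

(** * From the election event to the walk *)

Section Thresholds.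
Context {R : realType} {k : nat}.
Variable p : ranking k -> R.
Variable alpha : 'I_k -> R.
Hypothesis alpha01 : forall j, 0 < alpha j < 1.
Variables X Y : {set 'I_k}.
Hypothesis XY : [disjoint X & Y].
Local Notation d := #|X :|: Y|.
Local Notation idx := (XYidx k X Y).

(** For [X], more than alpha n voters with m above j means fewer than (1 - alpha) n with j above m;
    the largest integer strictly below a real is its ceiling minus 1. For [Y], the voters with m
    above j are counted directly, with a weak inequality. *)
Definition threshold (n : nat) : lattice d :=
  [ffun i => if idx i \in X then Num.ceil ((1 - alpha (idx i)) * n%:R) - 1
             else Num.floor (alpha (idx i) * n%:R)].

Lemma threshold_near n i :
  `|(threshold n i)%:~R - n%:R * (if idx i \in X then 1 - alpha (idx i) else alpha (idx i))| <= 1 :> R.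
Proof.
rewrite ffunE; case: (idx i \in X).
  have := ceil_itv ((1 - alpha (idx i)) * n%:R).
  rewrite !rmorphB /= mulrC => /andP[].
  move: (Num.ceil _)%:~R => c; move: (n%:R * _) => y h1 h2; rewrite ler_norml; apply/andP; split; lra.
have := floor_itv (alpha (idx i) * n%:R).
rewrite rmorphD /=; move: (Num.floor _)%:~R => c; rewrite mulrC => /andP[].
move: (n%:R * _) => y h1 h2; rewrite ler_norml; apply/andP; split; lra.
Qed.

Lemma threshold_le n i : threshold n i <= n%:Z.
Proof.
have /andP[a0 a1] := alpha01 (idx i).
have n0 : 0 <= n%:R :> R by [].
rewrite ffunE; case: (idx i \in X).
  rewrite lerBlDr; apply: (@le_trans _ _ n%:Z); last by rewrite lerDl.
  rewrite ceil_le_int_tmp -[X in _ <= X]mul1r; apply: ler_wpM2r => //; lra.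
rewrite -(ler_int R); apply: le_trans (floor_le _) _.
by rewrite -[X in _ <= X]mul1r; apply: ler_wpM2r => //; lra.
Qed.

Lemma sum_stepv (n : nat) (b : 'I_n -> pattern d) i :
  (\sum_v stepv (b v)) i = #|[set v | b v i]|%:Z.
Proof.
have -> : #|[set v | b v i]| = (\sum_v (b v i : nat))%N.
  by rewrite -sum1dep_card big_mkcond; apply: eq_bigr => v _; case: (b v i).
by rewrite sum_ffunE -[RHS]intz sumMz; apply: eq_bigr => v _; rewrite ffunE intz.
Qed.

Lemma not_above_m (r : ranking k) j : ranks_above k r (cand_m k) (adv k j) = (j \notin above_m k r).
Proof.
rewrite inE /ranks_above -leqNgt [RHS]leq_eqVlt orb_idl // => /eqP/val_inj/perm_inj.
by move=> /(congr1 val) /= h; have := ltn_ord j; rewrite -h ltnn.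
Qed.

Lemma count_above_m n (prof : n.-tuple (ranking k)) j :
  (#|[set v | j \in above_m k (tnth prof v)]| + nb_m_above k n prof j = n)%N.
Proof.
rewrite /nb_m_above -[RHS](card_ord n) -(cardsC [set v | j \in above_m k (tnth prof v)]).
congr (_ + _)%N; apply: eq_card => v; rewrite finset.in_setC [in RHS]inE -not_above_m.
by apply/idP/idP; rewrite inE.
Qed.

Lemma event_threshold n (prof : n.-tuple (ranking k)) :
  event R k alpha X Y n prof
  = [forall i, (\sum_v stepv (rpat X Y (tnth prof v))) i <= threshold n i].
Proof.
have X_coord i : idx i \in X ->
  ((\sum_v stepv (rpat X Y (tnth prof v))) i <= threshold n i)
  = (alpha (idx i) * n%:R < (nb_m_above k n prof (idx i))%:R).
  move=> iX; rewrite sum_stepv ffunE iX lerBrDr lezD1 ceil_gt_int.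
  have -> : (nb_m_above k n prof (idx i))%:R = n%:R - #|[set v | idx i \in above_m k (tnth prof v)]|%:R :> R.
    by rewrite -[X in X%:R - _](count_above_m prof (idx i)) natrD addrAC subrr add0r.
  have -> : [set v | rpat X Y (tnth prof v) i] = [set v | idx i \in above_m k (tnth prof v)].
    by apply/setP => v; rewrite !inE ffunE iX inE.
  move: #|_| => s; rewrite -pmulrn; apply/idP/idP => h; lra.
have Y_coord i : idx i \notin X ->
  ((\sum_v stepv (rpat X Y (tnth prof v))) i <= threshold n i)
  = ((nb_m_above k n prof (idx i))%:R <= alpha (idx i) * n%:R).
  move=> iX; rewrite sum_stepv ffunE (negbTE iX) floor_ge_int_tmp /nb_m_above.
  rewrite -pmulrn; congr (_%:R <= _); apply: eq_card => v.
  rewrite [LHS]inE ffunE (negbTE iX) -not_above_m.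
  by apply/idP/idP; rewrite inE.
apply/andP/forallP => [[/forall_inP hX /forall_inP hY] i|h].
  have [iX|iX] := boolP (idx i \in X); first by rewrite X_coord // hX.
  rewrite Y_coord // hY //; have := XYidx_in i.
  by rewrite finset.in_setU (negbTE iX).
split; apply/forall_inP => j jXY.
  have [|i ij] := @XYidx_onto _ X Y j; first by rewrite finset.in_setU jXY.
  by have := h i; rewrite X_coord ij.
have [|i ij] := @XYidx_onto _ X Y j; first by rewrite finset.in_setU jXY orbT.
by have := h i; rewrite Y_coord ij // (disjointFl XY jXY).
Qed.

Lemma weight1E N (x : lattice d) :
  weight (fun=> 1 : R) N x = [forall i, 0 <= x i <= N%:Z]%:R.
Proof.
rewrite /weight; case: (boolP [forall i, _]) => [/forallP h|].
  by rewrite big1 // => i _; rewrite /phi1 h expr1n.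
rewrite negb_forall => /existsP[i hi].
by rewrite (bigD1 i) //= /phi1 (negbTE hi) mul0r.
Qed.

(** Step sums are nonnegative and thresholds at most n, so the cut-off at n + 1 never acts and the
    weight is the indicator of the event. *)
Lemma prob_event_walk n :
  prob_event R k p alpha X Y n
  = iter n (wavg (patlaw p X Y)) (weight (fun=> 1) n.+1) (threshold n).
Proof.
rewrite -sum_profiles; apply: eq_bigr => prof _; congr (_ * _).
rewrite event_threshold weight1E; congr (_%:R); congr (nat_of_bool _).
apply: eq_forallb => i.
have -> (u v : lattice d) : (u - v) i = u i - v i by rewrite !ffunE.
have := threshold_le n i.
set s := (\sum_v stepv _).
have : 0 <= s i by rewrite sum_stepv.
by move: (threshold n i) (s i) => w v; lia.
Qed.
End Thresholds.

Lemma expRM_int (R : realType) (x : R) (m : int) : expR (x * m%:~R) = expR x ^ m.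
Proof.
case: m => m; first by rewrite -pmulrn mulrC expRM_natl.
by rewrite -[RHS]/((expR x ^+ m.+1)^-1) NegzE rmorphN /= mulrN expRN -pmulrn mulrC expRM_natl.
Qed.

(** Coordinates in [C] contribute powers of 1, which leaves [S] and [Y]. The exponents are integers
    because the ceiling minus 1 is -1 at n = 0. *)
Lemma exp_threshold (R : realType) (k : nat) (alpha : 'I_k -> R) (X Y S C : {set 'I_k})
    (tau : 'rV[R]_#|X :|: Y|) (n : nat) :
    [disjoint X & Y] -> X = S :|: C -> (forall j, j \in C -> zeta_of R k X Y tau j = 1) ->
  expR (- \sum_i tau 0 i * (threshold alpha X Y n i)%:~R)
  = (\prod_(j in S) zeta_of R k X Y tau j ^ (Num.ceil ((1 - alpha j) * n%:R) - 1)
     * \prod_(j in Y) zeta_of R k X Y tau j ^ Num.floor (alpha j * n%:R))^-1.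
Proof.
move=> XY XSC zC; rewrite expRN expR_sum; congr _^-1.
pose e j := if j \in X then Num.ceil ((1 - alpha j) * n%:R) - 1 else Num.floor (alpha j * n%:R).
transitivity (\prod_(j in X :|: Y) zeta_of R k X Y tau j ^ e j).
  rewrite prod_XYidx; apply: eq_bigr => i _.
  by rewrite expRM_int ffunE /zeta_of tcoord_XYidx.
rewrite big_mkcond [in RHS]big_mkcond [X in _ = _ * X]big_mkcond -big_split.
apply: eq_bigr => j _ /=; rewrite finset.in_setU /e.
have := disjointFr XY (x := j).
have : (j \in X) = (j \in S) || (j \in C) by rewrite [in LHS]XSC finset.in_setU.
have := zC j; case: (j \in S) => /=.
  by move=> _ -> -> //; rewrite mulr1.
case: (j \in C) => [zj|_] -> jY /=; last by rewrite mul1r.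
by rewrite jY // zj // exp1rz mulr1.
Qed.

Theorem theorem8 (R : realType) (k : nat) (hk : (1 <= k)%N)
  (p : ranking k -> R) (hp_pos : forall r, 0 < p r)
  (hp_sum : \sum_(r : ranking k) p r = 1)
  (alpha : 'I_k -> R) (halpha : forall j, 0 < alpha j < 1)
  (X Y S C : {set 'I_k}) (hXY : [disjoint X & Y])
  (tau : 'rV[R]_#|X :|: Y|)
  (htau : forall t, objective R k p alpha X Y t <= objective R k p alpha X Y tau)
  (hX : X = S :|: C)
  (hS : forall j, j \in S -> zeta_of R k X Y tau j < 1)
  (hC : forall j, j \in C -> zeta_of R k X Y tau j = 1)
  (hY : forall j, j \in Y -> zeta_of R k X Y tau j < 1) :
  let zeta := zeta_of R k X Y tau in
  let H := hessian R k p X Y tau in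
  let M : 'M[R]_#|C| :=
    \matrix_(a < #|C|, b < #|C|)
      \sum_(i < #|X :|: Y|) \sum_(i' < #|X :|: Y|)
        ((XYidx k X Y i == @enum_val _ (mem C) a) &&
         (XYidx k X Y i' == @enum_val _ (mem C) b))%:R * invmx H i i' in
  asym_equiv (prob_event R k p alpha X Y)
    (fun n =>
       PXY R k p X Y zeta ^+ n
       / (\prod_(j in S) zeta j ^ (Num.ceil ((1 - alpha j) * n%:R) - 1)
          * \prod_(j in Y) zeta j ^ (Num.floor (alpha j * n%:R)))
       * (\prod_(j in S :|: Y) (1 - zeta j))^-1
       * (Num.sqrt ((2 * pi) ^+ #|X :|: Y| * n%:R ^+ #|S :|: Y| * \det H))^-1
       * fine (orthant_integral #|C|
           (fun u => (expR (- (\sum_(a < #|C|) \sum_(b < #|C|)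
                                  u (nat_of_ord a) * M a b * u (nat_of_ord b)) / 2))%:E))).
Proof.
move=> zeta H M.
pose q0 := patlaw p X Y; pose q := tilt q0 tau.
have q0_gt0 b : 0 < q0 b := patlaw_gt0 hp_pos b.
have q_gt0 b : 0 < q b := tilt_gt0 q0_gt0 tau b.
have q_sum1 : \sum_b q b = 1 := tilt_sum1 q0_gt0 tau.
have HE : H = covm q by exact: hessian_covm.
pose z i := expR (tau 0 i).
have zetaE i : zeta (XYidx k X Y i) = z i by rewrite /zeta /zeta_of tcoord_XYidx.
(* The coordinates with zeta < 1; by [notD_C] the others are those of [C], along which the Riemann
   sum is taken. *)
pose D := [set i | XYidx k X Y i \in S :|: Y].
have SX j : j \in S -> j \in X by rewrite hX finset.in_setU => ->.
have CX j : j \in C -> j \in X by rewrite hX finset.in_setU orbC => ->.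
have D_lt1 j : j \in S :|: Y -> zeta j < 1.
  by rewrite finset.in_setU => /orP[/hS|/hY].
have notD_C i : (i \notin D) = (XYidx k X Y i \in C).
  rewrite inE; set j := XYidx k X Y i; apply/idP/idP => [jSY|jC].
    have := XYidx_in i; rewrite -/j finset.in_setU [in j \in X]hX.
    by move: jSY; rewrite !finset.in_setU; case: (j \in S); case: (j \in C); case: (j \in Y).
  by apply/negP => /D_lt1; rewrite /zeta hC // ltxx.
have [iota iotaE] : exists iota : 'I_#|C| -> 'I_#|X :|: Y|,
    forall a, XYidx k X Y (iota a) = @enum_val _ (mem C) a.
  apply: (@fin_all_exists _ _ (fun a i => XYidx k X Y i = @enum_val _ (mem C) a)) => a.
  by apply: XYidx_onto; rewrite finset.in_setU CX // enum_valP.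
have iota_inj : injective iota.
  by move=> a b /(congr1 (XYidx k X Y)); rewrite !iotaE => /enum_val_inj.
have iota_im i : (i \notin D) = [exists a, iota a == i].
  rewrite notD_C; apply/idP/existsP => [iC|[a /eqP <-]]; last by rewrite iotaE enum_valP.
  by exists (enum_rank_in iC (XYidx k X Y i)); apply/eqP/(@XYidx_inj _ X Y); rewrite iotaE enum_rankK_in.
have imD : XYidx k X Y @: D = S :|: Y.
  apply/setP => j; apply/imsetP/idP => [[i iD ->]|jSY]; first by rewrite inE in iD.
  have [|i ij] := @XYidx_onto _ X Y j.
    by move: jSY; rewrite !finset.in_setU => /orP[/SX ->|->]; rewrite ?orbT.
  by exists i => //; rewrite inE ij.
have cardD : #|D| = #|S :|: Y| by rewrite -imD card_imset //; exact: XYidx_inj.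
have prodD : \prod_(i in D) (1 - z i)^-1 = (\prod_(j in S :|: Y) (1 - zeta j))^-1.
  rewrite prodfV -imD big_imset /=; last by move=> i i' _ _; exact: XYidx_inj.
  by congr _^-1; apply: eq_bigr => i _; rewrite zetaE.
(* The indicators in [M] select one entry of the inverse Hessian, so [M] is the block of [precm q]
   indexed by [iota]. *)
have ME a b : M a b = precm q (iota a) (iota b).
  rewrite mxE (bigD1 (iota a)) //= (bigD1 (iota b)) //= !iotaE !eqxx mul1r HE.
  rewrite [X in _ + X + _]big1 => [|i' i'b]; last first.
    by rewrite -iotaE (inj_eq (@XYidx_inj _ X Y)) (negbTE i'b) andbF mul0r.
  rewrite addr0 big1 ?addr0 // => i ia; apply: big1 => i' _.
  by rewrite -iotaE (inj_eq (@XYidx_inj _ X Y)) (negbTE ia) mul0r.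
have GE : fine (orthant_integral #|C|
    (fun u => (expR (- (\sum_(a < #|C|) \sum_(b < #|C|)
                u (nat_of_ord a) * M a b * u (nat_of_ord b)) / 2))%:E))
    = gauss_orthant iota q.
  rewrite /gauss_orthant; congr (fine (orthant_integral _ _)); apply/funext => u.
  rewrite /gorthant /gprofile (qform_emb iota_inj iota_im); congr (expR (- _ / 2))%:E.
  by apply: eq_bigr => a _; apply: eq_bigr => b _; rewrite ME.
have z_D i : i \in D -> z i < 1 by rewrite inE => /D_lt1; rewrite zetaE.
have z_C i : i \notin D -> z i = 1 by rewrite notD_C => /hC; rewrite -/zeta zetaE.
have w_near n i : `|(threshold alpha X Y n i)%:~R - n%:R * meanv q 0 i| <= 1.
  by rewrite (objective_stationary hp_pos hXY htau); exact: threshold_near.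
have := local_limit (fun i => ltW (expR_gt0 _)) z_D z_C iota_inj iota_im q_gt0 q_sum1 w_near.
have G_gt0 := gauss_orthant_gt0 iota_inj iota_im q_gt0 q_sum1.
have V_gt0 : 0 < Num.sqrt ((2 * pi) ^+ #|X :|: Y| * \det (covm q)) :> R.
  by rewrite sqrtr_gt0 mulr_gt0 ?exprn_gt0 ?mulr_gt0 ?pi_gt0 // det_covm_gt0.
have W_gt0 : 0 < \prod_(i in D) (1 - z i)^-1.
  by apply: prodr_gt0 => i /z_D zi; rewrite invr_gt0 subr_gt0.
set W := \prod_(i in D) _ in W_gt0 *; set G := gauss_orthant _ _ in G_gt0 *.
set V := Num.sqrt _ in V_gt0 *; set A := (fun n : nat => _ * _) => A_lim.
have L_neq0 : W * G / V != 0 by rewrite gt_eqF // !mulr_gt0 // invr_gt0.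
have : ((fun n => A n / (W * G / V)) @ \oo --> (1 : R))%classic.
  by rewrite -(divff L_neq0); apply: cvgMl.
(* For n >= 1, where sqrt n is nonzero, the ratio is exactly the normalised walk value divided by
   its limit: the n-th power of the polynomial and the powers of zeta cancel. *)
apply: cvg_trans; apply: near_eq_cvg; near=> n.
rewrite GE -/G (prob_event_walk _ halpha hXY) (iter_wavg_tilt tau _ _ _ q0_gt0).
rewrite (exp_threshold _ _ hXY hX hC) -/zeta -prodD -/W /zeta (PXY_partf _ hXY) -/zeta -/q0 -/q.
rewrite HE /A cardD.
have n_gt0 : 0 < n%:R :> R by rewrite ltr0n; near: n; exists 1%N.
have -> : Num.sqrt ((2 * pi) ^+ #|X :|: Y| * n%:R ^+ #|S :|: Y| * \det (covm q))
    = Num.sqrt n%:R ^+ #|S :|: Y| * V.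
  rewrite mulrAC mulrC sqrtrM ?exprn_ge0 //; congr (_ * _).
  by rewrite -{1}[n%:R]sqr_sqrtr // -exprM mulnC exprM sqrtr_sqr ger0_norm // exprn_ge0 // sqrtr_ge0.
set P := partf _ _ ^+ n; set B := (_ * \prod_(j in Y) _)^-1; set I := iter _ _ _ _.
have P0 : P != 0 by rewrite expf_neq0 // gt_eqF // partf_gt0.
have B0 : B != 0 by rewrite /B /zeta -(exp_threshold _ _ hXY hX hC) gt_eqF // expR_gt0.
have n0 : Num.sqrt n%:R ^+ #|S :|: Y| != 0 :> R by rewrite expf_neq0 // gt_eqF // sqrtr_gt0.
clearbody P B I W G V; move: P0 B0 n0; move: (Num.sqrt n%:R ^+ _) => s P0 B0 s0.
by field; rewrite P0 B0 s0 !gt_eqF.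
Unshelve. all: end_near.
Qed.
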